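(* Let $b\in WAP(\mathbb{R}^2;\mathbb{R})$ have mean value $b_0\neq0$, and let $H$ be the two-dimensional Pauli operator with magnetic field $b$ and zero electric potential. Then $\dim\operatorname{Ker}H=\infty$.
   Context: $CAP(\mathbb{R}^2)$ is the closure, in the space of bounded continuous functions on $\mathbb{R}^2$ with the sup norm, of the linear span of $e_\lambda(x)=e^{i\lambda\cdot x}$, $\lambda\in\mathbb{R}^2$. For $f\in CAP(\mathbb{R}^2)$, $f_\lambda=\lim_{T\to\infty}T^{-2}\int_{(-T/2,T/2)^2}f(x)e^{-i\lambda\cdot x}dx$; $f_0$ is the mean value of $f$. $WAP(\mathbb{R}^2;\mathbb{R})$ is the set of real-valued $f\in CAP(\mathbb{R}^2)$ with $\sum_{\lambda:\,f_\lambda\ne0}|f_\lambda|<\infty$. Pauli operator: for a bounded continuous $b:\mathbb{R}^2\to\mathbb{R}$ choose $A=(A_1,A_2)\in C^1(\mathbb{R}^2;\mathbb{R}^2)$ with $\partial_{x_1}A_2-\partial_{x_2}A_1=b$, let $h=(-i\nabla-A)^2$ be the self-adjoint operator in $L^2(\mathbb{R}^2)$ generated by the closure of the form $\int_{\mathbb{R}^2}|i\nabla u+Au|^2dx$, $u\in C_0^\infty(\mathbb{R}^2)$, and put $H=\begin{pmatrix}h-b&0\\0&h+b\end{pmatrix}$ in $L^2(\mathbb{R}^2;\mathbb{C}^2)$. Different choices of $A$ give unitarily equivalent operators (gauge invariance), so $\dim\operatorname{Ker}H$ depends only on $b$. *)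

(* Defs.v *)
From HB Require Import structures.
From mathcomp Require Import all_boot all_order all_algebra.
From mathcomp Require Import complex.
From mathcomp Require Import all_classical all_reals all_analysis.

Set Implicit Arguments.
Unset Strict Implicit.
Unset Printing Implicit Defensive.

Import Order.TTheory GRing.Theory Num.Theory.
Import numFieldNormedType.Exports.

Local Open Scope classical_set_scope.
Local Open Scope ring_scope.

Notation cabs := ComplexField.Normc.normc.

Section Integration.
Context {R : realType}.

Definition leb2 := (@lebesgue_measure R \x @lebesgue_measure R)%E.

Definition Cintegral (D : set (R * R)) (f : R * R -> R[i]) : R[i] :=
  ((\int[leb2]_(x in D) complex.Re (f x))
     +i* (\int[leb2]_(x in D) complex.Im (f x)))%C.

(* Measurability is with respect to the product Borel sigma-algebra; up to
   equality almost everywhere this gives the usual L^2. *)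
Definition in_L2 (u : R * R -> R[i]) : Prop :=
  [/\ measurable_fun [set: R * R] (fun x => complex.Re (u x)),
      measurable_fun [set: R * R] (fun x => complex.Im (u x)) &
      leb2.-integrable setT (fun x => (cabs (u x) ^+ 2)%:E)].

Definition L2dot (u v : R * R -> R[i]) : R[i] :=
  Cintegral setT (fun x => u x * (v x)^*).

Definition L2normsq (u : R * R -> R[i]) : R :=
  \int[leb2]_x (cabs (u x) ^+ 2).

End Integration.

Section AlmostPeriodic.
Context {R : realType}.

Definition dot2 (l x : R * R) : R := l.1 * x.1 + l.2 * x.2.

Definition expi (t : R) : R[i] := (cos t +i* sin t)%C.

(* The topology of R[i] is that of the alias R[i]^o. *)
Definition CAP (f : R * R -> R[i]) : Prop :=
  [/\ continuous (f : R * R -> R[i]^o),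
      exists M : R, forall x, cabs (f x) <= M &
      forall eps : R, 0 < eps ->
        exists s : seq (R[i] * (R * R)), forall x,
          cabs (f x - \sum_(p <- s) p.1 * expi (dot2 p.2 x)) <= eps].

Definition open_square (T : R) : set (R * R) :=
  `](- (T / 2)), (T / 2)[%classic `*` `](- (T / 2)), (T / 2)[%classic.

Definition fourier_coef (f : R * R -> R[i]) (l : R * R) : R[i] :=
  lim ((fun T : R => ((T ^- 2)%:C)%C *
          Cintegral (open_square T) (fun x => f x * expi (- dot2 l x)) : R[i]^o)
       @ +oo).

Definition mean_value (f : R * R -> R[i]) : R[i] := fourier_coef f 0.

Definition toC (b : R * R -> R) : R * R -> R[i] := fun x => ((b x)%:C)%C.

Definition WAP (b : R * R -> R) : Prop :=
  CAP (toC b) /\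
  (\esum_(l in [set l | fourier_coef (toC b) l != 0%R])
     (cabs (fourier_coef (toC b) l))%:E < +oo)%E.

End AlmostPeriodic.

Section Derivatives.
Context {R : realType}.

Definition e1 : R * R := (1, 0).
Definition e2 : R * R := (0, 1).

Fixpoint Ck (k : nat) (g : R * R -> R) : Prop :=
  if k is k'.+1 then
    [/\ continuous g,
        forall x, derivable g x e1, forall x, derivable g x e2,
        Ck k' ('D_e1 g) & Ck k' ('D_e2 g)]
  else continuous g.

Definition Cc_smooth (u : R * R -> R[i]) : Prop :=
  [/\ forall k, Ck k (fun x => complex.Re (u x)),
      forall k, Ck k (fun x => complex.Im (u x)) &
      compact (closure [set x | u x != 0])].

Definition Cderive (e : R * R) (u : R * R -> R[i]) (x : R * R) : R[i] :=
  ('D_e (fun y => complex.Re (u y)) x +i* 'D_e (fun y => complex.Im (u y)) x)%C.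

End Derivatives.

Section Pauli.
Context {R : realType}.
Variables (A : R * R -> R * R) (b : R * R -> R).

Definition C1_potential : Prop :=
  Ck 1 (fun x => (A x).1) /\ Ck 1 (fun x => (A x).2).

Definition curl (x : R * R) : R :=
  'D_e1 (fun y => (A y).2) x - 'D_e2 (fun y => (A y).1) x.

Definition mag_grad1 (u : R * R -> R[i]) (x : R * R) : R[i] :=
  ((0 +i* 1) * Cderive e1 u x + ((A x).1)%:C * u x)%C.
Definition mag_grad2 (u : R * R -> R[i]) (x : R * R) : R[i] :=
  ((0 +i* 1) * Cderive e2 u x + ((A x).2)%:C * u x)%C.

Definition mag_energy (u : R * R -> R[i]) : R :=
  \int[leb2]_x (cabs (mag_grad1 u x) ^+ 2 + cabs (mag_grad2 u x) ^+ 2).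

(* The sesquilinear form, linear in the first argument, whose quadratic form
   is mag_energy. *)
Definition mag_form (u v : R * R -> R[i]) : R[i] :=
  Cintegral setT (fun x => mag_grad1 u x * (mag_grad1 v x)^*
                         + mag_grad2 u x * (mag_grad2 v x)^*).

Definition form_approx (u : R * R -> R[i]) (un : nat -> R * R -> R[i]) : Prop :=
  [/\ forall n, Cc_smooth (un n),
      L2normsq (fun x => un n x - u x) @[n --> \oo] --> (0 : R) &
      forall eps : R, 0 < eps -> exists N : nat, forall n m : nat,
        (N <= n)%N -> (N <= m)%N ->
        mag_energy (fun x => un n x - un m x) < eps].

Definition form_dom (u : R * R -> R[i]) : Prop :=
  in_L2 u /\ exists un, form_approx u un.

(* closed_form u v z: the closure of mag_form takes the value z at (u, v).  As
   mag_form is closable, z does not depend on the approximating sequences. *)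
Definition closed_form (u v : R * R -> R[i]) (z : R[i]) : Prop :=
  exists un vn, [/\ form_approx u un, form_approx v vn &
    (mag_form (un n) (vn n) : R[i]^o) @[n --> \oo] --> (z : R[i]^o)].

(* mag_op u w: u is in the domain of h = (-i nabla - A)^2 and h u = w, where h is
   the self-adjoint operator associated with the closed form. *)
Definition mag_op (u w : R * R -> R[i]) : Prop :=
  [/\ form_dom u, in_L2 w &
      forall v, form_dom v -> closed_form u v (L2dot w v)].

(* The graph of H = diag(h - b, h + b); for bounded b its domain is two copies
   of the domain of h. *)
Definition pauli_op (U W : R * R -> R[i] * R[i]) : Prop :=
  exists w1 w2 : R * R -> R[i],
    [/\ mag_op (fun x => (U x).1) w1, mag_op (fun x => (U x).2) w2 &
        {ae leb2, forall x,
           W x = (w1 x - toC b x * (U x).1, w2 x + toC b x * (U x).2)}].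

Definition pauli_ker (U : R * R -> R[i] * R[i]) : Prop :=
  pauli_op U (fun=> 0).

(* Elements of L^2 are represented by functions, so linear independence is
   understood modulo equality almost everywhere. *)
Definition pauli_ker_infinite_dim : Prop :=
  forall n : nat, exists U : 'I_n -> R * R -> R[i] * R[i],
    (forall i, pauli_ker (U i)) /\
    forall c : 'I_n -> R[i],
      {ae leb2, forall x, \sum_(i < n) c i *: U i x = 0} ->
      forall i, c i = 0.

End Pauli.

(* Main.v *)
Require Import Defs.
From HB Require Import structures.
From mathcomp Require Import all_boot all_order all_algebra.
From mathcomp Require Import complex.
From mathcomp Require Import all_classical all_reals all_analysis.
From mathcomp Require Import measurable_realfun.
From mathcomp Require finmap.
From mathcomp Require Import ring lra.

Set Implicit Arguments.
Unset Strict Implicit.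
Unset Printing Implicit Defensive.

Import Order.TTheory GRing.Theory Num.Theory.
Import numFieldNormedType.Exports.
Local Open Scope classical_set_scope.
Local Open Scope ring_scope.

(* Let sg be the sign of b_0 and z = x_1 + i sg x_2.  Since the Fourier
   coefficients are summable, b is b_0 plus an absolutely convergent series of
   waves of nonzero frequencies l; a continuous almost periodic function with
   vanishing Fourier coefficients is zero, by averaging against Fejer kernels.
   Solving Laplace phi = b term by term (each term divided by |l|^2 and
   corrected by an affine function, so that the series still converges when
   the frequencies accumulate at 0) gives phi = b_0 |x|^2 / 4 + o(|x|^2).  Up
   to a gauge A = (- d_2 phi, d_1 phi), and as Aharonov and Casher observed the
   functions z^k exp (- sg phi) are annihilated by the first order operator
   L = (i d_1 + A_1) + i sg (i d_2 + A_2); they have Gaussian decay.  As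
   h - sg b = L^* L, they lie in the kernel of one component of H.  To see that
   they are in the domain of h, one approximates them by cut-off Bernstein
   polynomials u_n with L u_n -> 0 in L^2. *)

(** The form domain is a closure of smooth compactly supported functions, whereas [A] is merely C^1,
    so the zero modes are only known to be C^1 and a cut-off alone does not smooth them. Hence the
    polynomial approximation in C^1 on growing squares, with an error small enough to beat both the
    area of the square and the size of [A] on it. For bounded b, the identity h = L^* L + sg b
    bounds the energy of u by the L^2 norms of L u and u. So u_n -> u and L u_n -> 0 already make
    u_n Cauchy in energy. For v in the form domain with approximants v_n, the functions L v_n stay
    bounded, and the form at (u_n, v_n) tends to sg <b u, v>, which is the weak form of h u = sg b
    u. The error o(|x|^2) in phi is harmless because it only lowers the Gaussian rate; it holds
    because the tail of the series costs at most e |x|^2, while each single corrected wave, divided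
    by a fixed |l|^2, grows at most linearly. All integrals are taken on real parts: the imaginary
    part of the form at (u, v) is its real part at (-i u, v). *)

Section PartialDerivatives.
Context {R : realType}.
Implicit Types (f g : R * R -> R) (x y s : R).

Lemma is_derive_e1P f x y df :
  is_derive (x, y) e1 f df <-> is_derive x 1 (fun s => f (s, y)) df.
Proof.
have E : (fun h : R => h^-1 *: ((f \o shift (x, y)) (h *: e1) - f (x, y))) =
   (fun h : R => h^-1 *: (((fun s => f (s, y)) \o shift x) (h *: (1 : R)) - f (x, y))).
  by apply/funext => h /=; congr (_ *: (f _ - _));
    rewrite /e1; congr (_, _); rewrite /= /GRing.scale/= ?mulr0 ?add0r.
split=> -[dx vx]; split.
- by move: dx; rewrite /derivable E.
- by move: vx; rewrite /derive E.
- by move: dx; rewrite /derivable E.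
- by move: vx; rewrite /derive E.
Qed.

Lemma is_derive_e2P f x y df :
  is_derive (x, y) e2 f df <-> is_derive y 1 (fun s => f (x, s)) df.
Proof.
have E : (fun h : R => h^-1 *: ((f \o shift (x, y)) (h *: e2) - f (x, y))) =
   (fun h : R => h^-1 *: (((fun s => f (x, s)) \o shift y) (h *: (1 : R)) - f (x, y))).
  by apply/funext => h /=; congr (_ *: (f _ - _));
    rewrite /e2; congr (_, _); rewrite /= /GRing.scale/= ?mulr0 ?add0r.
split=> -[dx vx]; split.
- by move: dx; rewrite /derivable E.
- by move: vx; rewrite /derive E.
- by move: dx; rewrite /derivable E.
- by move: vx; rewrite /derive E.
Qed.

End PartialDerivatives.

(** * Calculus of directional derivatives of real functions *)

Section ChainRule.
Context {R : realType} {V : normedModType R}.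
Implicit Types (f g : V -> R) (x v : V).

(** Both difference quotients are literally the same function of [h]; the one-variable chain rule
    thereby becomes available for derivatives along [v]. *)
Lemma is_derive_lineP f x v df :
  is_derive x v f df <-> is_derive (0 : R) 1 (fun t => f (t *: v + x)) df.
Proof.
have E : (fun h : R => h^-1 *: ((f \o shift x) (h *: v) - f x)) =
   (fun h : R => h^-1 *: (((fun t => f (t *: v + x)) \o shift (0:R)) (h *: (1 : R))
      - f ((0:R) *: v + x))).
  by apply/funext => h /=; rewrite scale0r add0r addr0 /GRing.scale/= mulr1.
split=> -[dx vx]; split.
- by move: dx; rewrite /derivable E.
- by move: vx; rewrite /derive E.
- by move: dx; rewrite /derivable E.
- by move: vx; rewrite /derive E.
Qed.

Lemma is_derive_chain (h : R -> R) f x v df dh :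
  is_derive x v f df -> is_derive (f x) 1 h dh -> is_derive x v (fun y => h (f y)) (dh * df).
Proof.
move=> /is_derive_lineP Hf Hh; apply/is_derive_lineP.
have Hh' : is_derive (f (0 *: v + x)) 1 h dh by rewrite scale0r add0r.
rewrite (_ : (fun t => _) = h \o (fun t => f (t *: v + x)))//.
exact: is_derive1_comp.
Qed.

Lemma is_derive_mul f g x v df dg :
  is_derive x v f df -> is_derive x v g dg ->
  is_derive x v (fun y => f y * g y) (df * g x + f x * dg).
Proof.
move=> Hf Hg; have -> : (fun y => f y * g y) = f * g by apply/funext.
apply: is_derive_eq (is_deriveM Hf Hg) _.
by rewrite /GRing.scale/= addrC [_ * df]mulrC.
Qed.

Lemma is_derive_add f g x v df dg :
  is_derive x v f df -> is_derive x v g dg ->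
  is_derive x v (fun y => f y + g y) (df + dg).
Proof.
move=> Hf Hg; have -> : (fun y => f y + g y) = f + g by apply/funext.
exact: is_deriveD.
Qed.

Lemma is_derive_opp f x v df :
  is_derive x v f df -> is_derive x v (fun y => - f y) (- df).
Proof.
move=> Hf; have -> : (fun y => - f y) = - f by apply/funext.
exact: is_deriveN.
Qed.

Lemma is_derive_sub f g x v df dg :
  is_derive x v f df -> is_derive x v g dg ->
  is_derive x v (fun y => f y - g y) (df - dg).
Proof. by move=> Hf Hg; apply: is_derive_add => //; apply: is_derive_opp. Qed.

Lemma is_derive_cmul f c x v df :
  is_derive x v f df -> is_derive x v (fun y => c * f y) (c * df).
Proof.
move=> Hf; rewrite -[c * df]add0r -[0](mul0r (f x)).
by apply: is_derive_mul => //; apply: is_derive_cst.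
Qed.

End ChainRule.

(** * Closure properties of the classes [Ck] *)

Section Ck.
Context {R : realType}.
Implicit Types (f g : R * R -> R) (x v : R * R).

Lemma is_derive_fst x v : is_derive x v (fst : R * R -> R) v.1.
Proof.
apply/is_derive_lineP.
rewrite (_ : (fun t => _) = (fun t : R => t * v.1 + x.1)); last by apply/funext.
apply: (@is_derive_eq _ _ _ _ _ _ _ (1 * v.1 + 0 * 0 + 0)); last by rewrite mul1r mul0r !addr0.
by apply: is_derive_add; apply: is_derive_mul.
Qed.

Lemma is_derive_snd x v : is_derive x v (snd : R * R -> R) v.2.
Proof.
apply/is_derive_lineP.
rewrite (_ : (fun t => _) = (fun t : R => t * v.2 + x.2)); last by apply/funext.
apply: (@is_derive_eq _ _ _ _ _ _ _ (1 * v.2 + 0 * 0 + 0)); last by rewrite mul1r mul0r !addr0.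
by apply: is_derive_add; apply: is_derive_mul.
Qed.

Lemma Ck_continuous k f : Ck k f -> continuous f.
Proof. by case: k => //= k []. Qed.

Lemma Ck_is_derive1 k f : Ck k.+1 f -> forall x, is_derive x e1 f ('D_e1 f x).
Proof. by move=> [_ H _ _ _] x; apply/derivableP. Qed.

Lemma Ck_is_derive2 k f : Ck k.+1 f -> forall x, is_derive x e2 f ('D_e2 f x).
Proof. by move=> [_ _ H _ _] x; apply/derivableP. Qed.

(** [Ck] is phrased with the total functions ['D_e1 f] and ['D_e2 f]; uniqueness of derivatives
    identifies them with explicitly computed partials. *)
Lemma Ck_intro k f f1 f2 : continuous f ->
  (forall x, is_derive x e1 f (f1 x)) -> (forall x, is_derive x e2 f (f2 x)) ->
  Ck k f1 -> Ck k f2 -> Ck k.+1 f.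
Proof.
move=> cf d1 d2 c1 c2.
have E1 : 'D_e1 f = f1 by apply/funext => x; apply: derive_val.
have E2 : 'D_e2 f = f2 by apply/funext => x; apply: derive_val.
by split; rewrite ?E1 ?E2// => x; apply: ex_derive.
Qed.

Lemma CkS k f : Ck k.+1 f -> Ck k f.
Proof.
elim: k f => [f []//|k ih f [cf d1 d2 c1 c2]].
by split; [exact: cf|exact: d1|exact: d2|exact: ih c1|exact: ih c2].
Qed.

Lemma Ck_cst k (c : R) : Ck k (fun=> c).
Proof.
elim: k c => [c|k ih c]; first by move=> x; apply: cvg_cst.
apply: (@Ck_intro k _ (fun=> 0) (fun=> 0)).
- by move=> x; apply: cvg_cst.
- exact: (ih 0).
- exact: (ih 0).
Qed.

Lemma Ck_fst k : Ck k (fst : R * R -> R).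
Proof.
case: k => [|k]; first by move=> x; apply: cvg_fst.
apply: (@Ck_intro k _ (fun=> 1) (fun=> 0)); try exact: Ck_cst.
- by move=> x; apply: cvg_fst.
- by move=> x; apply: is_derive_fst.
- by move=> x; apply: is_derive_fst.
Qed.

Lemma Ck_snd k : Ck k (snd : R * R -> R).
Proof.
case: k => [|k]; first by move=> x; apply: cvg_snd.
apply: (@Ck_intro k _ (fun=> 0) (fun=> 1)); try exact: Ck_cst.
- by move=> x; apply: cvg_snd.
- by move=> x; apply: is_derive_snd.
- by move=> x; apply: is_derive_snd.
Qed.

Lemma Ck_add k f g : Ck k f -> Ck k g -> Ck k (fun x => f x + g x).
Proof.
elim: k f g => [f g cf cg x|k ih f g Cf Cg]; first exact: cvgD (cf x) (cg x).
apply: (@Ck_intro k _ (fun x => 'D_e1 f x + 'D_e1 g x) (fun x => 'D_e2 f x + 'D_e2 g x)).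
- by move=> x; apply: cvgD; [exact: Ck_continuous Cf x|exact: Ck_continuous Cg x].
- by move=> x; apply: is_derive_add; [exact: Ck_is_derive1 Cf x|exact: Ck_is_derive1 Cg x].
- by move=> x; apply: is_derive_add; [exact: Ck_is_derive2 Cf x|exact: Ck_is_derive2 Cg x].
- by case: Cf Cg => [_ _ _ Df _] [_ _ _ Dg _]; exact: ih Df Dg.
- by case: Cf Cg => [_ _ _ _ Df] [_ _ _ _ Dg]; exact: ih Df Dg.
Qed.

Lemma Ck_mul k f g : Ck k f -> Ck k g -> Ck k (fun x => f x * g x).
Proof.
elim: k f g => [f g cf cg x|k ih f g Cf Cg]; first exact: cvgM (cf x) (cg x).
apply: (@Ck_intro k _ (fun x => 'D_e1 f x * g x + f x * 'D_e1 g x)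
   (fun x => 'D_e2 f x * g x + f x * 'D_e2 g x)).
- by move=> x; apply: cvgM; [exact: Ck_continuous Cf x|exact: Ck_continuous Cg x].
- by move=> x; apply: is_derive_mul; [exact: Ck_is_derive1 Cf x|exact: Ck_is_derive1 Cg x].
- by move=> x; apply: is_derive_mul; [exact: Ck_is_derive2 Cf x|exact: Ck_is_derive2 Cg x].
- have [[_ _ _ Df _] [_ _ _ Dg _]] := (Cf, Cg).
  by apply: Ck_add; [exact: ih Df (CkS Cg)|exact: ih (CkS Cf) Dg].
- have [[_ _ _ _ Df] [_ _ _ _ Dg]] := (Cf, Cg).
  by apply: Ck_add; [exact: ih Df (CkS Cg)|exact: ih (CkS Cf) Dg].
Qed.

Lemma Ck_cmul k c f : Ck k f -> Ck k (fun x => c * f x).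
Proof. by move=> Cf; apply: Ck_mul => //; apply: Ck_cst. Qed.

Lemma Ck_opp k f : Ck k f -> Ck k (fun x => - f x).
Proof.
move=> /(Ck_cmul (-1)); congr (Ck _ _); apply/funext => x.
by rewrite mulN1r.
Qed.

Lemma Ck_sub k f g : Ck k f -> Ck k g -> Ck k (fun x => f x - g x).
Proof. by move=> Cf Cg; apply: Ck_add => //; apply: Ck_opp. Qed.

(** Regularity is asked of the composite with [h'], one order lower, so that a family of outer
    functions closed under differentiation can be treated by induction on [k]. *)
Lemma Ck_comp k (h h' : R -> R) f : (forall t : R, is_derive t 1 h (h' t)) ->
  Ck k.+1 f -> Ck k (fun x => h' (f x)) -> Ck k.+1 (fun x => h (f x)).
Proof.
move=> dh Cf Ch'; have [_ _ _ C1 C2] := Cf.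
apply: (@Ck_intro k _ (fun x => h' (f x) * 'D_e1 f x) (fun x => h' (f x) * 'D_e2 f x)).
- move=> x; apply: continuous_comp; first exact: (Ck_continuous Cf).
  by apply: differentiable_continuous; apply/derivable1_diffP; apply: ex_derive.
- by move=> x; apply: is_derive_chain; apply: Ck_is_derive1 Cf _.
- by move=> x; apply: is_derive_chain; apply: Ck_is_derive2 Cf _.
- exact: Ck_mul Ch' C1.
- exact: Ck_mul Ch' C2.
Qed.

Lemma C1_comp (h h' : R -> R) f : (forall t : R, is_derive t 1 h (h' t)) ->
  continuous h' -> Ck 1 f -> Ck 1 (fun x => h (f x)).
Proof.
move=> dh ch Cf; apply: (Ck_comp dh Cf).
move=> x; apply: continuous_comp; first exact: (Ck_continuous Cf).
exact: ch.
Qed.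

End Ck.

(** * Smooth functions that are flat at the origin *)

Section Bump.
Context {R : realType}.

(** Induction on the size, splitting off the top monomial, with y^n <= n! e^y from the exponential
    series. It serves both for flatness at 0 and for the Gaussian decay of the zero modes. *)
Lemma exp_poly_bound (p : {poly R}) :
  exists C : R, forall y, 0 <= y -> `|p.[y]| <= C * expR y.
Proof.
suff H n (q : {poly R}) : (size q <= n)%N ->
    exists C : R, 0 <= C /\ forall y, 0 <= y -> `|q.[y]| <= C * expR y.
  by have [C [_ HC]] := H _ p (leqnn _); exists C.
elim: n q => [q|n ih q sq].
  rewrite leqn0 size_poly_eq0 => /eqP ->; exists 0; split => // y _.
  by rewrite horner0 normr0 mul0r.
have [C [C0 HC]] := ih (take_poly n q) (size_take_poly _ _).
exists (C + `|q`_n| * n`!%:R); split; first by rewrite addr_ge0 ?mulr_ge0.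
move=> y y0.
have E : q = take_poly n q + q`_n *: 'X^n.
  rewrite -[LHS](poly_take_drop n); congr (_ + _).
  have -> : drop_poly n q = (q`_n)%:P.
    have s1 : (size (drop_poly n q) <= 1)%N by rewrite size_drop_poly leq_subLR addn1.
    by rewrite [LHS]size1_polyC// coef_drop_poly add0n.
  by rewrite mul_polyC.
rewrite {1}E hornerD hornerZ hornerXn.
apply: (le_trans (ler_normD _ _)); rewrite mulrDl lerD ?HC//.
rewrite normrM -mulrA ler_wpM2l// ger0_norm ?exprn_ge0//.
case: (n) => [|m]; first by rewrite expr0 mul1r -expR0 ler_expR.
have := expR_ge1Dxn m y0 => /(le_trans _) H.
rewrite mulrC -ler_pdivrMr ?ltr0n ?fact_gt0//; apply: H.
by rewrite lerDr.
Qed.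

(** The polynomial parameter makes the family closed under differentiation, so that smoothness of
    the classical function e^(-1/s) follows by induction. *)
Definition flat (p : {poly R}) (s : R) : R :=
  if 0 < s then p.[s^-1] * expR (- s^-1) else 0.

(** The exponential bound applied to [p * 'X^2] at 1/s gains the factor s^2. Quadratic vanishing is
    what yields derivative 0 at the origin. *)
Lemma flat_bound (p : {poly R}) : exists C : R, forall s, `|flat p s| <= C * s ^+ 2.
Proof.
have [C HC] := exp_poly_bound (p * 'X^2).
have C0 : 0 <= C.
  by have := HC 0 (lexx _); rewrite expR0 mulr1; apply: le_trans.
exists C => s; rewrite /flat; case: ifPn => s0; last by rewrite normr0 mulr_ge0 ?sqr_ge0.
have is0 : 0 < s^-1 by rewrite invr_gt0.
rewrite normrM (gtr0_norm (expR_gt0 _)) expRN ler_pdivrMr ?expR_gt0//.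
have := HC _ (ltW is0); rewrite hornerM hornerXn normrM [X in _ * X]ger0_norm ?(exprn_ge0 _ (ltW is0))//.
rewrite exprVn ler_pdivrMr ?exprn_gt0//.
by rewrite mulrAC.
Qed.

(** With y = 1/s, d/ds = - y^2 d/dy turns p(y) e^(-y) into y^2 (p - p')(y) e^(-y). To the left of 0
    the function is locally zero. *)
Lemma is_derive_flat (p : {poly R}) (s : R) :
  is_derive s 1 (flat p) (flat ('X^2 * (p - p^`())) s).
Proof.
have [s0|s0|->] := ltgtP s 0.
- rewrite {2}/flat ltNge (ltW s0)/=.
  apply: (@near_eq_is_derive _ _ _ (fun=> 0)) (is_derive_cst _ _ _).
  near=> t; rewrite /flat; case: ifPn => [t0|//].
  suff : t < 0 by rewrite ltNge (ltW t0).
  by near: t; apply: lt_nbhsl.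
- rewrite {2}/flat s0.
  apply: (@near_eq_is_derive R R R (fun t : R => p.[t^-1] * expR (- t^-1))).
  - by near=> t; rewrite /flat ifT//; near: t; apply: lt_nbhsr.
  have dV : is_derive s 1 (fun t : R => t^-1) (- s ^- 2).
    apply: is_derive_eq (@is_deriveV _ id s 1 1 _ _) _ => //; first by rewrite gt_eqF.
    by rewrite /GRing.scale/= mulr1.
  have D := is_derive_mul (is_derive_chain dV (is_derive_poly p s^-1))
    (is_derive_chain (is_derive_opp dV) (is_derive_expR (- s^-1))).
  apply: is_derive_eq D _.
  by rewrite hornerM hornerD hornerN hornerXn exprVn; ring.
- have [C HC] := flat_bound p.
  rewrite {2}/flat ltxx.
  have f0 : flat p 0 = 0 by rewrite /flat ltxx.
  have C0 : 0 <= C by have := HC 1; rewrite expr1n mulr1; apply: le_trans.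
  (* By [flat_bound] the quotient at 0 lies between - C |h| and C |h|. *)
  have L : (fun h : R => h^-1 *: ((flat p \o shift (0:R)) (h *: (1:R)) - flat p 0)) @ 0^' --> (0:R).
    rewrite f0.
    have cn : (fun h : R => C * `|h|) @ 0^' --> (0 : R).
      rewrite -[X in _ --> X](mulr0 C); apply: cvgM; first exact: cvg_cst.
      apply/cvgrPdist_le => e e0; near=> h; rewrite sub0r normrN normr_id.
      by near: h; apply: dnbhs0_le.
    apply: (@squeeze_cvgr _ _ _ _ (fun h => - (C * `|h|)) (fun h => C * `|h|)).
    + near=> h; rewrite /= subr0 addr0 /GRing.scale/= mulr1 -ler_norml normrM normfV.
      have h0 : 0 < `|h| by rewrite normr_gt0; near: h; exact: nbhs_dnbhs_neq.
      rewrite mulrC ler_pdivrMr// -mulrA -expr2 real_normK ?num_real//.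
    + by rewrite -[X in _ --> X]oppr0; apply: cvgN.
    + exact: cn.
  split; first by apply/cvg_ex; exists 0.
  exact: cvg_lim L.
Unshelve. all: by end_near. Qed.

Lemma Ck_flat k (p : {poly R}) (f : R * R -> R) : Ck k f -> Ck k (fun x => flat p (f x)).
Proof.
elim: k p => [|k ih] p Cf.
  move=> x; apply: continuous_comp; first exact: (Ck_continuous Cf).
  apply: differentiable_continuous; apply/derivable1_diffP.
  by have [] := is_derive_flat p (f x).
exact: Ck_comp (is_derive_flat p) Cf (ih _ (CkS Cf)).
Qed.

End Bump.

(** * Bernstein polynomials and their moments *)

Section Bernstein.
Context {R : realType}.
Implicit Types (a : nat -> R) (x y c : R).

Definition square (M : R) : set (R * R) :=
  `[- M, M]%classic `*` `[- M, M]%classic.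

Lemma in_square M (x : R * R) : square M x <-> `|x.1| <= M /\ `|x.2| <= M.
Proof. by rewrite /square/= !in_itv/= -!ler_norml; split => -[]. Qed.

Lemma compact_square M : compact (square M).
Proof. by apply: compact_setX; apply: segment_compact. Qed.

Definition sqdist (x y : R * R) : R := (x.1 - y.1) ^+ 2 + (x.2 - y.2) ^+ 2.

Lemma continuous_fst : continuous (fst : R * R -> R).
Proof. by move=> x; apply: cvg_fst. Qed.

Lemma continuous_snd : continuous (snd : R * R -> R).
Proof. by move=> x; apply: cvg_snd. Qed.

(* Uniform continuity in a form that can be averaged against second moments. *)
Lemma unif_cont_square (g : R * R -> R) (M e : R) : continuous g -> 0 < e ->
  exists2 K : R, 0 <= K & forall x y : R * R, square M x -> square M y ->
    `|g x - g y| <= e + K * sqdist x y.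
Proof.
move=> cg e0.
pose G (z : (R * R) * (R * R)) := `|g z.1 - g z.2|.
pose D (z : (R * R) * (R * R)) := sqdist z.1 z.2.
have c1 : continuous (fst : (R * R) * (R * R) -> R * R) by move=> x; apply: cvg_fst.
have c2 : continuous (snd : (R * R) * (R * R) -> R * R) by move=> x; apply: cvg_snd.
have cG : continuous G.
  move=> z; apply: cvg_norm; apply: cvgB.
    by apply: continuous_comp; [exact: c1|exact: cg].
  by apply: continuous_comp; [exact: c2|exact: cg].
have cD : continuous D.
  move=> z; apply: cvgD; apply: cvgM; apply: cvgB.
  all: try by apply: continuous_comp; [exact: c1|exact: continuous_fst].
  all: try by apply: continuous_comp; [exact: c2|exact: continuous_fst].
  all: try by apply: continuous_comp; [exact: c1|exact: continuous_snd].
  all: try by apply: continuous_comp; [exact: c2|exact: continuous_snd].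
pose S := square M `*` square M.
have cS : compact S by apply: compact_setX; apply: compact_square.
(* Off [A] the term [e] alone suffices. The compact set [A] misses the diagonal, so [D] has a
   positive minimum on it; [K] is the maximum of [G] over that minimum. *)
pose A := S `&` (G @^-1` [set t | e <= t]).
have cA : compact A.
  rewrite /A setIC; apply: (@subclosed_compact _ _ (S)); last by move=> z [].
    apply: closedI; last by apply: compact_closed => //; exact: norm_hausdorff.
    by apply: preimage_closed; [move=> z _; exact: cG|exact: closed_ge].
  exact: cS.
have [A0|/nonemptyPn A0] := pselect (A !=set0); last first.
  exists 0 => // x y Mx My; rewrite mul0r addr0 leNgt; apply/negP => h.
  suff : A (x, y) by rewrite A0.
  by split => //; apply: ltW.
have [zm /set_mem zmA Hm] := compact_EVT_min A0 cA (continuous_subspaceT cD).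
have [zM /set_mem zMA HM] := compact_EVT_max A0 cA (continuous_subspaceT cG).
have D0 : 0 < D zm.
  rewrite lt_neqAle addr_ge0 ?sqr_ge0// andbT eq_sym; apply/eqP => D0.
  case: zmA => _ /=; rewrite /G.
  suff -> : zm.1 = zm.2 by rewrite subrr normr0 leNgt e0.
  move: D0; rewrite /D /sqdist => /eqP; rewrite paddr_eq0 ?sqr_ge0//.
  rewrite !sqrf_eq0 !subr_eq0 => /andP[/eqP h1 /eqP h2].
  by case: zm.1 zm.2 h1 h2 => [? ?] [? ?] /= -> ->.
exists (G zM / D zm).
  by rewrite divr_ge0 ?normr_ge0// ltW.
move=> x y Mx My; have [h|h] := leP (`|g x - g y|) e.
  apply: (le_trans h); rewrite lerDl mulr_ge0 ?divr_ge0 ?normr_ge0 ?(ltW D0)//.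
  by rewrite addr_ge0 ?sqr_ge0.
have Axy : A (x, y) by split => //; apply: ltW.
apply: (@le_trans _ _ (G zM)); first by apply: (HM (x, y)); apply: mem_set.
apply: (@le_trans _ _ (G zM / D zm * sqdist x y)); last by rewrite lerDr ltW.
rewrite mulrAC ler_pdivlMr// ler_wpM2l ?normr_ge0//.
by apply: (Hm (x, y)); apply: mem_set.
Qed.

(* The Bernstein polynomial of degree [n] with control points
   [a 0, ..., a n], computed by de Casteljau's recursion. *)
Fixpoint bern n a x : R :=
  if n is m.+1 then (1 - x) * bern m a x + x * bern m (fun k => a k.+1) x else a 0%N.

Lemma bernB n a a' x : bern n (fun k => a k - a' k) x = bern n a x - bern n a' x.
Proof. by elim: n a a' => //= n ih a a'; rewrite !ih; ring. Qed.

Lemma bernZ n a c x : bern n (fun k => c * a k) x = c * bern n a x.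
Proof. by elim: n a => //= n ih a; rewrite !ih; ring. Qed.

Lemma eq_bern n a a' x : a =1 a' -> bern n a x = bern n a' x.
Proof. by move=> aa'; congr bern; apply/funext. Qed.

Lemma bern_le n a a' x : 0 <= x <= 1 -> (forall k, (k <= n)%N -> a k <= a' k) ->
  bern n a x <= bern n a' x.
Proof.
move=> /andP[x0 x1]; elim: n a a' => [|n ih] a a' H /=; first exact: H.
apply: lerD; apply: ler_wpM2l; rewrite ?subr_ge0//; apply: ih => k kn; apply: H => //.
exact: leqW.
Qed.

(** These are the binomial moments: mean n x and variance n x (1 - x). In the recursion, shifting
    the index by one amounts to replacing [c] by [c - 1]. *)
Lemma bern_moment n c d e x :
  bern n (fun k => d + e * (k%:R - c) ^+ 2) x =
  d + e * ((n%:R * x - c) ^+ 2 + n%:R * (x * (1 - x))).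
Proof.
elim: n c => [|n ih] c /=; first by rewrite !mul0r addr0.
rewrite ih (@eq_bern _ _ (fun k => d + e * (k%:R - (c - 1)) ^+ 2)).
  by rewrite ih; ring.
by move=> k; rewrite -natr1; ring.
Qed.

(** Chebyshev's argument: on [0, 1] the operator is positive and reproduces constants, so a
    quadratic bound on the control points is averaged into the second moment. *)
Lemma bern_near n a c d e m x : 0 <= x <= 1 ->
  (forall k, (k <= n)%N -> `|a k - c| <= d + e * (k%:R - m) ^+ 2) ->
  `|bern n a x - c| <= d + e * ((n%:R * x - m) ^+ 2 + n%:R * (x * (1 - x))).
Proof.
move=> x01 H; rewrite -bern_moment.
have cE : c = bern n (fun=> c) x by elim: (n) => //= k IH; rewrite -IH; ring.
rewrite {1}cE -bernB ler_norml; apply/andP; split; last first.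
  by apply: bern_le => // k kn; apply: le_trans (H k kn); apply: ler_norm.
rewrite -mulN1r -bernZ; apply: bern_le => // k kn.
by rewrite mulN1r lerNl; apply: le_trans (H k kn); rewrite -normrN ler_norm.
Qed.

(** The degree drops by one and the control points become forward differences. Divided by the mesh
    these are difference quotients, which the mean value theorem compares with the derivative of the
    approximated function. *)
Lemma is_derive_bern n a x :
  is_derive x 1 (bern n.+1 a) (n.+1%:R * bern n (fun k => a k.+1 - a k) x).
Proof.
have D1 : is_derive x 1 (fun y => 1 - y) (-1 : R).
  by rewrite -[-1]add0r; apply: is_derive_sub.
elim: n a => [|n ih] a.
  rewrite /= mul1r; have -> : a 1%N - a 0%N = (-1 * a 0%N + (1 - x) * 0) + (1 * a 1%N + x * 0) by ring.
  by apply: is_derive_add; apply: is_derive_mul.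
have -> : n.+2%:R * bern n.+1 (fun k => a k.+1 - a k) x =
  (-1 * bern n.+1 a x + (1 - x) * (n.+1%:R * bern n (fun k => a k.+1 - a k) x))
  + (1 * bern n.+1 (fun k => a k.+1) x +
     x * (n.+1%:R * bern n (fun k => a k.+2 - a k.+1) x)).
  by rewrite -[n.+2%:R]natr1 !bernB /=; ring.
by apply: is_derive_add; apply: is_derive_mul.
Qed.

Lemma Ck_bern k n (F : nat -> R * R -> R) g : Ck k g -> (forall j, Ck k (F j)) ->
  Ck k (fun z : R * R => bern n (F^~ z) (g z)).
Proof.
move=> Cg; elim: n F => [|n ih] F CF /=; first exact: CF.
apply: Ck_add; apply: Ck_mul => //.
- by apply: Ck_sub => //; apply: Ck_cst.
- exact: ih.
- by apply: (ih (fun j => F j.+1)) => j; apply: CF.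
Qed.

Lemma is_derive_bern_coef n (F dF : nat -> R -> R) x y :
  (forall j, is_derive y 1 (F j) (dF j y)) ->
  is_derive y 1 (fun t => bern n (F^~ t) x) (bern n (dF^~ y) x).
Proof.
elim: n F dF => [|n ih] F dF H /=; first exact: H.
exact: is_derive_add (is_derive_cmul (1 - x) (ih F dF H))
  (is_derive_cmul x (ih (fun j => F j.+1) (fun j => dF j.+1) (fun j => H j.+1))).
Qed.

Lemma bern2_near n1 n2 (F : nat -> nat -> R) (c d u1 u2 m1 m2 x y : R) :
  0 <= x <= 1 -> 0 <= y <= 1 ->
  (forall j k, (j <= n1)%N -> (k <= n2)%N ->
    `|F j k - c| <= d + u1 * (j%:R - m1) ^+ 2 + u2 * (k%:R - m2) ^+ 2) ->
  `|bern n1 (fun j => bern n2 (F j) y) x - c| <=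
    d + u1 * ((n1%:R * x - m1) ^+ 2 + n1%:R * (x * (1 - x)))
      + u2 * ((n2%:R * y - m2) ^+ 2 + n2%:R * (y * (1 - y))).
Proof.
move=> x01 y01 H; rewrite addrAC; apply: bern_near => // j jn.
by rewrite addrAC; apply: bern_near => // k kn; apply: H.
Qed.

End Bernstein.

(** * Polynomial approximation in C^1 on a square *)

Section C1Approximation.
Context {R : realType}.
Variables (f : R * R -> R) (M : R).
Hypotheses (Cf : Ck 1 f) (M0 : 0 < M).

Let s (t : R) := (t + M) / (2 * M).
Let p (N j : nat) : R := - M + 2 * M / N%:R * j%:R.

(** The tensor product Bernstein polynomial of [f] on [square M]: [s] rescales [-M, M] to [0, 1] and
    the [p N j] are the equidistant nodes. *)
Definition bern_approx (N : nat) (x : R * R) : R :=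
  bern N (fun j => bern N (fun k => f (p N j, p N k)) (s x.2)) (s x.1).

Let MN0 : M != 0. Proof. by rewrite gt_eqF. Qed.

Let s01 t : `|t| <= M -> 0 <= s t <= 1.
Proof.
rewrite ler_norml /s => /andP[h1 h2]; have M20 : 0 < 2 * M by rewrite mulr_gt0.
by apply/andP; split; [apply: divr_ge0|rewrite ler_pdivrMr//]; lra.
Qed.

Let p_in N j : (0 < N)%N -> (j <= N)%N -> `|p N j| <= M.
Proof.
move=> N0 jN; have N0' : (0 : R) < N%:R by rewrite ltr0n.
have jN' : (j%:R : R) / N%:R <= 1 by rewrite ler_pdivrMr// mul1r ler_nat.
have j0 : (0 : R) <= j%:R / N%:R by rewrite divr_ge0.
have -> : p N j = - M + 2 * M * (j%:R / N%:R) by rewrite /p mulrAC mulrA.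
move: (_ / _) jN' j0 => u u1 u0.
have h1 : 0 <= M * u by rewrite mulr_ge0// ltW.
have h2 : 0 <= M * (1 - u) by rewrite mulr_ge0 ?subr_ge0// ltW.
by rewrite ler_norml; apply/andP; split; lra.
Qed.

Let p_sub N j t : (0 < N)%N -> p N j - t = 2 * M / N%:R * (j%:R - N%:R * s t).
Proof.
move=> N0; have N0' : (N%:R : R) != 0 by rewrite pnatr_eq0 -lt0n.
by rewrite /p /s; field; rewrite MN0.
Qed.

Lemma Ck_bern_approx N k : Ck k (bern_approx N).
Proof.
have Cs1 : Ck k (fun x : R * R => s x.1).
  apply: Ck_mul; last exact: Ck_cst.
  by apply: Ck_add; [exact: Ck_fst|exact: Ck_cst].
have Cs2 : Ck k (fun x : R * R => s x.2).
  apply: Ck_mul; last exact: Ck_cst.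
  by apply: Ck_add; [exact: Ck_snd|exact: Ck_cst].
apply: (@Ck_bern _ k N (fun j x => bern N (fun k => f (p N j, p N k)) (s x.2))) => // j.
by apply: (@Ck_bern _ k N (fun k0 _ => f (p N j, p N k0))) => // i; apply: Ck_cst.
Qed.

Let is_derive_s (t : R) : is_derive t 1 s (2 * M)^-1.
Proof.
rewrite -[X in is_derive _ _ _ X]mul1r -[1 * _]addr0.
rewrite -[X in _ + X](mulr0 (t + M)).
by apply: is_derive_mul; rewrite -[X in is_derive _ _ _ X]addr0; apply: is_derive_add.
Qed.

Lemma is_derive1_bern_approx N x : is_derive x e1 (bern_approx N.+1)
  (bern N (fun j => bern N.+1 (fun k => N.+1%:R / (2 * M) *
     (f (p N.+1 j.+1, p N.+1 k) - f (p N.+1 j, p N.+1 k))) (s x.2)) (s x.1)).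
Proof.
case: x => x y; apply/is_derive_e1P => /=.
pose a j := bern N.+1 (fun k => f (p N.+1 j, p N.+1 k)) (s y).
apply: is_derive_eq (is_derive_chain (is_derive_s x) (is_derive_bern N a (s x))) _.
rewrite mulrAC -bernZ; apply: eq_bern => j.
by rewrite /a -bernB -bernZ.
Qed.

Lemma is_derive2_bern_approx N x : is_derive x e2 (bern_approx N.+1)
  (bern N.+1 (fun j => bern N (fun k => N.+1%:R / (2 * M) *
     (f (p N.+1 j, p N.+1 k.+1) - f (p N.+1 j, p N.+1 k))) (s x.2)) (s x.1)).
Proof.
case: x => x y; apply/is_derive_e2P.
pose F j t := bern N.+1 (fun k => f (p N.+1 j, p N.+1 k)) (s t).
pose dF j t := bern N (fun k => N.+1%:R / (2 * M) *
  (f (p N.+1 j, p N.+1 k.+1) - f (p N.+1 j, p N.+1 k))) (s t).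
suff H j : is_derive y 1 (F j) (dF j y) by exact: (is_derive_bern_coef N.+1 (s x) H).
pose a k := f (p N.+1 j, p N.+1 k).
apply: is_derive_eq (is_derive_chain (is_derive_s y) (is_derive_bern N a (s y))) _.
by rewrite /dF mulrAC -bernZ.
Qed.

(** Identifies a control point of the differentiated polynomial with a value of the derivative
    between two neighbouring nodes. *)
Let MVT_step (g dg : R -> R) N j : (0 < N)%N ->
  (forall t : R, is_derive t 1 g (dg t)) ->
  exists2 t, p N j <= t <= p N j.+1 &
    N%:R / (2 * M) * (g (p N j.+1) - g (p N j)) = dg t.
Proof.
move=> N0 dgP; have N0' : (0 : R) < N%:R by rewrite ltr0n.
have E : p N j.+1 - p N j = 2 * M / N%:R by rewrite /p -natr1; ring.
have lt : p N j < p N j.+1 by rewrite -subr_gt0 E divr_gt0// mulr_gt0.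
have [|t + ->] := MVT lt (fun t _ => dgP t).
  apply: continuous_subspaceT => t; apply: differentiable_continuous.
  by apply/derivable1_diffP; have [] := dgP t.
rewrite in_itv/= => /andP[/ltW a /ltW b]; exists t; first by rewrite a.
rewrite E; field; rewrite MN0/= gt_eqF//.
Qed.

Lemma C1_approx (e : R) : 0 < e -> exists P : R * R -> R, (forall k, Ck k P) /\
  forall x, square M x -> [/\ `|P x - f x| <= e,
    `|'D_e1 P x - 'D_e1 f x| <= e & `|'D_e2 P x - 'D_e2 f x| <= e].
Proof.
move=> e0; have e20 : 0 < e / 2 by rewrite divr_gt0.
have [_ _ _ c1 c2] := Cf.
have [K0 K00 HK0] := unif_cont_square M (Ck_continuous Cf) e20.
have [K1 K10 HK1] := unif_cont_square M (c1 : continuous _) e20.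
have [K2 K20 HK2] := unif_cont_square M (c2 : continuous _) e20.
pose K := K0 + K1 + K2.
have KK0 : K0 <= K by rewrite /K; lra.
have KK1 : K1 <= K by rewrite /K; lra.
have KK2 : K2 <= K by rewrite /K; lra.
have Kge0 : 0 <= K by rewrite /K; lra.
have sq0 (x y : R * R) : 0 <= sqdist x y by rewrite addr_ge0 ?sqr_ge0.
(* With mesh [h = 2 M / N] and [q = K h ^ 2], each of the three errors below is at most
   [e / 2 + 5 q N], that is [e / 2 + 5 K (2 M) ^ 2 / N]; [N] makes the second summand at most
   [e / 2]. *)
pose n := Num.truncn (5 * K * (2 * M) ^+ 2 / (e / 2)).
pose N := n.+1.
have N0 : (0 : R) < N%:R by rewrite ltr0n.
have HN : 5 * K * (2 * M) ^+ 2 / N%:R <= e / 2.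
  by rewrite ler_pdivrMr// [X in _ <= X]mulrC -ler_pdivrMr// ltW// truncnS_gt.
pose h := 2 * M / N%:R.
have h0 : 0 < h by rewrite divr_gt0// mulr_gt0.
have hE : 5 * (K * h ^+ 2) * N%:R = 5 * K * (2 * M) ^+ 2 / N%:R.
  by rewrite /h; field; rewrite gt_eqF.
pose q := K * h ^+ 2.
have q0 : 0 <= q by rewrite mulr_ge0// sqr_ge0.
have nN : (n%:R : R) = N%:R - 1 by rewrite /N -natr1 addrK.
have N1 : (1 : R) <= N%:R by rewrite ler1n.
have var (m : nat) t : (m <= N)%N -> `|t| <= M ->
    0 <= m%:R * (s t * (1 - s t)) <= m%:R.
  move=> mN /s01 /andP[]; move: (s t) => u a b.
  have u0 : 0 <= u * (1 - u) by rewrite mulr_ge0// subr_ge0.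
  have u1 : u * (1 - u) <= 1 by nra.
  by rewrite mulr_ge0//= ler_piMr.
have final z d : d <= e / 2 + 5 * q * N%:R -> `|z| <= d -> `|z| <= e.
  by move=> h1 h2; apply: (le_trans h2); apply: (le_trans h1); rewrite hE; lra.
have up Ki (g : R * R -> R) : Ki <= K -> (forall x y : R * R, square M x -> square M y ->
    `|g x - g y| <= e / 2 + Ki * sqdist x y) -> forall x y : R * R, square M x -> square M y ->
    `|g x - g y| <= e / 2 + K * sqdist x y.
  by move=> KiK H x y Mx My; apply: (le_trans (H _ _ Mx My)); rewrite lerD2l ler_wpM2r.
move: HK0 HK1 HK2 => /(up _ _ KK0) HK0 /(up _ _ KK1) HK1 /(up _ _ KK2) HK2.
(* The intermediate point [r] of the mean value theorem lies within [h] of the node, and (a + b)^2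
   <= 2 a^2 + 2 b^2; hence the doubled coefficient [2 * q] in the differentiated variable. *)
have drift j t r : `|t| <= M -> p N j <= r <= p N j.+1 ->
    (r - t) ^+ 2 <= h ^+ 2 * (2 + 2 * (j%:R - N%:R * s t) ^+ 2).
  move=> tM /andP[r1 r2]; have E : p N j.+1 - p N j = h by rewrite /p -natr1 /h; ring.
  have := @p_sub N j t (ltn0Sn _); rewrite -/h => E2.
  have -> : h ^+ 2 * (2 + 2 * (j%:R - N%:R * s t) ^+ 2) = 2 * h ^+ 2 + 2 * (p N j - t) ^+ 2.
    by rewrite E2; ring.
  have [a1 a2] : 0 <= r - p N j /\ r - p N j <= h by split; lra.
  have : 0 <= ((r - p N j) - (p N j - t)) ^+ 2 by exact: sqr_ge0.
  nra.
exists (bern_approx N); split; first exact: Ck_bern_approx.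
move=> x Mx; have [Mx1 Mx2] := (in_square M x).1 Mx.
pose m1 : R := N%:R * s x.1; pose m2 : R := N%:R * s x.2.
have [v1 v2] := (var N _ (leqnn _) Mx1, var N _ (leqnn _) Mx2).
have [w1 w2] := (var n _ (leqnSn _) Mx1, var n _ (leqnSn _) Mx2).
have [/andP[a1 b1] /andP[a2 b2]] := (s01 Mx1, s01 Mx2).
(* The differentiated polynomial has degree [n = N - 1], so its mean is off [m1] by [s x.1], which
   is at most 1. *)
have d1 : (n%:R * s x.1 - m1) ^+ 2 <= 1 by rewrite nN /m1; nra.
have d2 : (n%:R * s x.2 - m2) ^+ 2 <= 1 by rewrite nN /m2; nra.
have pN j : (j <= N)%N -> `|p N j| <= M by apply: p_in.
have tot u1 u2 w1' w2' m : (u1 - m) ^+ 2 <= 1 -> 0 <= w1' <= n%:R -> 0 <= w2' <= N%:R ->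
    e / 2 + 2 * q + 2 * q * ((u1 - m) ^+ 2 + w1') + q * ((u2 - u2) ^+ 2 + w2')
    <= e / 2 + 5 * q * N%:R.
  move=> h1 /andP[_ h2] /andP[_ h3]; rewrite subrr expr0n add0r.
  have : q * ((u1 - m) ^+ 2 + w1') <= q * N%:R by apply: ler_wpM2l => //; lra.
  have : q * w2' <= q * N%:R by exact: ler_wpM2l.
  have : q <= q * N%:R by rewrite ler_peMr.
  by lra.
split.
- apply: final; last first.
    apply: (@bern2_near _ _ _ _ _ (e / 2) q q m1 m2); rewrite ?s01// => j k jN kN.
    have -> : e / 2 + q * (j%:R - m1) ^+ 2 + q * (k%:R - m2) ^+ 2 =
       e / 2 + K * sqdist (p N j, p N k) x.
      by rewrite /sqdist /= !p_sub// -/h -/m1 -/m2 /q; ring.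
    by apply: HK0 => //; apply/in_square; split; apply: pN.
  by rewrite /m1 /m2 !subrr; nra.
- rewrite (@derive_val _ _ _ _ _ _ _ (is_derive1_bern_approx n x)).
  apply: final; last first.
    apply: (@bern2_near _ _ _ _ _ (e / 2 + 2 * q) (2 * q) q m1 m2); rewrite ?s01// => j k jN kN.
    have [r rP ->] := @MVT_step (fun t => f (t, p N k)) (fun t => 'D_e1 f (t, p N k)) N j
       (ltn0Sn _) (fun t => (is_derive_e1P _ _ _ _).1 (Ck_is_derive1 Cf _)).
    apply: (le_trans (HK1 (r, p N k) x _ _)) => //.
      apply/in_square; split; last exact: pN.
      have := pN j (leqW jN); have := pN j.+1 jN; rewrite !ler_norml /=; lra.
    rewrite /sqdist /= (@p_sub N k)// -/h -/m2.
    have := drift j x.1 r Mx1 rP; rewrite -/m1 => dr.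
    have := ler_wpM2l Kge0 dr.
    rewrite /q; lra.
  exact: tot.
- rewrite (@derive_val _ _ _ _ _ _ _ (is_derive2_bern_approx n x)).
  apply: final; last first.
    apply: (@bern2_near _ _ _ _ _ (e / 2 + 2 * q) q (2 * q) m1 m2); rewrite ?s01// => j k jN kN.
    have [r rP ->] := @MVT_step (fun t => f (p N j, t)) (fun t => 'D_e2 f (p N j, t)) N k
       (ltn0Sn _) (fun t => (is_derive_e2P _ _ _ _).1 (Ck_is_derive2 Cf _)).
    apply: (le_trans (HK2 (p N j, r) x _ _)) => //.
      apply/in_square; split; first exact: pN.
      have := pN k (leqW kN); have := pN k.+1 kN; rewrite !ler_norml /=; lra.
    rewrite /sqdist /= (@p_sub N j)// -/h -/m1.
    have := drift k x.2 r Mx2 rP; rewrite -/m2 => dr.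
    have := ler_wpM2l Kge0 dr.
    rewrite /q; lra.
  rewrite addrAC; exact: tot.
Qed.

End C1Approximation.

(** * Integration over the plane and the divergence theorem *)

Section PlaneIntegral.
Context {R : realType}.
Implicit Types (f g : R * R -> R) (x : R * R).

Lemma continuous_pairl (y : R) : continuous (fun s : R => (s, y) : R * R).
Proof.
move=> t; apply: (@cvg_pair _ _ _ (nbhs t) (nbhs t) (nbhs y) _ _ _ (fun s => s) (fun=> y)).
  exact: cvg_id.
exact: cvg_cst.
Qed.

Lemma continuous_pairr (x : R) : continuous (fun s : R => (x, s) : R * R).
Proof.
move=> t; apply: (@cvg_pair _ _ _ (nbhs t) (nbhs x) (nbhs t) _ _ _ (fun=> x) (fun s => s)).
  exact: cvg_cst.
exact: cvg_id.
Qed.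

Let rat_box (q : (rat * rat) * (rat * rat)) : set (R * R) :=
  `]ratr q.1.1, ratr q.1.2[%classic `*` `]ratr q.2.1, ratr q.2.2[%classic.

(** Measurability in [R * R] refers to the product sigma-algebra, so an open set is written as a
    countable union of boxes with rational corners. *)
Lemma open_measurable2 (U : set (R * R)) : open U -> measurable U.
Proof.
move=> oU.
have -> : U = \bigcup_(q in [set q | rat_box q `<=` U]) rat_box q.
  apply/seteqP; split=> [[x y] Uxy|z [q qU]]; last exact: qU.
  have /nbhs_ballP[e /= e0 eU] : nbhs (x, y) U by apply: open_nbhs_nbhs; split.
  have [|q1 q1P] := @rat_in_itvoo R (x - e) x; first by rewrite ltrBlDr ltrDl.
  have [|q2 q2P] := @rat_in_itvoo R x (x + e); first by rewrite ltrDl.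
  have [|q3 q3P] := @rat_in_itvoo R (y - e) y; first by rewrite ltrBlDr ltrDl.
  have [|q4 q4P] := @rat_in_itvoo R y (y + e); first by rewrite ltrDl.
  move: q1P q2P q3P q4P; rewrite !in_itv/= => /andP[a1 a2] /andP[a3 a4] /andP[a5 a6] /andP[a7 a8].
  exists ((q1, q2), (q3, q4)); last first.
    by split; rewrite /= in_itv/=; apply/andP.
  move=> [s t] []; rewrite /= !in_itv/= => /andP[b1 b2] /andP[b3 b4].
  by apply: eU; split; rewrite /ball/= ltr_norml; apply/andP; split; lra.
rewrite bigcup_mkcond; apply: countable_bigcupT_measurable => // q.
case: ifPn => _ //; apply: measurableX; apply: measurable_itv.
Qed.

Lemma continuous_measurable2 f : continuous f -> measurable_fun [set: R * R] f.
Proof.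
move=> /continuousP cf; apply: (measurability _ (RGenOpens.measurableE R)).
move=> _ [_ [a [b ->] <-]]; rewrite setTI; apply: open_measurable2.
exact/cf/interval_open.
Qed.

Lemma is_derive_continuous (g dg : R -> R) :
  (forall t : R, is_derive t 1 g (dg t)) -> continuous g.
Proof.
by move=> H t; apply: differentiable_continuous; apply/derivable1_diffP; have [] := H t.
Qed.

Lemma FTC2 (g dg : R -> R) (a b : R) : a < b ->
  (forall t : R, is_derive t 1 g (dg t)) -> continuous dg ->
  (\int[lebesgue_measure]_(t in `[a, b]) (dg t)%:E = (g b - g a)%:E)%E.
Proof.
move=> ab H cdg; rewrite EFinB; apply: continuous_FTC2 => //.
- exact: continuous_subspaceT.
- split; first by move=> t _; have [] := H t.
  + by apply: cvg_at_right_filter; exact: is_derive_continuous H _.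
  + by apply: cvg_at_left_filter; exact: is_derive_continuous H _.
- by move=> t _; rewrite derive1E; apply: derive_val.
Qed.

Lemma leb2_box (A B : set R) : measurable A -> measurable B ->
  (leb2 (A `*` B) = lebesgue_measure A * lebesgue_measure B)%E.
Proof. by move=> mA mB; rewrite /leb2 product_measure1E. Qed.

Lemma measurable_square (M : R) : measurable (square M).
Proof. by apply: measurableX; apply: measurable_itv. Qed.

Lemma leb2_square_lty (M : R) : (leb2 (square M) < +oo)%E.
Proof.
rewrite /square leb2_box//.
by rewrite lebesgue_measure_itv/=; case: ifP => _; rewrite ?mule0 ?EFinN -?EFinD -?EFinM ltry.
Qed.

Definition intble f := leb2.-integrable setT (EFin \o f).

Lemma intble_le f g : measurable_fun [set: R * R] f -> intble g ->
  (forall x, `|f x| <= g x) -> intble f.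
Proof.
move=> mf ig H; apply: le_integrable ig => //; first exact/measurable_EFinP.
by move=> x _ /=; rewrite lee_fin; apply: (le_trans (H x)); exact: ler_norm.
Qed.

Lemma intbleD f g : intble f -> intble g -> intble (fun x => f x + g x).
Proof. by move=> If Ig; have := integrableD measurableT If Ig. Qed.

Lemma intbleB f g : intble f -> intble g -> intble (fun x => f x - g x).
Proof. by move=> If Ig; have := integrableB measurableT If Ig. Qed.

Lemma intbleZ (c : R) f : intble f -> intble (fun x => c * f x).
Proof. by move=> If; have := integrableZl measurableT c If. Qed.

Lemma intble_square (c M : R) : intble (fun x => c * \1_(square M) x).
Proof.
apply: intbleZ; have mM := measurable_square M.
apply/integrableP; split; first exact/measurable_EFinP/measurable_indic.
have -> : (\int[leb2]_x `|(EFin \o \1_(square M)) x| = \int[leb2]_x (\1_(square M) x)%:E)%E.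
  by apply: eq_integral => t _ /=; rewrite ger0_norm.
by rewrite integral_indic// setIT; exact: leb2_square_lty.
Qed.

Lemma intble_bounded f (C M : R) : measurable_fun [set: R * R] f ->
  (forall x, square M x -> `|f x| <= C) -> (forall x, ~ square M x -> f x = 0) -> intble f.
Proof.
move=> mf fC f0; apply: (@intble_le f (fun x => C * \1_(square M) x)) => //.
  exact: intble_square.
move=> x; rewrite indicE; have [xM|xM] := boolP (x \in square M).
  by rewrite mulr1; apply: fC; apply: set_mem.
by rewrite mulr0 f0 ?normr0//; move/mem_set; apply/negP.
Qed.

Lemma bounded_on_square f (M : R) : continuous f ->
  exists C : R, forall x, square M x -> `|f x| <= C.
Proof.
move=> cf; have [[x0 Mx0]|/forallNP M0] := pselect (square M !=set0); last first.
  by exists 0 => x Mx; case: (M0 x).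
have cn : continuous (fun x => `|f x|) by move=> x; apply: cvg_norm; exact: cf.
have [|z _ H] := @compact_EVT_max _ R (fun x => `|f x|) (square M) _ (@compact_square R M) (continuous_subspaceT cn).
  by exists x0.
by exists `|f z| => x Mx; apply: H; apply: mem_set.
Qed.

Lemma intble_compact f (M : R) : continuous f ->
  (forall x, ~ square M x -> f x = 0) -> intble f.
Proof.
move=> cf f0; have [C HC] := bounded_on_square M cf.
exact: intble_bounded (continuous_measurable2 cf) HC f0.
Qed.

Let vanish_section (g dg : R -> R) (M : R) : (forall t : R, is_derive t 1 g (dg t)) ->
  (forall t, M < `|t| -> g t = 0) -> forall t, M < `|t| -> dg t = 0.
Proof.
move=> H g0 t Mt; have <- := @derive_val _ _ _ _ _ _ _ (H t).
rewrite -(@derive_cst _ R R 0 t 1); apply: near_eq_derive.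
have cn : continuous (fun t : R => `|t|) by exact: norm_continuous.
have : \forall s \near t, M < `|s|.
  exact: (cvgr_gt _ (cn t)) Mt.
by apply: filterS => s /g0.
Qed.

Let integral_section (g dg : R -> R) (M : R) : 0 < M ->
  (forall t : R, is_derive t 1 g (dg t)) -> continuous dg ->
  (forall t, M < `|t| -> g t = 0) ->
  (\int[lebesgue_measure]_t (dg t)%:E = 0)%E.
Proof.
move=> M0 H cdg g0.
have dg0 := vanish_section H g0.
(* The interval is widened by 1 because [g] is known to vanish only for [|t| > M], and it must
   vanish at both ends. *)
have -> : (\int[lebesgue_measure]_t (dg t)%:E =
   \int[lebesgue_measure]_(t in `[(- (M + 1))%R, (M + 1)%R]) (dg t)%:E)%E.
  rewrite [RHS]integral_mkcond; apply: eq_integral => t _.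
  rewrite patchE; case: ifPn => // /negP tM; rewrite dg0//.
  rewrite ltNge; apply/negP => h; apply: tM; apply: mem_set => /=.
  by rewrite in_itv/= -ler_norml; apply: (le_trans h); rewrite lerDl.
rewrite (FTC2 _ H cdg); last lra.
by rewrite !g0 ?subrr// ?normrN ger0_norm; lra.
Qed.

Lemma vanish_D_e1 f df (M : R) : (forall x, is_derive x e1 f (df x)) ->
  (forall x, ~ square M x -> f x = 0) -> forall x, ~ square M x -> df x = 0.
Proof.
move=> H f0 [x y] xM.
have Hy (z : R) : forall t : R, is_derive t 1 (fun s => f (s, z)) (df (t, z)).
  by move=> t; apply/is_derive_e1P.
have f0' z : (M < `|z.1|) || (M < `|z.2|) -> f z = 0.
  move=> h; apply: f0 => /in_square[h1 h2].
  by move: h; rewrite !ltNge h1 h2.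
have [h|h] := ltP M `|y|.
  have E : (fun s => f (s, y)) = (fun=> 0).
    by apply/funext => s; apply: f0'; rewrite /= h orbT.
  have <- := @derive_val _ _ _ _ _ _ _ (Hy y x).
  by rewrite E derive_cst.
apply: (@vanish_section _ _ M (Hy y)); last first.
  by rewrite ltNge; apply/negP => h1; apply: xM; apply/in_square.
by move=> t Mt; apply: f0'; rewrite /= Mt.
Qed.

Lemma vanish_D_e2 f df (M : R) : (forall x, is_derive x e2 f (df x)) ->
  (forall x, ~ square M x -> f x = 0) -> forall x, ~ square M x -> df x = 0.
Proof.
move=> H f0 [x y] xM.
have Hy (z : R) : forall t : R, is_derive t 1 (fun s => f (z, s)) (df (z, t)).
  by move=> t; apply/is_derive_e2P.
have f0' z : (M < `|z.1|) || (M < `|z.2|) -> f z = 0.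
  move=> h; apply: f0 => /in_square[h1 h2].
  by move: h; rewrite !ltNge h1 h2.
have [h|h] := ltP M `|x|.
  have E : (fun s => f (x, s)) = (fun=> 0).
    by apply/funext => s; apply: f0'; rewrite /= h.
  have <- := @derive_val _ _ _ _ _ _ _ (Hy x y).
  by rewrite E derive_cst.
apply: (@vanish_section _ _ M (Hy x)); last first.
  by rewrite ltNge; apply/negP => h1; apply: xM; apply/in_square.
by move=> t Mt; apply: f0'; rewrite /= Mt orbT.
Qed.

(** Fubini reduces the claim to horizontal lines, where the fundamental theorem of calculus leaves
    only boundary values, all zero. *)
Lemma integral_D_e1 f df (M : R) : 0 < M -> (forall x, is_derive x e1 f (df x)) ->
  continuous df -> (forall x, ~ square M x -> f x = 0) ->
  intble df /\ \int[leb2]_x df x = 0.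
Proof.
move=> M0 H cdf f0.
have Hy (y : R) : forall t : R, is_derive t 1 (fun s => f (s, y)) (df (t, y)).
  by move=> t; apply/is_derive_e1P.
have f0' x : (M < `|x.1|) || (M < `|x.2|) -> f x = 0.
  move=> h; apply: f0 => /in_square[h1 h2].
  by move: h; rewrite !ltNge h1 h2.
have df0 := vanish_D_e1 H f0.
have I : intble df by apply: intble_compact df0.
split=> //; rewrite /Rintegral.
have -> : (\int[leb2]_x (df x)%:E = 0)%E; last by [].
rewrite /leb2 -(integral21_prod_meas1 I) /fubini_G.
rewrite (@eq_integral _ _ _ _ _ (fun=> 0%E)) ?integral0// => y _ /=.
apply: (@integral_section _ _ M M0 (Hy y)).
- move=> t; apply: (@continuous_comp _ _ _ (fun s => (s, y)) df); last exact: cdf.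
  exact: continuous_pairl.
- by move=> t Mt; apply: f0'; rewrite /= Mt.
Qed.

Lemma integral_D_e2 f df (M : R) : 0 < M -> (forall x, is_derive x e2 f (df x)) ->
  continuous df -> (forall x, ~ square M x -> f x = 0) ->
  intble df /\ \int[leb2]_x df x = 0.
Proof.
move=> M0 H cdf f0.
have Hy (x : R) : forall t : R, is_derive t 1 (fun s => f (x, s)) (df (x, t)).
  by move=> t; apply/is_derive_e2P.
have f0' x : (M < `|x.1|) || (M < `|x.2|) -> f x = 0.
  move=> h; apply: f0 => /in_square[h1 h2].
  by move: h; rewrite !ltNge h1 h2.
have df0 := vanish_D_e2 H f0.
have I : intble df by apply: intble_compact df0.
split=> //; rewrite /Rintegral.
have -> : (\int[leb2]_x (df x)%:E = 0)%E; last by [].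
rewrite /leb2 -(integral12_prod_meas1 I) /fubini_F.
rewrite (@eq_integral _ _ _ _ _ (fun=> 0%E)) ?integral0// => x _ /=.
apply: (@integral_section _ _ M M0 (Hy x)).
- move=> t; apply: (@continuous_comp _ _ _ (fun s => (x, s)) df); last exact: cdf.
  exact: continuous_pairr.
- by move=> t Mt; apply: f0'; rewrite /= Mt orbT.
Qed.

End PlaneIntegral.

(** * Real square-integrable functions and limits of their products *)

Section RealL2.
Context {R : realType}.
Implicit Types (f g h : R * R -> R) (x : R * R).

Definition RI f : R := \int[leb2]_x f x.

Lemma RID f g : intble f -> intble g -> RI (fun x => f x + g x) = RI f + RI g.
Proof. by move=> If Ig; rewrite /RI RintegralD. Qed.

Lemma RIB f g : intble f -> intble g -> RI (fun x => f x - g x) = RI f - RI g.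
Proof. by move=> If Ig; rewrite /RI RintegralB. Qed.

Lemma RIZ (c : R) f : intble f -> RI (fun x => c * f x) = c * RI f.
Proof. by move=> If; rewrite /RI RintegralZl. Qed.

Lemma eq_RI f g : f =1 g -> RI f = RI g.
Proof. by move=> /funext ->. Qed.

Lemma RI_le f g : intble f -> intble g -> (forall x, f x <= g x) -> RI f <= RI g.
Proof. by move=> If Ig H; apply: le_Rintegral => //. Qed.

Lemma RI_ge0 f : (forall x, 0 <= f x) -> 0 <= RI f.
Proof. by move=> H; apply: Rintegral_ge0 => x _; apply: H. Qed.

Lemma RI_norm f g : intble f -> intble g -> (forall x, `|f x| <= g x) -> `|RI f| <= RI g.
Proof.
move=> If Ig H; rewrite ler_norml -mulN1r -RIZ//; apply/andP; split; apply: RI_le => //.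
- exact: intbleZ.
- by move=> x; rewrite mulN1r lerNl; apply: le_trans (H x); rewrite -normrN ler_norm.
- by move=> x; apply: le_trans (H x); rewrite ler_norm.
Qed.

Definition L2r f := measurable_fun [set: R * R] f /\ intble (fun x => f x ^+ 2).
Definition N2 f : R := RI (fun x => f x ^+ 2).

Lemma N2_ge0 f : 0 <= N2 f.
Proof. by apply: RI_ge0 => x; apply: sqr_ge0. Qed.

Lemma L2r_le f g : measurable_fun [set: R * R] f -> intble g ->
  (forall x, f x ^+ 2 <= g x) -> L2r f.
Proof.
move=> mf Ig H; split=> //; apply: intble_le Ig _; first exact: measurable_funX.
by move=> x; rewrite ger0_norm ?sqr_ge0.
Qed.

Lemma L2rM f g : L2r f -> L2r g -> intble (fun x => f x * g x).
Proof.
move=> [mf If] [mg Ig]; apply: (@intble_le _ _ (fun x => f x ^+ 2 + g x ^+ 2)).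
- exact: measurable_funM.
- exact: intbleD.
- move=> x; have := sqr_ge0 (f x + g x); have := sqr_ge0 (f x - g x).
  by rewrite ler_norml => h1 h2; apply/andP; split; nra.
Qed.

Lemma L2rD f g : L2r f -> L2r g -> L2r (fun x => f x + g x).
Proof.
move=> [mf If] [mg Ig].
apply: (@L2r_le _ (fun x => 2 * (f x ^+ 2 + g x ^+ 2))).
- exact: measurable_funD.
- by apply: intbleZ; apply: intbleD.
- by move=> x; have := sqr_ge0 (f x - g x); nra.
Qed.

Lemma L2rZ (c : R) f : L2r f -> L2r (fun x => c * f x).
Proof.
move=> [mf If]; apply: (@L2r_le _ (fun x => c ^+ 2 * (f x ^+ 2))).
- by apply: measurable_funM.
- exact: intbleZ.
- by move=> x; rewrite exprMn.
Qed.

Lemma L2rB f g : L2r f -> L2r g -> L2r (fun x => f x - g x).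
Proof.
move=> Lf /(L2rZ (-1)) Lg; have := L2rD Lf Lg; congr L2r; apply/funext => x.
by rewrite mulN1r.
Qed.

Lemma L2r_bmul (C : R) f g : measurable_fun [set: R * R] f -> (forall x, `|f x| <= C) ->
  L2r g -> L2r (fun x => f x * g x).
Proof.
move=> mf HC [mg Ig]; apply: (@L2r_le _ (fun x => C ^+ 2 * (g x ^+ 2))).
- exact: measurable_funM.
- exact: intbleZ.
- move=> x; rewrite exprMn ler_wpM2r ?sqr_ge0//.
  by rewrite -[f x ^+ 2]real_normK ?num_real// lerXn2r ?nnegrE ?(le_trans _ (HC x)).
Qed.

Lemma L2r_compact f (M : R) : continuous f ->
  (forall x, ~ square M x -> f x = 0) -> L2r f.
Proof.
move=> cf f0; split; first exact: continuous_measurable2.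
apply: (@intble_compact _ _ M); last by move=> x /f0 ->; rewrite expr0n.
by move=> x; apply: cvgM; exact: cf.
Qed.

Lemma N2D f g : L2r f -> L2r g -> N2 (fun x => f x + g x) <= 2 * (N2 f + N2 g).
Proof.
move=> Lf Lg; have [_ If] := Lf; have [_ Ig] := Lg.
rewrite /N2 -RID// -RIZ; last exact: intbleD.
apply: RI_le; first by case: (L2rD Lf Lg).
  by apply: intbleZ; apply: intbleD.
by move=> x; have := sqr_ge0 (f x - g x); nra.
Qed.

Lemma N2B f g : L2r f -> L2r g -> N2 (fun x => f x - g x) <= 2 * (N2 f + N2 g).
Proof.
move=> Lf Lg; have := N2D Lf (L2rZ (-1) Lg).
congr (_ <= _); first by apply: eq_RI => x; rewrite mulN1r.
by congr (_ * (_ + _)); apply: eq_RI => x; rewrite mulN1r sqrrN.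
Qed.

(** A weighted form of the Cauchy-Schwarz inequality, pointwise and free of square roots; the weight
    [d] stays free so that one factor may be merely bounded. *)
Lemma RIM_le (d : R) f g : 0 < d -> L2r f -> L2r g ->
  `|RI (fun x => f x * g x)| <= d * N2 g + d^-1 * N2 f.
Proof.
move=> d0 Lf Lg; have [_ If] := Lf; have [_ Ig] := Lg.
rewrite /N2 -!RIZ// -RID; try exact: intbleZ.
apply: RI_norm; [exact: L2rM| by apply: intbleD; exact: intbleZ |] => x.
have E : d * g x ^+ 2 + d^-1 * f x ^+ 2 = d * ((g x) ^+ 2 + (d^-1 * f x) ^+ 2).
  by field; rewrite gt_eqF.
have -> : f x * g x = d * (g x * (d^-1 * f x)) by field; rewrite gt_eqF.
rewrite E normrM (gtr0_norm d0) ler_wpM2l ?(ltW d0)//; set y := d^-1 * f x.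
have := sqr_ge0 (g x + y); have := sqr_ge0 (g x - y).
by rewrite ler_norml => h1 h2; apply/andP; split; nra.
Qed.

Lemma cvg_RIM_0 (fn gn : nat -> R * R -> R) (C : R) :
  (forall n, L2r (fn n)) -> (forall n, L2r (gn n)) ->
  N2 (fn n) @[n --> \oo] --> (0 : R) -> (\forall n \near \oo, N2 (gn n) <= C) ->
  RI (fun x => fn n x * gn n x) @[n --> \oo] --> (0 : R).
Proof.
move=> Lf Lg f0 gC; apply/cvgrPdist_le => e e0.
pose C' := `|C| + 1; have C'0 : 0 < C' by rewrite ltr_wpDl.
(* Chosen so that [d * C'] is [e / 2]; the part [d^-1 * N2 (fn n)] is below [e / 2] for large
   [n]. *)
pose d := e / (2 * C'); have d0 : 0 < d by rewrite divr_gt0// mulr_gt0.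
have de : 0 < d * (e / 2) by rewrite mulr_gt0// divr_gt0.
near=> n; rewrite sub0r normrN; apply: (le_trans (RIM_le d0 (Lf n) (Lg n))).
have h1 : N2 (gn n) <= C'.
  have : N2 (gn n) <= C by near: n.
  by move=> h; rewrite /C'; have := ler_norm C; lra.
have h2 : N2 (fn n) <= d * (e / 2).
  rewrite -[N2 (fn n)]ger0_norm ?N2_ge0// -normrN -sub0r.
  by near: n; apply: (cvgrPdist_le _ _).1.
have -> : e = d * C' + e / 2 by rewrite /d; field; rewrite gt_eqF.
apply: lerD; first by rewrite ler_pM2l.
by rewrite ler_pdivrMl.
Unshelve. all: by end_near. Qed.

(** The product is expanded around [f * g] into three terms, each with a factor tending to zero and
    the other bounded in norm. *)
Lemma cvg_RIM (fn gn : nat -> R * R -> R) f g :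
  (forall n, L2r (fn n)) -> (forall n, L2r (gn n)) -> L2r f -> L2r g ->
  N2 (fun x => fn n x - f x) @[n --> \oo] --> (0 : R) ->
  N2 (fun x => gn n x - g x) @[n --> \oo] --> (0 : R) ->
  RI (fun x => fn n x * gn n x) @[n --> \oo] --> RI (fun x => f x * g x).
Proof.
move=> Lfn Lgn Lf Lg f0 g0.
have Lfd n : L2r (fun x => fn n x - f x) by exact: L2rB.
have Lgd n : L2r (fun x => gn n x - g x) by exact: L2rB.
have c1 : RI (fun x => (fn n x - f x) * (gn n x - g x)) @[n --> \oo] --> (0 : R).
  apply: (@cvg_RIM_0 _ _ 1) => //; near=> n.
  rewrite -[N2 _]ger0_norm ?N2_ge0// -normrN -sub0r.
  by near: n; apply: (cvgrPdist_le _ _).1.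
have c2 : RI (fun x => (fn n x - f x) * g x) @[n --> \oo] --> (0 : R).
  by apply: (@cvg_RIM_0 _ (fun=> g) (N2 g)) => //; near=> n.
have c3 : RI (fun x => (gn n x - g x) * f x) @[n --> \oo] --> (0 : R).
  by apply: (@cvg_RIM_0 _ (fun=> f) (N2 f)) => //; near=> n.
have E n : RI (fun x => fn n x * gn n x) = (RI (fun x => (fn n x - f x) * (gn n x - g x))
  + RI (fun x => (fn n x - f x) * g x)) + RI (fun x => (gn n x - g x) * f x) + RI (fun x => f x * g x).
  have [I1 I2] := (L2rM (Lfd n) (Lgd n), L2rM (Lfd n) Lg).
  have [I3 I4] := (L2rM (Lgd n) Lf, L2rM Lf Lg).
  have I12 := intbleD I1 I2; have I123 := intbleD I12 I3.
  by rewrite -RID// -RID// -RID//; apply: eq_RI => x; ring.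
rewrite (funext E : (fun n => RI (fun x => fn n x * gn n x)) = _).
have H := cvgD (cvgD (cvgD c1 c2) c3) (@cvg_cst R (RI (fun x => f x * g x)) nat \oo _).
by rewrite !add0r in H; exact: H.
Unshelve. all: by end_near. Qed.

End RealL2.

(** * Real and imaginary parts of complex functions *)

Section ComplexParts.
Context {R : realType}.
Implicit Types (z w : R[i]).
Notation Re := (@complex.Re R).
Notation Im := (@complex.Im R).

Lemma cabs_sqr z : cabs z ^+ 2 = Re z ^+ 2 + Im z ^+ 2.
Proof. by case: z => a b /=; rewrite sqr_sqrtr// addr_ge0 ?sqr_ge0. Qed.

Lemma ReM z w : Re (z * w) = Re z * Re w - Im z * Im w.
Proof. by case: z w => [a b] [c d]. Qed.

Lemma ImM z w : Im (z * w) = Re z * Im w + Im z * Re w.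
Proof. by case: z w => [a b] [c d]. Qed.

Lemma ReD z w : Re (z + w) = Re z + Re w.
Proof. by case: z w => [a b] [c d]. Qed.

Lemma ImD z w : Im (z + w) = Im z + Im w.
Proof. by case: z w => [a b] [c d]. Qed.

Lemma ReN z : Re (- z) = - Re z.
Proof. by case: z. Qed.

Lemma ImN z : Im (- z) = - Im z.
Proof. by case: z. Qed.

Lemma ReJ z : Re (z^*) = Re z.
Proof. by case: z. Qed.

Lemma ImJ z : Im (z^*) = - Im z.
Proof. by case: z. Qed.

Lemma ReC (a : R) : Re (a%:C)%C = a. Proof. by []. Qed.
Lemma ImC (a : R) : Im (a%:C)%C = 0. Proof. by []. Qed.

Lemma ReMk (a c : R) : Re (a +i* c)%C = a. Proof. by []. Qed.
Lemma ImMk (a c : R) : Im (a +i* c)%C = c. Proof. by []. Qed.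

Lemma eq_ReIm z w : Re z = Re w -> Im z = Im w -> z = w.
Proof. by case: z w => [a b] [c d] /= -> ->. Qed.

Definition partsE := (ReM, ImM, ReD, ImD, ReN, ImN, ReJ, ImJ, ReC, ImC, ReMk, ImMk).

Lemma cvg_complex {T : Type} {F : set_system T} {FF : Filter F} (z_ : T -> R[i]) z :
  Re (z_ n) @[n --> F] --> Re z -> Im (z_ n) @[n --> F] --> Im z ->
  (z_ n : R[i]^o) @[n --> F] --> (z : R[i]^o).
Proof.
move=> cr ci; apply/cvgrPdist_le => -[e e'] /=; rewrite ltcE/= => /andP[/eqP -> e0].
have e20 : 0 < e / 2 by rewrite divr_gt0.
near=> n; rewrite -[`|_|]/((cabs (z - z_ n))%:C)%C lecE/= eqxx/=.
have h1 : `|Re z - Re (z_ n)| <= e / 2 by near: n; apply: (cvgrPdist_le _ _).1.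
have h2 : `|Im z - Im (z_ n)| <= e / 2 by near: n; apply: (cvgrPdist_le _ _).1.
rewrite -ler_sqr ?nnegrE ?(ltW e0)//; last by case: (z - z_ n) => ? ?; exact: sqrtr_ge0.
rewrite cabs_sqr !partsE.
move: (Re z - Re (z_ n)) (Im z - Im (z_ n)) h1 h2 => a b h1 h2.
rewrite -(real_normK (num_real a)) -(real_normK (num_real b)).
have := normr_ge0 a; have := normr_ge0 b; nra.
Unshelve. all: by end_near. Qed.

Lemma in_L2P (u : R * R -> R[i]) :
  in_L2 u <-> L2r (fun x => Re (u x)) /\ L2r (fun x => Im (u x)).
Proof.
split=> [[mr mi I]|[[mr Ir] [mi Ii]]].
  have I' : intble (fun x => Re (u x) ^+ 2 + Im (u x) ^+ 2).
    by move: I; congr (leb2.-integrable _ _); apply/funext => x /=; rewrite cabs_sqr.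
  by split; apply: L2r_le I' _ => // x; rewrite ?lerDl ?lerDr sqr_ge0.
split=> //; have := intbleD Ir Ii; rewrite /intble; congr (leb2.-integrable _ _).
by apply/funext => x /=; rewrite cabs_sqr.
Qed.

Lemma L2normsqE (u : R * R -> R[i]) : in_L2 u ->
  L2normsq u = N2 (fun x => Re (u x)) + N2 (fun x => Im (u x)).
Proof.
move=> /in_L2P[[_ Ir] [_ Ii]]; rewrite /N2 -RID//.
by apply: eq_RI => x; rewrite cabs_sqr.
Qed.

End ComplexParts.

(** * Symmetry of second derivatives *)

Section Schwarz.
Context {R : realType}.

Lemma MVT_pos (g dg : R -> R) (a h : R) : 0 < h ->
  (forall t : R, is_derive t 1 g (dg t)) ->
  exists2 t, a < t < a + h & g (a + h) - g a = dg t * h.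
Proof.
move=> h0 H; have ah : a < a + h by rewrite ltrDl.
have [t] := MVT ah (fun t _ => H t) (continuous_subspaceT (is_derive_continuous H)).
by rewrite in_itv/= => tP ->; exists t => //; congr (_ * _); ring.
Qed.

Let half_dist (a c d e : R) : `|a - d| <= e / 2 -> `|c - d| <= e / 2 -> `|a - c| <= e.
Proof. by rewrite !ler_norml => /andP[? ?] /andP[? ?]; apply/andP; split; lra. Qed.

(** The second difference of [v] over a square of side [h], evaluated by the mean value theorem in
    either order, equals h^2 times each mixed derivative at some point of the square. Continuity of
    both concludes as [h] shrinks. *)
Lemma schwarz (v : R * R -> R) x : Ck 2 v -> 'D_e1 ('D_e2 v) x = 'D_e2 ('D_e1 v) x.
Proof.
move=> Cv; have [_ _ _ C1 C2] := Cv; have [_ _ _ _ c21] := C1; have [_ _ _ c12 _] := C2.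
case: x => x y.
have box (h : R) : 0 < h -> exists p q : R * R,
   [/\ `|x - p.1| <= h /\ `|y - p.2| <= h, `|x - q.1| <= h /\ `|y - q.2| <= h &
     'D_e1 ('D_e2 v) p = 'D_e2 ('D_e1 v) q].
  move=> h0; have hh : h * h != 0 by rewrite mulf_neq0// gt_eqF.
  pose g s := v (s, y + h) - v (s, y).
  have [s1 sP1 E1] := @MVT_pos g (fun s => 'D_e1 v (s, y + h) - 'D_e1 v (s, y)) x h h0
    (fun t => is_derive_sub ((is_derive_e1P _ _ _ _).1 (Ck_is_derive1 Cv (t, y + h)))
                            ((is_derive_e1P _ _ _ _).1 (Ck_is_derive1 Cv (t, y)))).
  have [t1 tP1 F1] := @MVT_pos (fun t => 'D_e1 v (s1, t)) (fun t => 'D_e2 ('D_e1 v) (s1, t)) y h h0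
    (fun t => (is_derive_e2P _ _ _ _).1 (@Ck_is_derive2 R 0 _ C1 (s1, t))).
  pose k s := v (x + h, s) - v (x, s).
  have [t2 tP2 E2] := @MVT_pos k (fun s => 'D_e2 v (x + h, s) - 'D_e2 v (x, s)) y h h0
    (fun t => is_derive_sub ((is_derive_e2P _ _ _ _).1 (Ck_is_derive2 Cv (x + h, t)))
                            ((is_derive_e2P _ _ _ _).1 (Ck_is_derive2 Cv (x, t)))).
  have [s2 sP2 F2] := @MVT_pos (fun t => 'D_e2 v (t, t2)) (fun t => 'D_e1 ('D_e2 v) (t, t2)) x h h0
    (fun t => (is_derive_e1P _ _ _ _).1 (@Ck_is_derive1 R 0 _ C2 (t, t2))).
  exists (s2, t2), (s1, t1).
  have near_pt (a c : R) : a < c < a + h -> `|a - c| <= h.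
    by clear; move=> /andP[? ?]; rewrite ler_norml; apply/andP; split; lra.
  split; [by split; apply: near_pt|by split; apply: near_pt|].
  rewrite F1 in E1; rewrite F2 in E2.
  have E : g (x + h) - g x = k (y + h) - k y by rewrite /g /k; ring.
  rewrite E1 E2 in E.
  move: ('D_e1 ('D_e2 v) _) ('D_e2 ('D_e1 v) _) E => d12 d21; clear -hh => E.
  by apply: (mulIf hh); rewrite !mulrA.
apply/eqP; rewrite -subr_eq0 -normr_le0; apply/ler_addgt0Pl => e e0; rewrite addr0.
have e20 : 0 < e / 2 by rewrite divr_gt0.
have : \forall p \near (x, y), `|'D_e1 ('D_e2 v) (x, y) - 'D_e1 ('D_e2 v) p| <= e / 2.
  exact: (cvgrPdist_le _ _).1 (c12 (x, y)) _ e20.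
move=> /nbhs_ballP[d1 /= d10 H1].
have : \forall p \near (x, y), `|'D_e2 ('D_e1 v) (x, y) - 'D_e2 ('D_e1 v) p| <= e / 2.
  exact: (cvgrPdist_le _ _).1 (c21 (x, y)) _ e20.
move=> /nbhs_ballP[d2 /= d20 H2].
pose h := Num.min d1 d2 / 2.
have m0 : 0 < Num.min d1 d2 by rewrite lt_min d10.
have h0 : 0 < h by rewrite divr_gt0.
have hd : h < d1 /\ h < d2.
  have : Num.min d1 d2 <= d1 by rewrite ge_min lexx.
  have : Num.min d1 d2 <= d2 by rewrite ge_min lexx orbT.
  by rewrite /h; split; lra.
have [p [q [[p1 p2] [q1 q2] E]]] := box h h0.
have {}H1 := H1 p; have {}H2 := H2 q.
have {}H1 : `|'D_e1 ('D_e2 v) (x, y) - 'D_e1 ('D_e2 v) p| <= e / 2.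
  by apply: H1; split; rewrite /ball/=; [apply: le_lt_trans p1 _|apply: le_lt_trans p2 _]; case: hd.
have {}H2 : `|'D_e2 ('D_e1 v) (x, y) - 'D_e2 ('D_e1 v) q| <= e / 2.
  by apply: H2; split; rewrite /ball/=; [apply: le_lt_trans q1 _|apply: le_lt_trans q2 _]; case: hd.
rewrite E in H1; exact: half_dist H1 H2.
Qed.

End Schwarz.

(** * The magnetic form and the first order operator L *)

Section MagneticForm.
Context {R : realType}.
Variables (A : R * R -> R * R) (b : R * R -> R) (sg : R).
Hypotheses (hA : C1_potential A) (hcurl : forall x, curl A x = b x).
Hypotheses (sg2 : sg ^+ 2 = 1).
Implicit Types (u v : R * R -> R[i]) (x : R * R) (M : R).
Notation Re := (@complex.Re R).
Notation Im := (@complex.Im R).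

Definition gR1 u x : R := - 'D_e1 (fun y => Im (u y)) x + (A x).1 * Re (u x).
Definition gI1 u x : R := 'D_e1 (fun y => Re (u y)) x + (A x).1 * Im (u x).
Definition gR2 u x : R := - 'D_e2 (fun y => Im (u y)) x + (A x).2 * Re (u x).
Definition gI2 u x : R := 'D_e2 (fun y => Re (u y)) x + (A x).2 * Im (u x).

(* Real and imaginary parts of [mag_grad1 A u + i sg mag_grad2 A u]; up to sign
   and a gauge factor this is the Cauchy-Riemann operator. *)
Definition LR u x : R := gR1 u x - sg * gI2 u x.
Definition LI u x : R := gI1 u x + sg * gR2 u x.

Let grad_parts (d1 d2 a : R) (z : R[i]) :
  ((0 +i* 1) * (d1 +i* d2) + a%:C * z)%C = ((- d2 + a * Re z) +i* (d1 + a * Im z))%C.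
Proof. by case: z => p q; apply: eq_ReIm => /=; ring. Qed.

Lemma mag_grad1E u x : mag_grad1 A u x = (gR1 u x +i* gI1 u x)%C.
Proof. exact: grad_parts. Qed.

Lemma mag_grad2E u x : mag_grad2 A u x = (gR2 u x +i* gI2 u x)%C.
Proof. exact: grad_parts. Qed.

Definition C1c M u := [/\ Ck 1 (fun x => Re (u x)), Ck 1 (fun x => Im (u x)) &
  forall x, ~ square M x -> u x = 0].

Let cA1 : continuous (fun x => (A x).1).
Proof. by case: hA => /Ck_continuous. Qed.

Let cA2 : continuous (fun x => (A x).2).
Proof. by case: hA => _ /Ck_continuous. Qed.

Lemma L2_grads M u : C1c M u ->
  [/\ L2r (fun x => (gR1 u x)), L2r (fun x => (gI1 u x)),
      L2r (fun x => (gR2 u x)) & L2r (fun x => (gI2 u x))].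
Proof.
move=> [Cr Ci u0].
have r0 x : ~ square M x -> Re (u x) = 0 by move=> /u0 ->.
have i0 x : ~ square M x -> Im (u x) = 0 by move=> /u0 ->.
have [_ _ _ cr1 cr2] := Cr; have [_ _ _ ci1 ci2] := Ci.
have r10 := vanish_D_e1 (Ck_is_derive1 Cr) r0.
have i10 := vanish_D_e1 (Ck_is_derive1 Ci) i0.
have r20 := vanish_D_e2 (Ck_is_derive2 Cr) r0.
have i20 := vanish_D_e2 (Ck_is_derive2 Ci) i0.
split; apply: (@L2r_compact _ _ M) => [x|x xM].
- apply: cvgD; first by apply: cvgN; exact: ci1.
  by apply: cvgM; [exact: cA1|exact: (Ck_continuous Cr)].
- by rewrite /gR1 i10// r0// oppr0 mulr0 addr0.
- apply: cvgD; first exact: cr1.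
  by apply: cvgM; [exact: cA1|exact: (Ck_continuous Ci)].
- by rewrite /gI1 r10// i0// mulr0 addr0.
- apply: cvgD; first by apply: cvgN; exact: ci2.
  by apply: cvgM; [exact: cA2|exact: (Ck_continuous Cr)].
- by rewrite /gR2 i20// r0// oppr0 mulr0 addr0.
- apply: cvgD; first exact: cr2.
  by apply: cvgM; [exact: cA2|exact: (Ck_continuous Ci)].
- by rewrite /gI2 r20// i0// mulr0 addr0.
Qed.

Lemma L2_Lop M u : C1c M u -> L2r (fun x => (LR u x)) /\ L2r (fun x => (LI u x)).
Proof.
move=> /L2_grads[h1 h2 h3 h4]; split.
- by apply: L2rB => //; apply: L2rZ.
- by apply: L2rD => //; apply: L2rZ.
Qed.

Lemma L2_C1c M u : C1c M u -> in_L2 u.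
Proof.
move=> [Cr Ci u0]; apply/in_L2P; split; apply: (@L2r_compact _ _ M).
- exact: Ck_continuous Cr.
- by move=> x /u0 ->.
- exact: Ck_continuous Ci.
- by move=> x /u0 ->.
Qed.

Definition form_re u v x : R :=
  ((gR1 u x) * (gR1 v x) + (gI1 u x) * (gI1 v x)) +
  ((gR2 u x) * (gR2 v x) + (gI2 u x) * (gI2 v x)).
Definition Lform_re u v x : R :=
  (LR u x) * (LR v x) + (LI u x) * (LI v x).
Definition dot_re u v x : R := Re (u x) * Re (v x) + Im (u x) * Im (v x).

(** The pointwise identity behind the integration by parts, for u = p + i q and v = r + i s. A digit
    denotes the derivative in that variable, [r12] and [s12] are mixed derivatives, [A21] is d_1 A_2
    and [A12] is d_2 A_1. The mixed derivatives cancel on the right, and [A21 - A12] on the left is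
    the field. *)
Let alg (a1 a2 p q r s p1 p2 q1 q2 r1 r2 s1 s2 r12 s12 A21 A12 : R) :
  ((- q1 + a1 * p) * (- s1 + a1 * r) + (p1 + a1 * q) * (r1 + a1 * s)
    + ((- q2 + a2 * p) * (- s2 + a2 * r) + (p2 + a2 * q) * (r2 + a2 * s)))
  - ((- q1 + a1 * p - sg * (p2 + a2 * q)) * (- s1 + a1 * r - sg * (r2 + a2 * s))
    + (p1 + a1 * q + sg * (- q2 + a2 * p)) * (r1 + a1 * s + sg * (- s2 + a2 * r)))
  - sg * ((A21 - A12) * (p * r + q * s)) =
  sg * ((q2 * r1 + q * r12 - (p2 * s1 + p * s12) + (A12 * (p * r + q * s)
      + a1 * (p2 * r + p * r2 + (q2 * s + q * s2))))
    - (q1 * r2 + q * r12 - (p1 * s2 + p * s12) + (A21 * (p * r + q * s)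
      + a2 * (p1 * r + p * r1 + (q1 * s + q * s1))))).
Proof.
have E (x y z w : R) : (x - sg * y) * (z - sg * w) = x * z - sg * (x * w + y * z) + y * w.
  by rewrite -[y * w]mul1r -sg2; ring.
have E' (x y z w : R) : (x + sg * y) * (z + sg * w) = x * z + sg * (x * w + y * z) + y * w.
  by rewrite -[y * w]mul1r -sg2; ring.
by rewrite E E'; ring.
Qed.

(* Integration by parts: the two sides differ by the divergence of a compactly
   supported field; [schwarz] removes the second derivatives of [v]. *)
Lemma form_reE M u v : 0 < M -> C1c M u ->
  Ck 2 (fun x => Re (v x)) -> Ck 2 (fun x => Im (v x)) ->
  RI (fun x => form_re u v x - Lform_re u v x - sg * (b x * dot_re u v x)) = 0.
Proof.
move=> M0 [Cp Cq u0] Cr Cs; case: hA => CA1 CA2.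
set p := fun x => Re (u x) in Cp *; set q := fun x => Im (u x) in Cq *.
set r := fun x => Re (v x) in Cr *; set s := fun x => Im (v x) in Cs *.
have p0 x : ~ square M x -> p x = 0 by rewrite /p => /u0 ->.
have q0 x : ~ square M x -> q x = 0 by rewrite /q => /u0 ->.
have C1r := CkS Cr; have C1s := CkS Cs.
have [_ _ _ Cr1 Cr2] := Cr; have [_ _ _ Cs1 Cs2] := Cs.
(* [F] and [G] are the real parts of [u] times the conjugates of [mag_grad2 A v] and
   [mag_grad1 A v], the fluxes of the integration by parts; they vanish wherever [u] does. *)
pose F x := q x * 'D_e2 r x - p x * 'D_e2 s x + (A x).2 * (p x * r x + q x * s x).
pose G x := q x * 'D_e1 r x - p x * 'D_e1 s x + (A x).1 * (p x * r x + q x * s x).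
have CF : Ck 1 F.
  apply: Ck_add.
    by apply: Ck_sub; [exact: Ck_mul Cq Cr2|exact: Ck_mul Cp Cs2].
  by apply: Ck_mul CA2 _; apply: Ck_add; [exact: Ck_mul Cp C1r|exact: Ck_mul Cq C1s].
have CG : Ck 1 G.
  apply: Ck_add.
    by apply: Ck_sub; [exact: Ck_mul Cq Cr1|exact: Ck_mul Cp Cs1].
  by apply: Ck_mul CA1 _; apply: Ck_add; [exact: Ck_mul Cp C1r|exact: Ck_mul Cq C1s].
have F0 x : ~ square M x -> F x = 0.
  by move=> xM; rewrite /F p0// q0// !mul0r subr0 addr0 mulr0 addr0.
have G0 x : ~ square M x -> G x = 0.
  by move=> xM; rewrite /G p0// q0// !mul0r subr0 addr0 mulr0 addr0.
have [_ _ _ cF1 _] := CF; have [_ _ _ _ cG2] := CG.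
have [IF EF] := integral_D_e1 M0 (Ck_is_derive1 CF) cF1 F0.
have [IG EG] := integral_D_e2 M0 (Ck_is_derive2 CG) cG2 G0.
have D12r x : is_derive x e1 ('D_e2 r) ('D_e2 ('D_e1 r) x).
  exact: is_derive_eq (@Ck_is_derive1 R 0 _ Cr2 x) (schwarz x Cr).
have D12s x : is_derive x e1 ('D_e2 s) ('D_e2 ('D_e1 s) x).
  exact: is_derive_eq (@Ck_is_derive1 R 0 _ Cs2 x) (schwarz x Cs).
have dF x : 'D_e1 F x = ('D_e1 q x * 'D_e2 r x + q x * 'D_e2 ('D_e1 r) x)
   - ('D_e1 p x * 'D_e2 s x + p x * 'D_e2 ('D_e1 s) x)
   + ('D_e1 (fun y => (A y).2) x * (p x * r x + q x * s x)
      + (A x).2 * (('D_e1 p x * r x + p x * 'D_e1 r x) + ('D_e1 q x * s x + q x * 'D_e1 s x))).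
  apply: (@derive_val _ _ _ _ _ _ _ (is_derive_add (is_derive_sub
    (is_derive_mul (Ck_is_derive1 Cq x) (D12r x))
    (is_derive_mul (Ck_is_derive1 Cp x) (D12s x)))
    (is_derive_mul (Ck_is_derive1 CA2 x) (is_derive_add
    (is_derive_mul (Ck_is_derive1 Cp x) (Ck_is_derive1 Cr x))
    (is_derive_mul (Ck_is_derive1 Cq x) (Ck_is_derive1 Cs x)))))).
have dG x : 'D_e2 G x = ('D_e2 q x * 'D_e1 r x + q x * 'D_e2 ('D_e1 r) x)
   - ('D_e2 p x * 'D_e1 s x + p x * 'D_e2 ('D_e1 s) x)
   + ('D_e2 (fun y => (A y).1) x * (p x * r x + q x * s x)
      + (A x).1 * (('D_e2 p x * r x + p x * 'D_e2 r x) + ('D_e2 q x * s x + q x * 'D_e2 s x))).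
  apply: (@derive_val _ _ _ _ _ _ _ (is_derive_add (is_derive_sub
    (is_derive_mul (Ck_is_derive2 Cq x) (@Ck_is_derive2 R 0 _ Cr1 x))
    (is_derive_mul (Ck_is_derive2 Cp x) (@Ck_is_derive2 R 0 _ Cs1 x)))
    (is_derive_mul (Ck_is_derive2 CA1 x) (is_derive_add
    (is_derive_mul (Ck_is_derive2 Cp x) (Ck_is_derive2 Cr x))
    (is_derive_mul (Ck_is_derive2 Cq x) (Ck_is_derive2 Cs x)))))).
have E x : form_re u v x - Lform_re u v x - sg * (b x * dot_re u v x) =
    sg * ('D_e2 G x - 'D_e1 F x).
  have K := alg (A x).1 (A x).2 (p x) (q x) (r x) (s x) ('D_e1 p x) ('D_e2 p x)
    ('D_e1 q x) ('D_e2 q x) ('D_e1 r x) ('D_e2 r x) ('D_e1 s x) ('D_e2 s x)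
    ('D_e2 ('D_e1 r) x) ('D_e2 ('D_e1 s) x)
    ('D_e1 (fun y => (A y).2) x) ('D_e2 (fun y => (A y).1) x).
  rewrite -dG -dF in K; rewrite -{}K.
  by rewrite -(hcurl x).
rewrite (eq_RI E) RIZ; last exact: intbleB.
by rewrite RIB// /RI EF EG subrr mulr0.
Qed.

End MagneticForm.

(** * Energy estimates through L *)

Section ZeroMode.
Context {R : realType}.
Variables (A : R * R -> R * R) (b : R * R -> R) (sg B : R).
Hypotheses (hA : C1_potential A) (hcurl : forall x, curl A x = b x).
Hypotheses (sg2 : sg ^+ 2 = 1) (cb : continuous b) (bB : forall x, `|b x| <= B).
Implicit Types (u v : R * R -> R[i]) (x : R * R) (M : R).
Notation Re := (@complex.Re R).
Notation Im := (@complex.Im R).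

Let mb : measurable_fun [set: R * R] b := continuous_measurable2 cb.

Lemma Cc_smoothP u : Cc_smooth u <->
  [/\ forall k, Ck k (fun x => Re (u x)), forall k, Ck k (fun x => Im (u x)) &
      exists2 M, 0 < M & forall x, ~ square M x -> u x = 0].
Proof.
split=> [[Cr Ci cpt]|[Cr Ci [M M0 u0]]]; split=> //.
  have [M [_ HM]] := compact_bounded cpt.
  exists (`|M| + 1); first by rewrite ltr_wpDl.
  move=> x xM; apply: contrapT => /eqP ux; apply: xM.
  have H : `|x| <= `|M| + 1.
    apply: HM; first by rewrite (le_lt_trans (ler_norm _))// ltrDl.
    by apply: subset_closure.
  move: H; rewrite prod_normE ge_max => /andP[h1 h2].
  by apply/in_square.
apply: (@subclosed_compact _ _ (square M)).
- exact: closed_closure.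
- exact: compact_square.
- rewrite [X in _ `<=` X](closure_id _).1; last first.
    by apply: compact_closed; [exact: norm_hausdorff|exact: compact_square].
  apply: closureS => x /eqP ux; apply: contrapT => xM; apply: ux; exact: u0.
Qed.

Lemma Cc_C1c u : Cc_smooth u -> exists2 M, 0 < M & C1c M u.
Proof. by move=> /Cc_smoothP[Cr Ci [M M0 u0]]; exists M => //; split. Qed.

(** Since Im z = Re (-i z), the imaginary part of the form at (u, v) is its real part at ([mi u],
    v); only real parts have to be studied. *)
Definition mi u x : R[i] := (0 +i* -1)%C * u x.

Lemma mi_parts u x : mi u x = (Im (u x) +i* - Re (u x))%C.
Proof. by rewrite /mi; case: (u x) => p q; apply: eq_ReIm => /=; ring. Qed.

Let mi_grad1 M u x : C1c M u -> (gR1 A (mi u) x) = (gI1 A u x) /\ (gI1 A (mi u) x) = - (gR1 A u x).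
Proof.
move=> [Cr Ci _]; rewrite /gR1 /gI1 (funext (mi_parts u)).
rewrite (@derive_val _ _ _ _ _ _ _ (is_derive_opp (Ck_is_derive1 Cr x))).
by split; [rewrite opprK|rewrite opprD opprK mulrN].
Qed.

Let mi_grad2 M u x : C1c M u -> (gR2 A (mi u) x) = (gI2 A u x) /\ (gI2 A (mi u) x) = - (gR2 A u x).
Proof.
move=> [Cr Ci _]; rewrite /gR2 /gI2 (funext (mi_parts u)).
rewrite (@derive_val _ _ _ _ _ _ _ (is_derive_opp (Ck_is_derive2 Cr x))).
by split; [rewrite opprK|rewrite opprD opprK mulrN].
Qed.

Lemma mi_Lop M u x : C1c M u -> (LR A sg (mi u) x) = (LI A sg u x) /\ (LI A sg (mi u) x) = - (LR A sg u x).
Proof.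
move=> C; have [a1 a2] := mi_grad1 x C; have [a3 a4] := mi_grad2 x C.
by rewrite /LR /LI a1 a2 a3 a4; split; ring.
Qed.

Lemma Lop_sub M M' u v x : C1c M u -> C1c M' v ->
  (LR A sg (fun y => u y - v y) x) = (LR A sg u x) - (LR A sg v x) /\
  (LI A sg (fun y => u y - v y) x) = (LI A sg u x) - (LI A sg v x).
Proof.
move=> [Cr Ci _] [Dr Di _].
have er y : Re (u y - v y) = Re (u y) - Re (v y) by rewrite ReD ReN.
have ei y : Im (u y - v y) = Im (u y) - Im (v y) by rewrite ImD ImN.
rewrite /LR /LI /gR1 /gI1 /gR2 /gI2 (funext er) (funext ei) er ei.
rewrite (@derive_val _ _ _ _ _ _ _ (is_derive_sub (Ck_is_derive1 Cr x) (Ck_is_derive1 Dr x))).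
rewrite (@derive_val _ _ _ _ _ _ _ (is_derive_sub (Ck_is_derive1 Ci x) (Ck_is_derive1 Di x))).
rewrite (@derive_val _ _ _ _ _ _ _ (is_derive_sub (Ck_is_derive2 Cr x) (Ck_is_derive2 Dr x))).
rewrite (@derive_val _ _ _ _ _ _ _ (is_derive_sub (Ck_is_derive2 Ci x) (Ck_is_derive2 Di x))).
move: ('D_e1 _ x) ('D_e1 _ x) ('D_e1 _ x) ('D_e1 _ x) => d1 d2 d3 d4.
by move: ('D_e2 _ x) ('D_e2 _ x) ('D_e2 _ x) ('D_e2 _ x) => d5 d6 d7 d8; split; ring.
Qed.

Lemma Cc_smooth_sub u v : Cc_smooth u -> Cc_smooth v -> Cc_smooth (fun x => u x - v x).
Proof.
move=> /Cc_smoothP[Cr Ci [M M0 u0]] /Cc_smoothP[Dr Di [M' M'0 v0]]; apply/Cc_smoothP.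
have er y : Re (u y - v y) = Re (u y) - Re (v y) by rewrite ReD ReN.
have ei y : Im (u y - v y) = Im (u y) - Im (v y) by rewrite ImD ImN.
rewrite (funext er) (funext ei); split.
- by move=> k; apply: Ck_sub.
- by move=> k; apply: Ck_sub.
exists (M + M'); first exact: addr_gt0.
move=> x xM; rewrite u0 ?v0 ?subrr// => /in_square[h1 h2]; apply: xM; apply/in_square.
  by split; [apply: (le_trans h1)|apply: (le_trans h2)]; rewrite lerDr ltW.
by split; [apply: (le_trans h1)|apply: (le_trans h2)]; rewrite lerDl ltW.
Qed.

Lemma intble_form M M' u v : C1c M u -> C1c M' v -> intble (form_re A u v).
Proof.
move=> /(L2_grads hA)[a1 a2 a3 a4] /(L2_grads hA)[c1 c2 c3 c4].
by apply: intbleD; apply: intbleD; apply: L2rM.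
Qed.

Lemma intble_Lform M M' u v : C1c M u -> C1c M' v -> intble (Lform_re A sg u v).
Proof.
move=> /(L2_Lop sg hA)[a1 a2] /(L2_Lop sg hA)[c1 c2].
by apply: intbleD; apply: L2rM.
Qed.

Lemma intble_bdot u v : in_L2 u -> in_L2 v -> intble (fun x => b x * dot_re u v x).
Proof.
move=> /in_L2P[u1 u2] /in_L2P[v1 v2].
have := intbleD (L2rM (L2r_bmul mb bB u1) v1) (L2rM (L2r_bmul mb bB u2) v2).
by congr intble; apply/funext => x; rewrite /dot_re mulrDr !mulrA.
Qed.

(** The operator identity h = L^* L + sg b in the sense of forms. *)
Lemma RI_form M M' u v : 0 < M -> C1c M u -> C1c M' v ->
  Ck 2 (fun x => Re (v x)) -> Ck 2 (fun x => Im (v x)) ->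
  RI (form_re A u v) = RI (Lform_re A sg u v) + sg * RI (fun x => b x * dot_re u v x).
Proof.
move=> M0 Cu Cv Cr Ci; have := form_reE hA hcurl sg2 M0 Cu Cr Ci.
have I1 := intble_form Cu Cv; have I2 := intble_Lform Cu Cv.
have I3 := intble_bdot (L2_C1c Cu) (L2_C1c Cv).
rewrite RIB; [|exact: intbleB|exact: intbleZ].
rewrite RIB// RIZ// => /eqP; rewrite subr_eq add0r subr_eq => /eqP ->.
by rewrite addrC.
Qed.

Let C2 u : Cc_smooth u -> Ck 2 (fun x => Re (u x)) /\ Ck 2 (fun x => Im (u x)).
Proof. by move=> [Cr Ci _]; split. Qed.

Lemma mag_energyE u : mag_energy A u = RI (form_re A u u).
Proof.
by apply: eq_RI => x; rewrite mag_grad1E mag_grad2E !cabs_sqr /form_re -!expr2.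
Qed.

Let form_parts (a1 a2 c1 c2 a1' a2' c1' c2' : R) :
  (a1 +i* a2)%C * ((c1 +i* c2)%C)^* + (a1' +i* a2')%C * ((c1' +i* c2')%C)^* =
  ((a1 * c1 + a2 * c2 + (a1' * c1' + a2' * c2')) +i*
   (a2 * c1 - a1 * c2 + (a2' * c1' - a1' * c2')))%C.
Proof. by apply: eq_ReIm => /=; ring. Qed.

Lemma Re_mag_form u v : Re (mag_form A u v) = RI (form_re A u v).
Proof.
apply: (@eq_RI _ (fun x => Re (mag_grad1 A u x * (mag_grad1 A v x)^* +
  mag_grad2 A u x * (mag_grad2 A v x)^*))) => x.
by rewrite !mag_grad1E !mag_grad2E form_parts.
Qed.

Lemma Im_mag_form M u v : C1c M u -> Im (mag_form A u v) = RI (form_re A (mi u) v).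
Proof.
move=> Cu; apply: (@eq_RI _ (fun x => Im (mag_grad1 A u x * (mag_grad1 A v x)^* +
  mag_grad2 A u x * (mag_grad2 A v x)^*))) => x; rewrite /form_re.
have [-> ->] := mi_grad1 x Cu; have [-> ->] := mi_grad2 x Cu.
by rewrite !mag_grad1E !mag_grad2E form_parts !mulNr.
Qed.

(** [RI_form] at [v = u], with |sg b| <= B. Convergence of u_n and L u_n in L^2 therefore controls
    the energy. *)
Lemma energy_le u : Cc_smooth u ->
  mag_energy A u <= (N2 (fun x => (LR A sg u x)) + N2 (fun x => (LI A sg u x)))
    + B * (N2 (fun x => Re (u x)) + N2 (fun x => Im (u x))).
Proof.
move=> Cu; have [M M0 C1u] := Cc_C1c Cu; have [Cr Ci] := C2 Cu.
rewrite mag_energyE (RI_form M0 C1u C1u Cr Ci).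
have /in_L2P[[_ I1] [_ I2]] := L2_C1c C1u.
have [[_ I3] [_ I4]] := L2_Lop sg hA C1u.
apply: lerD.
  have E x : LR A sg u x ^+ 2 + LI A sg u x ^+ 2 = Lform_re A sg u u x.
    by rewrite /Lform_re !expr2.
  by rewrite -(eq_RI E) RID.
have -> : sg * RI (fun x => b x * dot_re u u x) = RI (fun x => sg * (b x * dot_re u u x)).
  by rewrite RIZ//; apply: intble_bdot; exact: L2_C1c C1u.
rewrite /N2 -RID// -RIZ; last exact: intbleD.
apply: RI_le.
- by apply: intbleZ; apply: intble_bdot; exact: L2_C1c C1u.
- by apply: intbleZ; exact: intbleD.
- move=> x; rewrite /dot_re -!expr2 mulrA ler_wpM2r ?addr_ge0 ?sqr_ge0//.
  apply: le_trans (ler_norm _) _; rewrite normrM.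
  have -> : `|sg| = 1.
    by apply/eqP; rewrite -(@eqrXn2 _ 2)// ?normr_ge0// real_normK ?num_real// sg2 expr1n.
  by rewrite mul1r.
Qed.

(** Pointwise, since L u is the sum of the two components of the magnetic gradient up to factors of
    modulus one. *)
Lemma N2_Lop_le u : Cc_smooth u ->
  N2 (fun x => (LR A sg u x)) <= 2 * mag_energy A u /\ N2 (fun x => (LI A sg u x)) <= 2 * mag_energy A u.
Proof.
move=> Cu; have [M M0 C1u] := Cc_C1c Cu.
have I := intble_form C1u C1u; have [[_ I3] [_ I4]] := L2_Lop sg hA C1u.
have sq (p q p' q' : R) :
    (p - sg * q') ^+ 2 <= 2 * ((p * p + q * q) + (p' * p' + q' * q')) /\
    (p + sg * q') ^+ 2 <= 2 * ((q' * q' + p' * p') + (q * q + p * p)).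
  have E1 : (p - sg * q') ^+ 2 = p * p - 2 * (sg * (p * q')) + sg ^+ 2 * q' ^+ 2 by ring.
  have E2 : (p + sg * q') ^+ 2 = p * p + 2 * (sg * (p * q')) + sg ^+ 2 * q' ^+ 2 by ring.
  have F1 : (p + sg * q') ^+ 2 >= 0 by exact: sqr_ge0.
  have F2 : (p - sg * q') ^+ 2 >= 0 by exact: sqr_ge0.
  have [F3 F4] := (sqr_ge0 p', sqr_ge0 q).
  rewrite sg2 in E1 E2; rewrite !expr2 in F3 F4 E1 E2 F1 F2 *.
  by split; lra.
rewrite mag_energyE /N2 -!RIZ//; split; apply: RI_le => //; try exact: intbleZ.
- move=> x; rewrite /LR /form_re; have [h _] := sq ((gR1 A u x)) ((gI1 A u x)) ((gR2 A u x)) ((gI2 A u x)).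
  exact: h.
- move=> x; rewrite /LI /form_re; have [_ h] := sq ((gI1 A u x)) ((gR2 A u x)) ((gR2 A u x)) ((gR2 A u x)).
  have [_ {}h] := sq ((gI1 A u x)) ((gR1 A u x)) ((gI2 A u x)) ((gR2 A u x)).
  by apply: (le_trans h); rewrite le_eqVlt; apply/orP; left; apply/eqP; ring.
Qed.

Variable (u : R * R -> R[i]).
Hypothesis L2u : in_L2 u.

(** The Cauchy condition in energy of [form_approx] is replaced by L u_n -> 0, which implies it
    through [energy_le] and encodes L u = 0 as well. *)
Definition approximants (un : nat -> R * R -> R[i]) :=
  [/\ forall n, Cc_smooth (un n),
    N2 (fun x => Re (un n x) - Re (u x)) @[n --> \oo] --> (0 : R) /\
    N2 (fun x => Im (un n x) - Im (u x)) @[n --> \oo] --> (0 : R) &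
    N2 (fun x => (LR A sg (un n) x)) @[n --> \oo] --> (0 : R) /\
    N2 (fun x => (LI A sg (un n) x)) @[n --> \oo] --> (0 : R)].

Lemma L2normsq_sub v w : in_L2 v -> in_L2 w -> L2normsq (fun x => v x - w x) =
  N2 (fun x => Re (v x) - Re (w x)) + N2 (fun x => Im (v x) - Im (w x)).
Proof.
move=> /in_L2P[v1 v2] /in_L2P[w1 w2].
have er y : Re (v y - w y) = Re (v y) - Re (w y) by rewrite ReD ReN.
have ei y : Im (v y - w y) = Im (v y) - Im (w y) by rewrite ImD ImN.
rewrite L2normsqE ?(funext er) ?(funext ei)//.
by apply/in_L2P; rewrite (funext er) (funext ei); split; apply: L2rB.
Qed.

Lemma Cc_L2 v : Cc_smooth v -> in_L2 v.
Proof. by move=> /Cc_C1c[M _ /L2_C1c]. Qed.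

Let small (f : nat -> R) (e : R) : 0 < e -> f n @[n --> \oo] --> (0 : R) ->
  \forall n \near \oo, f n <= e.
Proof.
move=> e0 f0; near=> n; apply: le_trans (ler_norm _) _.
by rewrite -normrN -sub0r; near: n; apply: (cvgrPdist_le _ _).1.
Unshelve. all: by end_near. Qed.

Lemma form_approx_approximants un : approximants un -> form_approx A u un.
Proof.
move=> [Cn [c1 c2] [c3 c4]]; split=> //.
  have -> : (fun n => L2normsq (fun x => un n x - u x)) =
     (fun n => N2 (fun x => Re (un n x) - Re (u x)) + N2 (fun x => Im (un n x) - Im (u x))).
    by apply/funext => n; apply: L2normsq_sub => //; exact: Cc_L2.
  by have H := cvgD c1 c2; rewrite addr0 in H; exact: H.
(* Each of the four squared norms of differences is at most 2 (d + d) = 4 d, so the energy is at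
   most 8 d (1 + |B|), which is half of [e]. *)
move=> e e0; pose d := e / (8 * (2 + 2 * `|B|)).
have B0 : 0 < 2 + 2 * `|B| by rewrite ltr_pwDl// mulr_ge0.
have d0 : 0 < d by rewrite divr_gt0// mulr_gt0.
have := filterI (filterI (small d0 c1) (small d0 c2)) (filterI (small d0 c3) (small d0 c4)).
move=> [N _ HN]; exists N => n m Nn Nm.
have [[a1 a2] [a3 a4]] := HN n Nn; have [[m1 m2] [m3 m4]] := HN m Nm.
have [Mn _ Cun] := Cc_C1c (Cn n); have [Mm _ Cum] := Cc_C1c (Cn m).
have [Ln1 Ln2] := L2_Lop sg hA Cun; have [Lm1 Lm2] := L2_Lop sg hA Cum.
have /in_L2P[un1 un2] := Cc_L2 (Cn n); have /in_L2P[um1 um2] := Cc_L2 (Cn m).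
have /in_L2P[u1 u2] := L2u.
apply: (le_lt_trans (energy_le (Cc_smooth_sub (Cn n) (Cn m)))).
have b1 : N2 (fun x => (LR A sg (fun y => un n y - un m y) x)) <= 4 * d.
  have -> : N2 (fun x => (LR A sg (fun y => un n y - un m y) x)) =
      N2 (fun x => (LR A sg (un n) x) - (LR A sg (un m) x)).
    by apply: eq_RI => x; rewrite (Lop_sub x Cun Cum).1.
  by apply: (le_trans (N2B Ln1 Lm1)); lra.
have b2 : N2 (fun x => (LI A sg (fun y => un n y - un m y) x)) <= 4 * d.
  have -> : N2 (fun x => (LI A sg (fun y => un n y - un m y) x)) =
      N2 (fun x => (LI A sg (un n) x) - (LI A sg (un m) x)).
    by apply: eq_RI => x; rewrite (Lop_sub x Cun Cum).2.
  by apply: (le_trans (N2B Ln2 Lm2)); lra.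
have b3 : N2 (fun x => Re (un n x - un m x)) <= 4 * d.
  have -> : N2 (fun x => Re (un n x - un m x)) =
      N2 (fun x => (Re (un n x) - Re (u x)) - (Re (un m x) - Re (u x))).
    by apply: eq_RI => x; rewrite ReD ReN; congr (_ ^+ 2); ring.
  by apply: (le_trans (N2B (L2rB un1 u1) (L2rB um1 u1))); lra.
have b4 : N2 (fun x => Im (un n x - un m x)) <= 4 * d.
  have -> : N2 (fun x => Im (un n x - un m x)) =
      N2 (fun x => (Im (un n x) - Im (u x)) - (Im (un m x) - Im (u x))).
    by apply: eq_RI => x; rewrite ImD ImN; congr (_ ^+ 2); ring.
  by apply: (le_trans (N2B (L2rB un2 u2) (L2rB um2 u2))); lra.
have BB : B <= `|B| by exact: ler_norm.
have b5 : B * (N2 (fun x => Re (un n x - un m x)) + N2 (fun x => Im (un n x - un m x)))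
    <= `|B| * (8 * d).
  apply: le_trans (ler_wpM2r _ BB) _; first by rewrite addr_ge0 ?N2_ge0.
  by rewrite ler_wpM2l//; lra.
have E : (2 + 2 * `|B|) * (8 * d) = e by rewrite /d; field; rewrite gt_eqF.
have := mulr_ge0 (normr_ge0 B) (ltW d0).
by lra.
Qed.

End ZeroMode.

(** * From approximants to the operator domain *)

Section ZeroModeForm.
Context {R : realType}.
Variables (A : R * R -> R * R) (b : R * R -> R) (sg B : R).
Hypotheses (hA : C1_potential A) (hcurl : forall x, curl A x = b x).
Hypotheses (sg2 : sg ^+ 2 = 1) (cb : continuous b) (bB : forall x, `|b x| <= B).
Implicit Types (u v : R * R -> R[i]) (x : R * R) (M : R).
Notation Re := (@complex.Re R).
Notation Im := (@complex.Im R).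

Let mb : measurable_fun [set: R * R] b := continuous_measurable2 cb.

Lemma L2_mi u : in_L2 u -> in_L2 (mi u).
Proof.
move=> /in_L2P[u1 u2]; apply/in_L2P; rewrite (funext (mi_parts u)); split=> //.
have := L2rZ (-1) u1; congr L2r; apply/funext => x; exact: mulN1r.
Qed.

Lemma N2N (f : R * R -> R) : N2 (fun x => - f x) = N2 f.
Proof. by apply: eq_RI => x; rewrite sqrrN. Qed.

Lemma Cc_mi u : Cc_smooth u -> Cc_smooth (mi u).
Proof.
move=> /Cc_smoothP[Cr Ci [M M0 u0]]; apply/Cc_smoothP.
rewrite (funext (mi_parts u)); split.
- exact: Ci.
- by move=> k; apply: Ck_opp; exact: Cr.
- by exists M => // x /u0 ->; apply: eq_ReIm => //=; rewrite oppr0.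
Qed.

(** L is complex linear, so multiplication by -i only permutes the real and imaginary parts up to
    sign. *)
Lemma approximants_mi u un : approximants A sg u un -> approximants A sg (mi u) (fun n => mi (un n)).
Proof.
move=> [Cn [c1 c2] [c3 c4]]; split; first by move=> n; apply: Cc_mi.
- rewrite (funext (mi_parts u)); split.
    have -> : (fun n => N2 (fun x => Re (mi (un n) x) - Re (Im (u x) +i* - Re (u x))%C)) =
      (fun n => N2 (fun x => Im (un n x) - Im (u x))).
      by apply/funext => n; apply: eq_RI => x; rewrite mi_parts.
    exact: c2.
  have -> : (fun n => N2 (fun x => Im (mi (un n) x) - Im (Im (u x) +i* - Re (u x))%C)) =
      (fun n => N2 (fun x => Re (un n x) - Re (u x))).
    apply/funext => n; rewrite -N2N; apply: eq_RI => x; rewrite mi_parts /=.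
    by congr (_ ^+ 2); ring.
  exact: c1.
- split.
    have -> : (fun n => N2 (fun x => LR A sg (mi (un n)) x)) = (fun n => N2 (LI A sg (un n))).
      apply/funext => n; apply: eq_RI => x; have [M _ C] := Cc_C1c (Cn n).
      by rewrite (mi_Lop A sg x C).1.
    exact: c4.
  have -> : (fun n => N2 (fun x => LI A sg (mi (un n)) x)) = (fun n => N2 (LR A sg (un n))).
    apply/funext => n; rewrite -[RHS]N2N; apply: eq_RI => x; have [M _ C] := Cc_C1c (Cn n).
    by rewrite (mi_Lop A sg x C).2.
  exact: c3.
Qed.

(** From some index [N] on, the energy distance to [vn N] is below 1, and L is bounded by the
    energy. *)
Lemma N2_Lop_bounded v vn : form_approx A v vn -> exists C : R,
  \forall n \near \oo, N2 (LR A sg (vn n)) <= C /\ N2 (LI A sg (vn n)) <= C.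
Proof.
move=> [Cn _ /(_ 1 ltr01)[N HN]].
have [MN _ CN] := Cc_C1c (Cn N); have [lN1 lN2] := L2_Lop sg hA CN.
exists (2 * (2 + (N2 (LR A sg (vn N)) + N2 (LI A sg (vn N))))).
exists N => // n /= Nn; have [Mn _ Cnn] := Cc_C1c (Cn n); have [ln1 ln2] := L2_Lop sg hA Cnn.
have [h1 h2] := N2_Lop_le hA sg2 (Cc_smooth_sub (Cn n) (Cn N)).
have h3 := HN n N Nn (leqnn N).
have [p1 p2] := (N2_ge0 (LR A sg (vn N)), N2_ge0 (LI A sg (vn N))).
have d1 := L2rB ln1 lN1; have d2 := L2rB ln2 lN2.
have k1 : N2 (fun x => LR A sg (vn n) x - LR A sg (vn N) x) <= 2.
  rewrite (_ : N2 _ = N2 (fun x => LR A sg (fun y => vn n y - vn N y) x)); first lra.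
  by apply: eq_RI => x; rewrite (Lop_sub A sg x Cnn CN).1.
have k2 : N2 (fun x => LI A sg (vn n) x - LI A sg (vn N) x) <= 2.
  rewrite (_ : N2 _ = N2 (fun x => LI A sg (fun y => vn n y - vn N y) x)); first lra.
  by apply: eq_RI => x; rewrite (Lop_sub A sg x Cnn CN).2.
split.
  have -> : N2 (LR A sg (vn n)) =
    N2 (fun x => (LR A sg (vn n) x - LR A sg (vn N) x) + LR A sg (vn N) x).
    by apply: eq_RI => x; rewrite subrK.
  by apply: (le_trans (N2D d1 lN1)); lra.
have -> : N2 (LI A sg (vn n)) =
  N2 (fun x => (LI A sg (vn n) x - LI A sg (vn N) x) + LI A sg (vn N) x).
  by apply: eq_RI => x; rewrite subrK.
by apply: (le_trans (N2D d2 lN2)); lra.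
Qed.

Lemma form_approx_cvg v vn : in_L2 v -> form_approx A v vn ->
  N2 (fun x => Re (vn n x) - Re (v x)) @[n --> \oo] --> (0 : R) /\
  N2 (fun x => Im (vn n x) - Im (v x)) @[n --> \oo] --> (0 : R).
Proof.
move=> Lv [Cn c _].
have E n : L2normsq (fun x => vn n x - v x) = N2 (fun x => Re (vn n x) - Re (v x)) +
    N2 (fun x => Im (vn n x) - Im (v x)).
  by apply: L2normsq_sub => //; exact: Cc_L2.
by split; apply: (@squeeze_cvgr _ _ _ _ (fun=> 0) _ _ _ _ (cvg_cst 0) c);
  near=> n; rewrite E N2_ge0/= ?lerDl ?lerDr N2_ge0.
Unshelve. all: by end_near. Qed.

Let cvg_b (fn gn : nat -> R * R -> R) f g :
  (forall n, L2r (fn n)) -> (forall n, L2r (gn n)) -> L2r f -> L2r g ->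
  N2 (fun x => fn n x - f x) @[n --> \oo] --> (0 : R) ->
  N2 (fun x => gn n x - g x) @[n --> \oo] --> (0 : R) ->
  RI (fun x => b x * fn n x * gn n x) @[n --> \oo] --> RI (fun x => b x * f x * g x).
Proof.
move=> Lfn Lgn Lf Lg f0 g0; apply: cvg_RIM => //.
- by move=> n; apply: L2r_bmul bB _.
- exact: L2r_bmul bB _.
have c : B ^+ 2 * N2 (fun x => fn n x - f x) @[n --> \oo] --> (0 : R).
  by have H := cvgM (@cvg_cst R (B ^+ 2) nat \oo _) f0; rewrite mulr0 in H; exact: H.
apply: (@squeeze_cvgr _ _ _ _ (fun=> 0) _ _ _ _ (cvg_cst 0) c).
near=> n; rewrite N2_ge0/=.
have Ld : L2r (fun x => fn n x - f x) by exact: L2rB.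
have [_ I] := Ld; have [_ I'] := L2r_bmul mb bB Ld.
rewrite /N2 -RIZ//; apply: RI_le => //.
- by move: I'; congr intble; apply/funext => x; congr (_ ^+ 2); ring.
- exact: intbleZ.
- move=> x; have -> : b x * fn n x - b x * f x = b x * (fn n x - f x) by ring.
  rewrite exprMn ler_wpM2r ?sqr_ge0//.
  by rewrite -[b x ^+ 2]real_normK ?num_real// lerXn2r ?nnegrE ?(le_trans _ (bB x)).
Unshelve. all: by end_near. Qed.

(** By [RI_form] the form is <L u_n, L v_n> + sg <b u_n, v_n>. The first term tends to 0, one factor
    vanishing in the limit and the other being bounded; the second converges because b is
    bounded. *)
Lemma cvg_form_re u v un vn : in_L2 u -> in_L2 v ->
  approximants A sg u un -> form_approx A v vn ->
  RI (form_re A (un n) (vn n)) @[n --> \oo] --> sg * RI (fun x => b x * dot_re u v x).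
Proof.
move=> Lu Lv [Cun [u1 u2] [u3 u4]] av; have [Cvn _ _] := av.
have [v1 v2] := form_approx_cvg Lv av; have [C bC] := N2_Lop_bounded av.
have [/in_L2P[Lu1 Lu2] /in_L2P[Lv1 Lv2]] := (Lu, Lv).
have LLu n : L2r (LR A sg (un n)) /\ L2r (LI A sg (un n)).
  by have [M _ Cn] := Cc_C1c (Cun n); have [l1 l2] := L2_Lop sg hA Cn; split.
have LLv n : L2r (LR A sg (vn n)) /\ L2r (LI A sg (vn n)).
  by have [M _ Cn] := Cc_C1c (Cvn n); have [l1 l2] := L2_Lop sg hA Cn; split.
have Lun n : L2r (fun x => Re (un n x)) /\ L2r (fun x => Im (un n x)).
  exact/in_L2P/Cc_L2.
have Lvn n : L2r (fun x => Re (vn n x)) /\ L2r (fun x => Im (vn n x)).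
  exact/in_L2P/Cc_L2.
have E n : RI (form_re A (un n) (vn n)) =
    (RI (fun x => LR A sg (un n) x * LR A sg (vn n) x) +
     RI (fun x => LI A sg (un n) x * LI A sg (vn n) x)) +
    sg * (RI (fun x => b x * Re (un n x) * Re (vn n x)) +
          RI (fun x => b x * Im (un n x) * Im (vn n x))).
  have [M M0 Cn] := Cc_C1c (Cun n); have [M' _ Cm] := Cc_C1c (Cvn n).
  have [Cr Ci _] := Cvn n.
  rewrite (RI_form hA hcurl sg2 cb bB M0 Cn Cm (Cr 2%N) (Ci 2%N)).
  have [[l1 l2] [l3 l4]] := (LLu n, LLv n); have [[m1 m2] [m3 m4]] := (Lun n, Lvn n).
  rewrite -[in RHS]RID; [|exact: L2rM|exact: L2rM].
  rewrite -[in RHS]RID; [|by apply: L2rM => //; exact: L2r_bmul bB _|by apply: L2rM => //; exact: L2r_bmul bB _].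
  congr (_ + _ * _); apply: eq_RI => x.
  by rewrite /dot_re; ring.
have Elim : sg * RI (fun x => b x * dot_re u v x) = 0 + 0 + sg * (RI (fun x => b x * Re (u x) * Re (v x)) +
          RI (fun x => b x * Im (u x) * Im (v x))).
  rewrite !add0r -RID; try by apply: L2rM => //; exact: L2r_bmul bB _.
  by congr (_ * _); apply: eq_RI => x; rewrite /dot_re; ring.
rewrite Elim (funext E : (fun n => RI (form_re A (un n) (vn n))) = _).
apply: cvgD; last first.
  apply: cvgM; first exact: cvg_cst.
  by apply: cvgD; apply: cvg_b => // n; case: (Lun n) => //; case: (Lvn n).
apply: cvgD; apply: (@cvg_RIM_0 _ _ _ C) => //.
- by move=> n; case: (LLu n).
- by move=> n; case: (LLv n).
- by apply: filterS bC => n [].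
- by move=> n; case: (LLu n).
- by move=> n; case: (LLv n).
- by apply: filterS bC => n [].
Qed.

(** The limit of the form against every [v] is the scalar product of sg b u with [v]; the imaginary
    part is the real part for [mi u]. *)
Lemma zero_mode u un : in_L2 u -> approximants A sg u un ->
  mag_op A u (fun x => ((sg * b x)%:C)%C * u x).
Proof.
move=> Lu au; have fa := form_approx_approximants hA hcurl sg2 cb bB Lu au.
have /in_L2P[Lu1 Lu2] := Lu.
have wE x : (((sg * b x)%:C)%C * u x) = (sg * (b x * Re (u x)) +i* (sg * (b x * Im (u x))))%C.
  by case: (u x) => p q; apply: eq_ReIm => /=; ring.
split.
- by split=> //; exists un.
- have er x : Re (((sg * b x)%:C)%C * u x) = sg * (b x * Re (u x)) by rewrite wE.
  have ei x : Im (((sg * b x)%:C)%C * u x) = sg * (b x * Im (u x)) by rewrite wE.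
  apply/in_L2P; rewrite (funext er) (funext ei); split; apply: L2rZ; exact: L2r_bmul bB _.
move=> v [Lv [vn av]]; exists un, vn; split=> //.
have [Cun _ _] := au.
apply: cvg_complex.
  have -> : (fun n => Re (mag_form A (un n) (vn n))) = (fun n => RI (form_re A (un n) (vn n))).
    by apply/funext => n; rewrite Re_mag_form.
  have -> : Re (L2dot (fun x => ((sg * b x)%:C)%C * u x) v) = sg * RI (fun x => b x * dot_re u v x).
    rewrite -RIZ; last exact (intble_bdot cb bB Lu Lv).
    apply: (@eq_RI _ (fun x => Re ((((sg * b x)%:C)%C * u x) * (v x)^*))) => x.
    by rewrite wE ReM ReJ ImJ /dot_re /=; ring.
  exact: cvg_form_re.
have -> : (fun n => Im (mag_form A (un n) (vn n))) = (fun n => RI (form_re A (mi (un n)) (vn n))).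
  by apply/funext => n; have [M _ Cn] := Cc_C1c (Cun n); rewrite (Im_mag_form _ _ Cn).
have -> : Im (L2dot (fun x => ((sg * b x)%:C)%C * u x) v) = sg * RI (fun x => b x * dot_re (mi u) v x).
  rewrite -RIZ; last exact (intble_bdot cb bB (L2_mi Lu) Lv).
  apply: (@eq_RI _ (fun x => Im ((((sg * b x)%:C)%C * u x) * (v x)^*))) => x.
  by rewrite wE ImM ReJ ImJ /dot_re mi_parts /=; ring.
apply: (cvg_form_re (L2_mi Lu) Lv _ av); exact: approximants_mi.
Qed.

End ZeroModeForm.

(** * Smooth compactly supported approximants of an L^2 solution of L u = 0 *)

Section Approximants.
Context {R : realType}.
Implicit Types (f g : R * R -> R) (x : R * R) (M : R).

Lemma smooth_cutoff : exists (th dth : R -> R) (C : R),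
  [/\ th 0 = 1, forall t, 0 <= th t <= 1,
      forall t, 1 <= `|t| -> th t = 0 /\ dth t = 0,
      forall k f, Ck k f -> Ck k (fun x => th (f x)) &
      (forall t : R, is_derive t 1 th (dth t)) /\ forall t, `|dth t| <= C].
Proof.
pose q : {poly R} := 'X^2 * (1 - 1^`()).
pose c : R := expR (-1); have c0 : 0 < c by exact: expR_gt0.
have E1 (s : R) : 0 < s -> flat 1 s = expR (- s^-1) by move=> s0; rewrite /flat s0 hornerC mul1r.
have E0 p (s : R) : s <= 0 -> flat p s = 0 by move=> s0; rewrite /flat ltNge s0.
have [C HC] := flat_bound q.
(* On |t| < 1 this is exp (1 - 1/(1 - t^2)); the factor [c^-1] normalises [th 0] to 1, and [q] above
   is the polynomial of the derivative of [flat 1]. *)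
pose th t : R := c^-1 * flat 1 (1 - t ^+ 2).
pose dth t : R := c^-1 * (flat q (1 - t ^+ 2) * (- (2 * t))).
have big (t : R) : 1 <= `|t| -> 1 - t ^+ 2 <= 0.
  by move=> t1; rewrite subr_le0 -[t ^+ 2]real_normK ?num_real// expr_ge1.
exists th, dth, (c^-1 * (C * 2)); split.
- by rewrite /th expr0n subr0 E1// invr1 mulVf// gt_eqF.
- move=> t; rewrite /th; have [t1|t1] := leP (1 - t ^+ 2) 0.
    by rewrite E0// mulr0 lexx ler01.
  rewrite E1// mulr_ge0 ?expR_ge0 ?invr_ge0 ?(ltW c0)//=.
  rewrite mulrC ler_pdivrMr// mul1r ler_expR lerN2.
  by rewrite -[X in X <= _]invr1 lef_pV2 ?posrE// gerBl sqr_ge0.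
- by move=> t t1; rewrite /th /dth !E0 ?big// mul0r mulr0.
- move=> k f Cf; apply: Ck_cmul; apply: Ck_flat; apply: Ck_sub; first exact: Ck_cst.
  exact: Ck_mul.
split.
  move=> t; apply: is_derive_cmul.
  have D : is_derive t 1 (fun s : R => 1 - s ^+ 2) (- (2 * t)).
    have -> : (fun s : R => 1 - s ^+ 2) = (fun s : R => 1 - s * s).
      by apply/funext => s; rewrite expr2.
    have D1 : is_derive t 1 (fun s : R => s * s) (1 * t + t * 1).
      exact: is_derive_mul (is_derive_id t 1) (is_derive_id t 1).
    have D2 : is_derive t 1 (fun=> 1 : R) (0 : R) by exact: is_derive_cst.
    by apply: is_derive_eq (is_derive_sub D2 D1) _; ring.
  exact: is_derive_chain D (is_derive_flat 1 (1 - t ^+ 2)).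
have C0 : 0 <= C by have := HC 1; rewrite expr1n mulr1; apply: le_trans.
move=> t; rewrite normrM gtr0_norm ?invr_gt0// ler_pM2l ?invr_gt0// normrM.
have [t1|t1] := leP 1 `|t|; first by rewrite E0 ?big// normr0 mul0r mulr_ge0.
apply: ler_pM => //.
  apply: (le_trans (HC _)); rewrite -[leRHS]mulr1 ler_wpM2l//.
  have t2 : t ^+ 2 <= 1 by rewrite -[t ^+ 2]real_normK ?num_real// expr_le1// ltW.
  by rewrite expr_le1// ?subr_ge0// gerBl sqr_ge0.
by rewrite normrN normrM ger0_norm// ler_piMr// ltW.
Qed.

Lemma RI_dominated (fn : nat -> R * R -> R) g :
  (forall n, measurable_fun [set: R * R] (fn n)) -> intble g ->
  (forall n x, `|fn n x| <= g x) -> (forall x, fn n x @[n --> \oo] --> (0 : R)) ->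
  RI (fn n) @[n --> \oo] --> (0 : R).
Proof.
move=> mf Ig fg f0.
have [||||_ _ H] := @dominated_convergence _ _ _ leb2 setT measurableT
   (fun n x => (fn n x)%:E) (fun=> 0%E) (EFin \o g) _ _ _ Ig.
- by move=> n; apply/measurable_EFinP; exact: mf.
- by [].
- apply: aeW => x _; have H : (fn n x)%:E @[n --> \oo] --> (0 : R)%:E.
    by apply: cvg_EFin; [exact: nearW|exact: f0].
  exact: H.
- by apply: aeW => x n _; rewrite /= lee_fin.
by rewrite integral0 in H; exact: fine_cvg H.
Qed.

Lemma cvg_harmonic_mul (c : R) : c * n.+1%:R^-1 @[n --> \oo] --> (0 : R).
Proof.
have H := cvgM (@cvg_cst R c nat \oo _) (@cvg_harmonic R).
by rewrite mulr0 in H; exact: H.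
Qed.

Variables (A : R * R -> R * R) (sg : R) (u : R * R -> R[i]).
Hypotheses (hA : C1_potential A) (sg2 : sg ^+ 2 = 1).
Notation Re := (@complex.Re R).
Notation Im := (@complex.Im R).
Hypotheses (Cr : Ck 1 (fun x => Re (u x))) (Ci : Ck 1 (fun x => Im (u x))).
Hypothesis L2u : in_L2 u.
Hypotheses (LRu : forall x, LR A sg u x = 0) (LIu : forall x, LI A sg u x = 0).

Let nsg : `|sg| = 1.
Proof.
by apply/eqP; rewrite -(@eqrXn2 _ 2)// ?normr_ge0// real_normK ?num_real// sg2 expr1n.
Qed.

Let ind M x : R := \1_(square M) x.

Let ind_in M x : square M x -> ind M x = 1.
Proof. by move=> xM; rewrite /ind indicE mem_set. Qed.

Let intble_ind M : intble (ind M).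
Proof.
by have := intble_square 1 M; congr intble; apply/funext => x; rewrite mul1r.
Qed.

Let abs4 (e a1 a2 w1 w2 w3 w4 K : R) : `|a1| + `|a2| <= K ->
  `|w1| <= e -> `|w2| <= e -> `|w3| <= e -> `|w4| <= e ->
  `|w1 + a1 * w2 + sg * (w3 + a2 * w4)| <= e * (2 + K).
Proof.
move=> aK h1 h2 h3 h4; have e0 : 0 <= e := le_trans (normr_ge0 _) h1.
apply: (le_trans (ler_normD _ _)); rewrite normrM nsg mul1r.
have k1 : `|w1 + a1 * w2| <= e + `|a1| * e.
  by apply: (le_trans (ler_normD _ _)); rewrite normrM lerD// ler_wpM2l.
have k2 : `|w3 + a2 * w4| <= e + `|a2| * e.
  by apply: (le_trans (ler_normD _ _)); rewrite normrM lerD// ler_wpM2l.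
have := ler_wpM2l e0 aK; rewrite mulrDr; lra.
Qed.

Let abs2 (d t1 t2 p q P Q e : R) : `|t1| <= d -> `|t2| <= d -> `|P - p| <= e -> `|Q - q| <= e ->
  `|t1 * P + sg * (t2 * Q)| <= d * (`|p| + `|q|) + 2 * d * e.
Proof.
move=> h1 h2 h3 h4; have d0 : 0 <= d := le_trans (normr_ge0 _) h1.
apply: (le_trans (ler_normD _ _)); rewrite !normrM nsg mul1r.
have k1 : `|P| <= `|p| + e.
  by rewrite -[P](subrK p) addrC; apply: (le_trans (ler_normD _ _)); rewrite lerD2l.
have k2 : `|Q| <= `|q| + e.
  by rewrite -[Q](subrK q) addrC; apply: (le_trans (ler_normD _ _)); rewrite lerD2l.
have j1 : `|t1| * `|P| <= d * (`|p| + e) by apply: ler_pM.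
have j2 : `|t2| * `|Q| <= d * (`|q| + e) by apply: ler_pM.
by lra.
Qed.

Let sq_bound (a c d1 : R) : `|a| <= d1 -> (a + c) ^+ 2 <= 2 * d1 ^+ 2 + 2 * c ^+ 2.
Proof.
move=> h; have : a ^+ 2 <= d1 ^+ 2.
  by rewrite -[a ^+ 2]real_normK ?num_real// lerXn2r ?nnegrE ?(le_trans _ h).
have := sqr_ge0 (a - c); nra.
Qed.

Let cvg_squeeze0 (f g : nat -> R) : (forall n, 0 <= f n <= g n) ->
  g n @[n --> \oo] --> (0 : R) -> f n @[n --> \oo] --> (0 : R).
Proof.
move=> fg g0; apply: (@squeeze_cvgr _ _ _ _ (fun=> 0) _ _ _ _ (cvg_cst 0) g0).
by near=> n.
Unshelve. all: by end_near. Qed.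

(** Take a cut-off at scale m times polynomials close to [u] in C^1 on the square of half-side m.
    Since L u = 0, L u_n consists of cut-off derivatives, O(1/m) times a function in L^2, and of
    approximation errors, which are uniformly small on a set of finite area. *)
Lemma exists_approximants : exists un, approximants A sg u un.
Proof.
have [th [dth [C [th0 th01 thout Cth [dthP dthC]]]]] := smooth_cutoff.
have C0 : 0 <= C by apply: le_trans (dthC 0).
have /in_L2P[[mr Ir] [mi Ii]] := L2u.
pose eta (m : R) x := th (x.1 / m) * th (x.2 / m).
pose eta1 (m : R) x := dth (x.1 / m) / m * th (x.2 / m).
pose eta2 (m : R) x := th (x.1 / m) * (dth (x.2 / m) / m).
have dV (f : R * R -> R) x v (m df : R) : is_derive x v f df ->
    is_derive x v (fun y => th (f y / m)) (dth (f x / m) / m * df).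
  move=> Hf; have D : is_derive x v (fun y => f y / m) (m^-1 * df).
    have -> : (fun y => f y / m) = (fun y => m^-1 * f y) by apply/funext => y; rewrite mulrC.
    exact: is_derive_cmul.
  by rewrite -mulrA; apply: is_derive_chain D (dthP _).
have deta1 m x : is_derive x e1 (eta m) (eta1 m x).
  apply: is_derive_eq (is_derive_mul (dV _ _ _ m _ (is_derive_fst x e1))
    (dV _ _ _ m _ (is_derive_snd x e1))) _.
  by rewrite /eta1 /= mulr0 mulr0 addr0 mulr1.
have deta2 m x : is_derive x e2 (eta m) (eta2 m x).
  apply: is_derive_eq (is_derive_mul (dV _ _ _ m _ (is_derive_fst x e2))
    (dV _ _ _ m _ (is_derive_snd x e2))) _.
  by rewrite /eta2 /= mulr0 mul0r add0r mulr1.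
have Ceta m k : Ck k (eta m).
  by apply: Ck_mul; apply: Cth; apply: Ck_mul; try exact: Ck_cst; [exact: Ck_fst|exact: Ck_snd].
have eta_out m x : 0 < m -> ~ square m x -> [/\ eta m x = 0, eta1 m x = 0 & eta2 m x = 0].
  move=> m0 xm.
  have [h|h] : 1 <= `|x.1 / m| \/ 1 <= `|x.2 / m|.
    have E t : (1 <= `|t / m|) = (m <= `|t|).
      by rewrite normrM normfV (gtr0_norm m0) ler_pdivlMr// mul1r.
    rewrite !E; apply/orP; rewrite -[_ || _]negbK negb_or -!ltNge; apply/negP => /andP[h1 h2].
    by apply: xm; apply/in_square; split; exact: ltW.
  - have [t1 t2] := thout _ h; rewrite /eta /eta1 /eta2 t1 t2.
    by split; rewrite !mul0r.
  - have [t1 t2] := thout _ h; rewrite /eta /eta1 /eta2 t1 t2.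
    by split; rewrite ?mul0r !mulr0.
have eta01 m x : 0 <= eta m x <= 1.
  have /andP[a1 a2] := th01 (x.1 / m); have /andP[c1 c2] := th01 (x.2 / m).
  by rewrite /eta mulr_ge0//= mulr_ile1.
have eta1C m x : 0 < m -> `|eta1 m x| <= C / m.
  move=> m0; have /andP[c1 c2] := th01 (x.2 / m).
  rewrite /eta1 normrM (ger0_norm c1) normrM (gtr0_norm (_ : 0 < m^-1)) ?invr_gt0//.
  apply: (le_trans (ler_piMr _ c2)); first by rewrite mulr_ge0// invr_ge0 ltW.
  by rewrite ler_wpM2r// invr_ge0 ltW.
have eta2C m x : 0 < m -> `|eta2 m x| <= C / m.
  move=> m0; have /andP[c1 c2] := th01 (x.1 / m).
  rewrite /eta2 normrM (ger0_norm c1) normrM (gtr0_norm (_ : 0 < m^-1)) ?invr_gt0//.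
  apply: (le_trans (ler_piMl _ c2)); first by rewrite mulr_ge0// invr_ge0 ltW.
  by rewrite ler_wpM2r// invr_ge0 ltW.
pose m (n : nat) : R := n.+1%:R.
have m0 n : 0 < m n by rewrite ltr0n.
have m1 n : 1 <= m n by rewrite ler1n.
pose V n := RI (ind (m n)).
have V0 n : 0 <= V n by apply: RI_ge0 => x; rewrite /ind indicE.
(* A uniform error [d n] on the square costs [d n ^+ 2 * V n] in L^2, [V n] being the area; this
   choice makes both [d n] and that cost at most 1/m. *)
pose d n := ((m n) * (1 + V n))^-1.
have V1 n : 0 < 1 + V n by rewrite ltr_pwDl.
have d0 n : 0 < d n by rewrite invr_gt0 mulr_gt0.
have dm n : d n <= (m n)^-1.
  by rewrite lef_pV2 ?posrE ?mulr_gt0// ler_peMr ?(ltW (m0 n)) ?lerDl ?V0.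
have d1 n : d n <= 1 by apply: (le_trans (dm n)); rewrite invf_le1.
have dV2 n : d n ^+ 2 * V n <= (m n)^-1.
  have h : d n * V n <= 1.
    rewrite /d mulrC ler_pdivrMr ?mulr_gt0// mul1r.
    have : V n <= m n * V n by rewrite ler_peMl.
    have := ltW (m0 n); have := m1 n; rewrite mulrDr mulr1; lra.
  rewrite expr2 -mulrA; apply: le_trans (dm n); rewrite ler_piMr ?(ltW (d0 n))//.
have [CA1 CA2] := hA.
have Kex n : exists2 K : R, 0 <= K & forall x, square (m n) x -> `|(A x).1| + `|(A x).2| <= K.
  have [K1 H1] := bounded_on_square (m n) (Ck_continuous CA1).
  have [K2 H2] := bounded_on_square (m n) (Ck_continuous CA2).
  exists (`|K1| + `|K2|); first by rewrite addr_ge0.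
  move=> x xm; apply: lerD.
    by apply: le_trans (H1 x xm) _; exact: ler_norm.
  by apply: le_trans (H2 x xm) _; exact: ler_norm.
have [K K0 HK] : exists2 K : nat -> R, forall n, 0 <= K n &
    forall n x, square (m n) x -> `|(A x).1| + `|(A x).2| <= K n.
  exists (fun n => sval (cid2 (Kex n))) => n; by case: cid2.
(* L applied to an error involves two first derivatives and coefficients of total size at most
   [K n], so a C^1 error [e n] becomes [e n * (2 + K n) = d n]. *)
pose e n := d n / (2 + K n).
have K2 n : 0 < 2 + K n by rewrite ltr_pwDl.
have e0 n : 0 < e n by rewrite divr_gt0.
have ed n : e n * (2 + K n) = d n by rewrite /e divfK// gt_eqF.
have ed1 n : e n <= d n.
  by rewrite /e ler_pdivrMr// ler_peMr ?(ltW (d0 n))//; have := K0 n; lra.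
have Pex (f : R * R -> R) : Ck 1 f -> exists P : nat -> R * R -> R,
    (forall n k, Ck k (P n)) /\ forall n x, square (m n) x ->
    [/\ `|P n x - f x| <= e n, `|'D_e1 (P n) x - 'D_e1 f x| <= e n
      & `|'D_e2 (P n) x - 'D_e2 f x| <= e n].
  move=> Cf; exists (fun n => sval (cid (C1_approx Cf (m0 n) (e0 n)))).
  by split=> n; case: cid => /= P [].
have [P [CP HP]] := Pex _ Cr; have [Q [CQ HQ]] := Pex _ Ci.
pose un n x : R[i] := (eta (m n) x * P n x +i* (eta (m n) x * Q n x))%C.
have H1 n x : 'D_e1 (fun y => eta (m n) y * P n y) x = eta1 (m n) x * P n x + eta (m n) x * 'D_e1 (P n) x.
  exact: (@derive_val _ _ _ _ _ _ _ (is_derive_mul (deta1 (m n) x) (Ck_is_derive1 (CP n 1%N) x))).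
have H2 n x : 'D_e2 (fun y => eta (m n) y * P n y) x = eta2 (m n) x * P n x + eta (m n) x * 'D_e2 (P n) x.
  exact: (@derive_val _ _ _ _ _ _ _ (is_derive_mul (deta2 (m n) x) (Ck_is_derive2 (CP n 1%N) x))).
have H3 n x : 'D_e1 (fun y => eta (m n) y * Q n y) x = eta1 (m n) x * Q n x + eta (m n) x * 'D_e1 (Q n) x.
  exact: (@derive_val _ _ _ _ _ _ _ (is_derive_mul (deta1 (m n) x) (Ck_is_derive1 (CQ n 1%N) x))).
have H4 n x : 'D_e2 (fun y => eta (m n) y * Q n y) x = eta2 (m n) x * Q n x + eta (m n) x * 'D_e2 (Q n) x.
  exact: (@derive_val _ _ _ _ _ _ _ (is_derive_mul (deta2 (m n) x) (Ck_is_derive2 (CQ n 1%N) x))).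
(* Subtracting [eta] times L u, which is zero, turns every term without a derivative of the cut-off
   into an approximation error. *)
have LRE n x : LR A sg (un n) x =
    - (eta1 (m n) x * Q n x + sg * (eta2 (m n) x * P n x)) -
    eta (m n) x * (('D_e1 (Q n) x - 'D_e1 (fun y => Im (u y)) x) + (- (A x).1) * (P n x - Re (u x))
      + sg * (('D_e2 (P n) x - 'D_e2 (fun y => Re (u y)) x) + (A x).2 * (Q n x - Im (u x)))).
  have -> : LR A sg (un n) x =  LR A sg (un n) x - eta (m n) x * LR A sg u x.
    by rewrite LRu mulr0 subr0.
  rewrite /LR /gR1 /gI2 H2 H3.
  move: ('D_e1 _ x) ('D_e2 _ x) ('D_e1 _ x) ('D_e2 _ x) => *; rewrite /un /=; ring.
have LIE n x : LI A sg (un n) x =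
    (eta1 (m n) x * P n x + (- sg) * (eta2 (m n) x * Q n x)) +
    eta (m n) x * (('D_e1 (P n) x - 'D_e1 (fun y => Re (u y)) x) + (A x).1 * (Q n x - Im (u x))
      + sg * (- ('D_e2 (Q n) x - 'D_e2 (fun y => Im (u y)) x) + (A x).2 * (P n x - Re (u x)))).
  have -> : LI A sg (un n) x =  LI A sg (un n) x - eta (m n) x * LI A sg u x.
    by rewrite LIu mulr0 subr0.
  rewrite /LI /gI1 /gR2 H1 H4.
  move: ('D_e1 _ x) ('D_e2 _ x) ('D_e1 _ x) ('D_e2 _ x) => *; rewrite /un /=; ring.
have Cun n : Cc_smooth (un n).
  apply/Cc_smoothP; split.
  - by move=> k; apply: Ck_mul (Ceta _ k) (CP n k).
  - by move=> k; apply: Ck_mul (Ceta _ k) (CQ n k).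
  - exists (m n) => // x xm; have [E _ _] := eta_out _ _ (m0 n) xm.
    by rewrite /un E !mul0r.
have c01 n : 0 <= C / m n <= C.
  by rewrite divr_ge0 ?(ltW (m0 n))//= ler_pdivrMr// ler_peMr.
pose Np := N2 (fun x => Re (u x)) + N2 (fun x => Im (u x)).
(* The part 2 C comes from cut-off derivatives multiplying approximation errors, the part 1 from the
   error term of L itself. *)
pose D := 2 * C + 1; have D0 : 0 <= D by rewrite /D; lra.
have bnd n (z : R * R -> R) : L2r z -> (forall x, ~ square (m n) x -> z x = 0) ->
    (forall x, square (m n) x -> `|z x| <= C / m n * (`|Re (u x)| + `|Im (u x)|) + D * d n) ->
    0 <= N2 z <= (4 * C ^+ 2 * Np + 2 * D ^+ 2) * (m n)^-1.
  move=> [_ Iz] zout zin; rewrite N2_ge0 /=.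
  pose g x := 4 * (C / m n) ^+ 2 * (Re (u x) ^+ 2 + Im (u x) ^+ 2)
    + 2 * D ^+ 2 * d n ^+ 2 * ind (m n) x.
  have Iri := intbleD Ir Ii.
  have Ig : intble g by apply: intbleD; apply: intbleZ.
  apply: (@le_trans _ _ (RI g)).
    apply: RI_le => // x; have i0 : 0 <= ind (m n) x by rewrite /ind indicE.
    have [xm|xm] := pselect (square (m n) x); last first.
      rewrite zout// expr0n /= /g; apply: addr_ge0.
        by apply: mulr_ge0; [rewrite mulr_ge0 ?sqr_ge0|rewrite addr_ge0 ?sqr_ge0].
      by apply: mulr_ge0 => //; apply: mulr_ge0; [rewrite mulr_ge0 ?sqr_ge0|exact: sqr_ge0].
    rewrite /g ind_in// mulr1.
    have h := zin x xm; have c0 : 0 <= C / m n by case/andP: (c01 n).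
    move: (C / m n) h c0 => c h c0.
    move: (Re (u x)) (Im (u x)) h => p q h.
    have h2 : z x ^+ 2 <= (D * d n + c * (`|p| + `|q|)) ^+ 2.
      rewrite -[z x ^+ 2]real_normK ?num_real// lerXn2r ?nnegrE//; last by rewrite addrC.
      by apply: addr_ge0; apply: mulr_ge0; [exact: D0|exact: ltW|exact: c0|rewrite addr_ge0].
    apply: (le_trans h2).
    have Dd : `|D * d n| <= D * d n by rewrite ger0_norm// mulr_ge0// ltW.
    apply: (le_trans (sq_bound _ Dd)).
    have -> : 2 * (D * d n) ^+ 2 = 2 * D ^+ 2 * d n ^+ 2 by rewrite exprMn mulrA.
    rewrite addrC lerD2r.
    rewrite -(real_normK (num_real p)) -(real_normK (num_real q)).
    have : 0 <= c ^+ 2 * (`|p| - `|q|) ^+ 2 by rewrite mulr_ge0 ?sqr_ge0.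
    by move: (`|p|) (`|q|) => p' q' k; nra.
  rewrite /g RID; [|exact: intbleZ|exact: intbleZ].
  rewrite !RIZ// RID// -/(N2 (fun x => Re (u x))) -/(N2 (fun x => Im (u x))) -/Np -/(V n).
  have Np0 : 0 <= Np by rewrite addr_ge0 ?N2_ge0.
  rewrite [X in _ <= X]mulrDl; apply: lerD.
    have -> : 4 * (C / m n) ^+ 2 * Np = (4 * C ^+ 2 * Np * (m n)^-1) * (m n)^-1.
      by rewrite exprMn; ring.
    by rewrite ler_wpM2r ?invr_ge0 ?(ltW (m0 n))// ler_piMr ?invf_le1// !mulr_ge0// sqr_ge0.
  by rewrite -mulrA ler_wpM2l ?dV2// mulr_ge0// sqr_ge0.
have etan n x : `|eta (m n) x| <= 1.
  by have /andP[h1 h2] := eta01 (m n) x; rewrite ger0_norm.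
have tail n x w1 w2 w3 w4 a1 a2 T1 T2 X Y p q : square (m n) x -> `|a1| + `|a2| <= K n ->
  `|w1| <= e n -> `|w2| <= e n -> `|w3| <= e n -> `|w4| <= e n ->
  `|T1| <= C / m n -> `|T2| <= C / m n -> `|X - p| <= e n -> `|Y - q| <= e n ->
  `|(T1 * X + sg * (T2 * Y)) + eta (m n) x * (w1 + a1 * w2 + sg * (w3 + a2 * w4))|
   <= C / m n * (`|p| + `|q|) + D * d n.
  move=> xm aK b1 b2 b3 b4 t1 t2 xp yq.
  apply: (le_trans (ler_normD _ _)).
  have k1 := abs2 t1 t2 xp yq.
  have k2 := abs4 aK b1 b2 b3 b4; rewrite ed in k2.
  have k3 : `|eta (m n) x * (w1 + a1 * w2 + sg * (w3 + a2 * w4))| <= d n.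
    by rewrite normrM -[d n]mul1r; apply: ler_pM.
  have k4 : 2 * (C / m n) * e n <= 2 * C * d n.
    have /andP[h1 h2] := c01 n.
    by rewrite -[_ * e n]mulrA -[_ * d n]mulrA ler_wpM2l// ler_pM// ltW.
  apply: (le_trans (lerD k1 k3)); rewrite -addrA lerD2l.
  have -> : D * d n = 2 * C * d n + d n by rewrite /D; ring.
  by rewrite lerD2r.
have Lb n : 0 <= N2 (LR A sg (un n)) <= (4 * C ^+ 2 * Np + 2 * D ^+ 2) * (m n)^-1 /\
    0 <= N2 (LI A sg (un n)) <= (4 * C ^+ 2 * Np + 2 * D ^+ 2) * (m n)^-1.
  have [M _ Cn] := Cc_C1c (Cun n); have [l1 l2] := L2_Lop sg hA Cn.
  split; apply: bnd => // x xm.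
  - have [E1 E2 E3] := eta_out _ _ (m0 n) xm.
    by rewrite LRE E1 E2 E3 !mul0r mulr0 !(addr0, oppr0).
  - have [p1 p2 p3] := HP n x xm; have [q1 q2 q3] := HQ n x xm.
    have k := HK n x xm; have t1 := eta1C _ x (m0 n); have t2 := eta2C _ x (m0 n).
    rewrite LRE -opprD normrN [`|Re _| + _]addrC; apply: tail => //.
    by rewrite normrN.
  - have [E1 E2 E3] := eta_out _ _ (m0 n) xm.
    by rewrite LIE E1 E2 E3 !mul0r mulr0 !(addr0, oppr0).
  - have [p1 p2 p3] := HP n x xm; have [q1 q2 q3] := HQ n x xm.
    have k := HK n x xm; have t1 := eta1C _ x (m0 n); have t2 := eta2C _ x (m0 n).
    have -> : LI A sg (un n) x = (eta1 (m n) x * P n x + sg * ((- eta2 (m n) x) * Q n x)) +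
    eta (m n) x * (('D_e1 (P n) x - 'D_e1 (fun y => Re (u y)) x) + (A x).1 * (Q n x - Im (u x))
      + sg * (- ('D_e2 (Q n) x - 'D_e2 (fun y => Im (u y)) x) + (A x).2 * (P n x - Re (u x)))).
      by rewrite LIE !mulNr mulrN.
    by apply: tail; rewrite ?normrN.
have etacvg x : eta (m n) x @[n --> \oo] --> (1 : R).
  have thc t : th (t / m n) @[n --> \oo] --> (1 : R).
    rewrite -th0; apply: continuous_cvg; last exact: cvg_harmonic_mul.
    exact: (is_derive_continuous dthP).
  by have H := cvgM (thc x.1) (thc x.2); rewrite mulr1 in H; exact: H.
(* The difference splits into [eta * (F n - f)], bounded by [d n] on the square, and
   [(1 - eta) * f], which tends to 0 in L^2 by dominated convergence. *)
have conv (f : R * R -> R) (F : nat -> R * R -> R) : L2r f -> (forall n k, Ck k (F n)) ->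
    (forall n x, square (m n) x -> `|F n x - f x| <= e n) ->
    N2 (fun x => eta (m n) x * F n x - f x) @[n --> \oo] --> (0 : R).
  move=> [mf If] CF HF.
  have Lf : L2r f by [].
  pose h n x := (1 - eta (m n) x) ^+ 2 * f x ^+ 2.
  have me n : measurable_fun [set: R * R] (eta (m n)).
    exact: continuous_measurable2 (Ck_continuous (Ceta (m n) 0%N)).
  have mh n : measurable_fun [set: R * R] (h n).
    apply: measurable_funM; last exact: measurable_funX.
    by apply: measurable_funX; apply: measurable_funB.
  have hf n x : `|h n x| <= f x ^+ 2.
    have /andP[h1 h2] := eta01 (m n) x.
    rewrite /h ger0_norm; last by apply: mulr_ge0; exact: sqr_ge0.
    rewrite ler_piMl ?sqr_ge0// expr_le1// ?subr_ge0//.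
    by rewrite gerBl.
  have h0 x : h n x @[n --> \oo] --> (0 : R).
    have H1' : (1 - eta (m n) x) @[n --> \oo] --> (0 : R).
      have H := @cvgB _ _ _ _ _ _ _ (1 : R) 1 (@cvg_cst R 1 nat \oo _) (etacvg x).
      by rewrite subrr in H; exact: H.
    have H2' : (1 - eta (m n) x) ^+ 2 @[n --> \oo] --> (0 * 0 : R) by exact: cvgM.
    have H3' : h n x @[n --> \oo] --> (0 * 0 * f x ^+ 2 : R).
      by apply: cvgM => //; exact: cvg_cst.
    by rewrite !mul0r in H3'; exact: H3'.
  have Ih n : intble (h n) := intble_le (mh n) If (hf n).
  have dct := RI_dominated mh If hf h0.
  apply: (@cvg_squeeze0 _ (fun n => 2 * (m n)^-1 + 2 * RI (h n))); last first.
    have H := cvgD (cvg_harmonic_mul 2) (cvgM (@cvg_cst R 2 nat \oo _) dct).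
    by rewrite mulr0 addr0 in H; exact: H.
  move=> n; rewrite N2_ge0/=.
  pose g x := 2 * d n ^+ 2 * ind (m n) x + 2 * h n x.
  have Ig : intble g by apply: intbleD; apply: intbleZ.
  have L : L2r (fun x => eta (m n) x * F n x - f x).
    apply: L2rB => //; apply: (@L2r_compact _ _ (m n)).
      exact: Ck_continuous (Ck_mul (Ceta (m n) 0%N) (CF n 0%N)).
    by move=> x xm; have [-> _ _] := eta_out _ _ (m0 n) xm; rewrite mul0r.
  apply: (@le_trans _ _ (RI g)).
    apply: RI_le => //; first by case: L.
    move=> x; have [xm|xm] := pselect (square (m n) x); last first.
      have [E _ _] := eta_out _ _ (m0 n) xm; rewrite /g /h E mul0r sub0r subr0 expr1n mul1r sqrrN.
      have i0 : 0 <= ind (m n) x by rewrite /ind indicE.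
      have : 0 <= 2 * d n ^+ 2 * ind (m n) x.
        by apply: mulr_ge0 => //; apply: mulr_ge0 => //; exact: sqr_ge0.
      by have := sqr_ge0 (f x); lra.
    rewrite /g ind_in// mulr1 /h -exprMn.
    have -> : eta (m n) x * F n x - f x = eta (m n) x * (F n x - f x) + - ((1 - eta (m n) x) * f x).
      by ring.
    rewrite -(sqrrN ((1 - eta (m n) x) * f x)); apply: sq_bound.
    rewrite normrM -[d n]mul1r; apply: ler_pM => //.
    exact: le_trans (HF n x xm) (ed1 n).
  rewrite /g RID; [|exact: intbleZ|exact: intbleZ].
  rewrite !RIZ// -/(V n); apply: lerD => //.
  by rewrite -mulrA ler_wpM2l.
exists un; split=> //.
- split.
    by apply: (conv _ P) => // n x xm; have [] := HP n x xm.
  by apply: (conv _ Q) => // n x xm; have [] := HQ n x xm.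
- have H := cvg_harmonic_mul (4 * C ^+ 2 * Np + 2 * D ^+ 2).
  by split; apply: (cvg_squeeze0 _ H) => n; have [l1 l2] := Lb n.
Qed.

End Approximants.

(** * Gauge functions: potentials of curl-free C^1 fields *)

Section GaugePotential.
Context {R : realType}.
Implicit Types (f : R * R -> R) (x : R * R).
Notation mu := (@lebesgue_measure R).

Lemma MVT_lipschitz (g dg : R -> R) (M C a c : R) :
  (forall t : R, is_derive t 1 g (dg t)) -> (forall t, `|t| <= M -> `|dg t| <= C) ->
  `|a| <= M -> `|c| <= M -> `|g c - g a| <= C * `|c - a|.
Proof.
move=> H HC; wlog ac : a c / a <= c => [th aM cM|aM cM].
  have [h|/ltW h] := leP a c; first exact: th.
  by rewrite distrC [`|c - a|]distrC; exact: th.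
have [t + ->] := MVT_segment ac (fun t _ => H t) (continuous_subspaceT (is_derive_continuous H)).
rewrite in_itv/= => /andP[at_ tc]; rewrite normrM ler_wpM2r// HC//.
by move: aM cM; rewrite !ler_norml => /andP[? ?] /andP[? ?]; apply/andP; split; lra.
Qed.

(** Moving one coordinate at a time, the mean value theorem gives a local Lipschitz bound. It
    supplies the continuity that [Ck] asks for besides the partials. *)
Lemma partials_continuous f f1 f2 :
  (forall x, is_derive x e1 f (f1 x)) -> (forall x, is_derive x e2 f (f2 x)) ->
  continuous f1 -> continuous f2 -> continuous f.
Proof.
move=> H1 H2 c1 c2.
suff key (x y e : R) : 0 < e -> exists2 d : R, 0 < d &
    forall z w, `|x - z| < d -> `|y - w| < d -> `|f (x, y) - f (z, w)| <= e.
  move=> x0; apply/cvgrPdist_le => e e0; have [d d0 H] := key x0.1 x0.2 e e0.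
  exists (ball x0.1 d, ball x0.2 d); first by split; exact: nbhsx_ballx.
  by move=> [z w] [/= h1 h2]; have := H z w h1 h2; rewrite -surjective_pairing.
move=> e0; pose M := `|x| + `|y| + 1.
have [C1 HC1] := bounded_on_square M c1; have [C2 HC2] := bounded_on_square M c2.
have M0 : 0 < M by rewrite ltr_wpDl// addr_ge0.
pose C := `|C1| + `|C2| + 1; have C0 : 0 < C by rewrite ltr_wpDl// addr_ge0.
pose d := Num.min 1 (e / (2 * C)); have d0 : 0 < d by rewrite lt_min ltr01 divr_gt0// mulr_gt0.
exists d => // z w h1 h2.
have {}h1 : `|x - z| <= d by exact: ltW.
have {}h2 : `|y - w| <= d by exact: ltW.
have d1 : d <= 1 by rewrite ge_min lexx.
have d2 : C * d <= e / 2.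
  have : d <= e / (2 * C) by rewrite ge_min lexx orbT.
  by rewrite ler_pdivlMr ?mulr_gt0// => h; lra.
have zM : `|z| <= M.
  have := ler_normD (z - x) x; rewrite subrK distrC /M => h; have := normr_ge0 y; lra.
have wM : `|w| <= M.
  have := ler_normD (w - y) y; rewrite subrK distrC /M => h; have := normr_ge0 x; lra.
have xM : `|x| <= M by rewrite /M; have := normr_ge0 y; lra.
have yM : `|y| <= M by rewrite /M; have := normr_ge0 x; lra.
have b1 : `|f (x, y) - f (z, y)| <= C1 * `|x - z|.
  apply: (@MVT_lipschitz (fun s => f (s, y)) (fun s => f1 (s, y)) M) => //.
  - by move=> t; apply/is_derive_e1P.
  - by move=> t tM; apply: HC1; apply/in_square.
have b2 : `|f (z, y) - f (z, w)| <= C2 * `|y - w|.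
  apply: (@MVT_lipschitz (fun s => f (z, s)) (fun s => f2 (z, s)) M) => //.
  - by move=> t; apply/is_derive_e2P.
  - by move=> t tM; apply: HC2; apply/in_square.
have CC1 : C1 <= C by rewrite /C; have := ler_norm C1; have := normr_ge0 C2; lra.
have CC2 : C2 <= C by rewrite /C; have := ler_norm C2; have := normr_ge0 C1; lra.
have k1 : C1 * `|x - z| <= C * d.
  by apply: (@le_trans _ _ (C * `|x - z|)); rewrite ?ler_wpM2r ?ler_wpM2l// ltW.
have k2 : C2 * `|y - w| <= C * d.
  by apply: (@le_trans _ _ (C * `|y - w|)); rewrite ?ler_wpM2r ?ler_wpM2l// ltW.
have -> : f (x, y) - f (z, w) = (f (x, y) - f (z, y)) + (f (z, y) - f (z, w)) by ring.
by apply: (le_trans (ler_normD _ _)); lra.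
Qed.

Lemma integrable_unit (g : R -> R) : continuous g -> mu.-integrable `[0, 1] (EFin \o g).
Proof.
move=> cg; apply: continuous_compact_integrable; first exact: segment_compact.
exact: continuous_subspaceT.
Qed.

Lemma is_derive_integral (f df : R * R -> R) (x : R) :
  continuous f -> continuous df -> (forall z, is_derive z e1 f (df z)) ->
  is_derive x 1 (fun s => \int[mu]_(t in `[0, 1]) f (s, t))
    (\int[mu]_(t in `[0, 1]) df (x, t)).
Proof.
move=> cf cdf H.
have [C HC] := bounded_on_square (`|x| + 2) cdf.
have D s t : (fun r => f (r, t))^`()%classic s = df (s, t).
  have Hs := (is_derive_e1P f s t (df (s, t))).1 (H (s, t)).
  by rewrite derive1E; apply: derive_val.
have Ix : `]x - 1, x + 1[%classic x by rewrite /= in_itv/= ltrBlDr !ltrDl ltr01.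
have i1 s : `]x - 1, x + 1[%classic s ->
    mu.-integrable `[0, 1] (EFin \o (fun t => f (s, t))).
  move=> _; apply: integrable_unit => t.
  by apply: (@continuous_comp _ _ _ (fun t => (s, t)) f); [exact: continuous_pairr|exact: cf].
have i2 s t : `]x - 1, x + 1[%classic s -> `[0, 1]%classic t ->
    derivable (fun r => f (r, t)) s 1.
  by move=> _ _; have [] := (is_derive_e1P f s t (df (s, t))).1 (H (s, t)).
have i3 s t : `]x - 1, x + 1[%classic s -> `[0, 1]%classic t ->
    `|(fun r => f (r, t))^`()%classic s| <= `|C|.
  move=> /= sx t01; rewrite D; apply: le_trans (ler_norm C); apply: HC.
  move: sx t01; rewrite !in_itv/= => /andP[s1 s2] /andP[t0 t1].
  have [x1 x2] : - `|x| <= x /\ x <= `|x| by apply/andP; rewrite -ler_norml.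
  apply/in_square; split; rewrite /= ler_norml; apply/andP; split; lra.
have iC : mu.-integrable `[0, 1] (EFin \o (fun=> `|C|)).
  by apply: integrable_unit => t; apply: cvg_cst.
have mI : measurable (`[0, 1] : set R) by exact: measurable_itv.
have dv := @derivable_under_integral R _ _ mu (fun s t => f (s, t)) _ mI x _ _ Ix i1 i2
  (fun=> `|C|) (fun=> normr_ge0 C) iC i3.
have E := @differentiation_under_integral R _ _ mu (fun s t => f (s, t)) _ mI x _ _ Ix i1 i2
  (fun=> `|C|) (fun=> normr_ge0 C) iC i3.
split; first exact: dv.
rewrite -derive1E E; apply: eq_Rintegral => t _; exact: D.
Qed.

Lemma Rint_FTC (g dg : R -> R) : (forall t : R, is_derive t 1 g (dg t)) -> continuous dg ->
  \int[mu]_(t in `[0, 1]) dg t = g 1 - g 0.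
Proof. by move=> H c; rewrite /Rintegral (FTC2 ltr01 H c). Qed.

Lemma RintD_unit (g h : R -> R) : continuous g -> continuous h ->
  \int[mu]_(t in `[0, 1]) (g t + h t) =
  \int[mu]_(t in `[0, 1]) g t + \int[mu]_(t in `[0, 1]) h t.
Proof. by move=> cg ch; rewrite RintegralD//; exact: integrable_unit. Qed.

Lemma RintZ_unit (c : R) (g : R -> R) : continuous g ->
  \int[mu]_(t in `[0, 1]) (c * g t) = c * \int[mu]_(t in `[0, 1]) g t.
Proof. by move=> cg; rewrite RintegralZl//; exact: integrable_unit. Qed.

Lemma continuous_mulc (c : R) : continuous (fun t : R => t * c).
Proof. by move=> t; apply: cvgM; [exact: cvg_id|exact: cvg_cst]. Qed.

Lemma is_derive_mulc (c t : R) : is_derive t 1 (fun t : R => t * c) c.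
Proof.
have D := is_derive_mul (is_derive_id t 1) (is_derive_cst c t 1).
by apply: is_derive_eq D _; rewrite mulr0 addr0 mul1r.
Qed.

Lemma continuous_scaled (g : R -> R) (c : R) : continuous g -> continuous (fun t : R => g (t * c)).
Proof.
by move=> cg t; apply: (@continuous_comp _ _ _ (fun t : R => t * c) g);
  [exact: continuous_mulc|exact: cg].
Qed.

(** Rescaling to the fixed interval [0, 1] treats both signs of [x] alike and allows differentiation
    under the integral; the integrand g (t x) + x t g' (t x) is the t-derivative of t g (t x). *)
Lemma is_derive_primitive (g dg : R -> R) (x : R) :
  (forall t : R, is_derive t 1 g (dg t)) -> continuous dg ->
  is_derive x 1 (fun s => s * \int[mu]_(t in `[0, 1]) g (t * s)) (g x).
Proof.
move=> H cdg; have cg := is_derive_continuous H.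
have cm : continuous (fun z : R * R => z.2 * z.1).
  by move=> z; apply: cvgM; [exact: continuous_snd|exact: continuous_fst].
pose f (z : R * R) := g (z.2 * z.1); pose df (z : R * R) := z.2 * dg (z.2 * z.1).
have cf : continuous f.
  by move=> z; apply: (@continuous_comp _ _ _ (fun z : R * R => z.2 * z.1) g); [exact: cm|exact: cg].
have cdf : continuous df.
  move=> z; apply: cvgM; first exact: continuous_snd.
  by apply: (@continuous_comp _ _ _ (fun z : R * R => z.2 * z.1) dg); [exact: cm|exact: cdg].
have Hf z : is_derive z e1 f (df z).
  case: z => s t; apply/is_derive_e1P; rewrite /f /df /= mulrC.
  have D : is_derive s 1 (fun s => t * s) t.
    by apply: is_derive_eq (is_derive_cmul t (is_derive_id s 1)) _; rewrite mulr1.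
  exact: is_derive_chain D (H _).
have D := is_derive_mul (is_derive_id x 1) (is_derive_integral x cf cdf Hf).
apply: is_derive_eq D _; rewrite mul1r /f /df /=.
have c1 : continuous (fun t : R => t * dg (t * x)).
  by move=> t; apply: cvgM; [exact: cvg_id|exact: continuous_scaled].
rewrite -RintZ_unit// -RintD_unit//; last 2 first.
- exact: continuous_scaled.
- by move=> t; apply: cvgM; [exact: cvg_cst|exact: c1].
have Dp (t : R) : is_derive t 1 (fun t => t * g (t * x)) (g (t * x) + x * (t * dg (t * x))).
  apply: is_derive_eq (is_derive_mul (is_derive_id t 1)
    (is_derive_chain (is_derive_mulc x t) (H (t * x)))) _.
  by rewrite mul1r; congr (_ + _); ring.
rewrite (Rint_FTC Dp); first by rewrite !mul1r mul0r subr0.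
move=> t; apply: cvgD; first exact: continuous_scaled.
by apply: cvgM; [exact: cvg_cst|exact: c1].
Qed.

(** The field is integrated along the first axis ([p]) and then vertically ([q]). For the
    x_1-derivative of [q], zero curl replaces d_1 a2 by d_2 a1, whose vertical integral is a1 (x, y)
    - a1 (x, 0). *)
Lemma potential_exists (a1 a2 : R * R -> R) : Ck 1 a1 -> Ck 1 a2 ->
  (forall x, 'D_e1 a2 x = 'D_e2 a1 x) ->
  exists chi : R * R -> R, Ck 1 chi /\
    forall x, is_derive x e1 chi (a1 x) /\ is_derive x e2 chi (a2 x).
Proof.
move=> C1 C2 curl0; have [ca1 _ _ c11 c12] := C1; have [ca2 _ _ c21 c22] := C2.
have sec1 (f : R * R -> R) (y : R) : continuous f -> continuous (fun s => f (s, y)).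
  by move=> cf t; apply: (@continuous_comp _ _ _ (fun t => (t, y)) f); [exact: continuous_pairl|exact: cf].
have sec2 (f : R * R -> R) (y : R) : continuous f -> continuous (fun s => f (y, s)).
  by move=> cf t; apply: (@continuous_comp _ _ _ (fun t => (y, t)) f); [exact: continuous_pairr|exact: cf].
pose p (x : R) := x * \int[mu]_(t in `[0, 1]) a1 (t * x, 0).
pose q (x y : R) := y * \int[mu]_(t in `[0, 1]) a2 (x, t * y).
pose chi (z : R * R) := p z.1 + q z.1 z.2.
have dp (x : R) : is_derive x 1 p (a1 (x, 0)).
  apply: (@is_derive_primitive (fun s => a1 (s, 0)) (fun s => 'D_e1 a1 (s, 0))).
    by move=> t; apply/is_derive_e1P; exact: Ck_is_derive1 C1 _.
  exact (sec1 ('D_e1 a1) 0 c11).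
have dq2 (x y : R) : is_derive y 1 (q x) (a2 (x, y)).
  apply: (@is_derive_primitive (fun s => a2 (x, s)) (fun s => 'D_e2 a2 (x, s))).
    by move=> t; apply/is_derive_e2P; exact: Ck_is_derive2 C2 _.
  exact (sec2 ('D_e2 a2) x c22).
have dq1 (x y : R) : is_derive x 1 (q^~ y) (a1 (x, y) - a1 (x, 0)).
  pose s (z : R * R) := (z.1, z.2 * y).
  have cs : continuous s.
    move=> z; apply: (@cvg_pair _ _ _ (nbhs z) (nbhs z.1) (nbhs (z.2 * y)) _ _ _ fst (fun z => z.2 * y)).
      exact: continuous_fst.
    by apply: cvgM; [exact: continuous_snd|exact: cvg_cst].
  have ccomp (f : R * R -> R) : continuous f -> continuous (fun z => f (s z)).
    by move=> cf z; apply: (@continuous_comp _ _ _ s f); [exact: cs|exact: cf].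
  have D := is_derive_cmul y (is_derive_integral x (ccomp _ ca2) (ccomp _ c21) _).
  have {}D := D (fun z => _).
  have {}D : is_derive x 1 (q^~ y) (y * \int[mu]_(t in `[0, 1]) 'D_e1 a2 (x, t * y)).
    apply: D; case=> u v; apply/is_derive_e1P.
    exact: (is_derive_e1P _ _ _ _).1 (Ck_is_derive1 C2 (u, v * y)).
  apply: is_derive_eq D _.
  have E : (fun t => 'D_e1 a2 (x, t * y)) = (fun t => 'D_e2 a1 (x, t * y)).
    by apply/funext => t; exact: curl0.
  have cE : continuous (fun t : R => 'D_e2 a1 (x, t * y)) by exact (@continuous_scaled _ y (sec2 ('D_e2 a1) x c12)).
  rewrite E -RintZ_unit//.
  have D2 (t : R) : is_derive t 1 (fun t => a1 (x, t * y)) (y * 'D_e2 a1 (x, t * y)).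
    rewrite mulrC.
    exact: (@is_derive_chain _ _ (fun r => a1 (x, r)) _ _ _ _ _ (is_derive_mulc y t)
      ((is_derive_e2P _ _ _ _).1 (Ck_is_derive2 C1 (x, t * y)))).
  rewrite (Rint_FTC D2); first by rewrite mul1r mul0r.
  by move=> t; apply: cvgM; [exact: cvg_cst|exact: cE].
have d1 z : is_derive z e1 chi (a1 z).
  case: z => x y; apply/is_derive_e1P.
  by apply: is_derive_eq (is_derive_add (dp x) (dq1 x y)) _; ring.
have d2 z : is_derive z e2 chi (a2 z).
  case: z => x y; apply/is_derive_e2P.
  by apply: is_derive_eq (is_derive_add (is_derive_cst (p x) y 1) (dq2 x y)) _; rewrite add0r.
have cchi := partials_continuous d1 d2 ca1 ca2.
by exists chi; split; [exact (Ck_intro (k := 0) cchi d1 d2 ca1 ca2)|].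
Qed.

End GaugePotential.

(** * Mean values over growing squares *)

Section Means.
Context {R : realType}.
Implicit Types (f g h : R * R -> R) (x l : R * R) (T c d : R).
Notation mu := (@lebesgue_measure R).

Lemma measurable_open_square T : measurable (open_square T).
Proof. by apply: measurableX; exact: measurable_itv. Qed.

Lemma integrable_open_square g T : continuous g ->
  leb2.-integrable (open_square T) (EFin \o g).
Proof.
move=> cg; apply: (@integrableS _ _ _ leb2 (square (`|T| / 2))).
- exact: measurable_square.
- exact: measurable_open_square.
- move=> [x y] []; rewrite /= !in_itv/= => /andP[a1 a2] /andP[a3 a4].
  have h : T <= `|T| by exact: ler_norm.
  by apply/in_square; split; rewrite /= ler_norml; apply/andP; split; lra.
apply: measurable_bounded_integrable.
- exact: measurable_square.
- exact: leb2_square_lty.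
- by apply: measurable_funS (continuous_measurable2 cg).
have [C HC] := bounded_on_square (`|T| / 2) cg.
exists `|C|; split; first exact: num_real.
move=> M CM x xM; apply: le_trans (HC x xM) _.
by apply: le_trans (ler_norm _) (ltW CM).
Qed.

Lemma leb_open_itv T : 0 < T -> mu `](- (T / 2)), (T / 2)[%classic = T%:E.
Proof.
move=> T0; rewrite lebesgue_measure_itv/= lte_fin ifT; last by lra.
by rewrite -EFinD; congr EFin; lra.
Qed.

Lemma leb2_open_square T : 0 < T -> leb2 (open_square T) = (T * T)%:E.
Proof.
move=> T0; rewrite /open_square leb2_box; try exact: measurable_itv.
by rewrite leb_open_itv.
Qed.

Definition MT g T : R := T ^- 2 * \int[leb2]_(x in open_square T) g x.

Lemma MTD f g T : continuous f -> continuous g ->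
  MT (fun x => f x + g x) T = MT f T + MT g T.
Proof.
move=> cf cg; rewrite /MT RintegralD ?mulrDr//; try exact: integrable_open_square.
exact: measurable_open_square.
Qed.

Lemma MTZ (c : R) f T : continuous f -> MT (fun x => c * f x) T = c * MT f T.
Proof.
move=> cf; rewrite /MT RintegralZl; try exact: integrable_open_square.
  by rewrite mulrCA.
exact: measurable_open_square.
Qed.

Lemma MT_cst (c : R) T : 0 < T -> MT (fun=> c) T = c.
Proof.
move=> T0; rewrite /MT.
have -> : \int[leb2]_(x in open_square T) c = c * fine (leb2 (open_square T)).
  by apply: Rintegral_cst; exact: measurable_open_square.
by rewrite leb2_open_square//=; field; rewrite gt_eqF.
Qed.

Lemma MT_le f g T : continuous f -> continuous g -> (forall x, f x <= g x) -> MT f T <= MT g T.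
Proof.
move=> cf cg fg; rewrite /MT ler_wpM2l ?invr_ge0 ?sqr_ge0//.
apply: le_Rintegral => //; try exact: integrable_open_square.
exact: measurable_open_square.
Qed.

(** Continuity is bundled in because it makes [g] integrable on every square, hence the averages
    linear and monotone. *)
Definition mean_to g c := continuous g /\ MT g T @[T --> +oo] --> c.

Lemma eq_mean f g c : f =1 g -> mean_to f c -> mean_to g c.
Proof. by move=> /funext ->. Qed.

Lemma mean_add f g c d : mean_to f c -> mean_to g d -> mean_to (fun x => f x + g x) (c + d).
Proof.
move=> [cf fc] [cg gd]; split; first by move=> x; apply: cvgD; [exact: cf|exact: cg].
have -> : MT (fun x => f x + g x) = (fun T => MT f T + MT g T).
  by apply/funext => T; exact: MTD.
exact: cvgD.
Qed.

Lemma mean_scale (k : R) f c : mean_to f c -> mean_to (fun x => k * f x) (k * c).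
Proof.
move=> [cf fc]; split; first by move=> x; apply: cvgM; [exact: cvg_cst|exact: cf].
have -> : MT (fun x => k * f x) = (fun T => k * MT f T).
  by apply/funext => T; exact: MTZ.
by apply: cvgM => //; exact: cvg_cst.
Qed.

Lemma mean_sub f g c d : mean_to f c -> mean_to g d -> mean_to (fun x => f x - g x) (c - d).
Proof.
move=> Hf Hg; have H := mean_add Hf (mean_scale (-1) Hg).
by rewrite mulN1r in H; apply: eq_mean H => x; rewrite mulN1r.
Qed.

Lemma mean_cst (c : R) : mean_to (fun=> c) c.
Proof.
split; first by move=> x; exact: cvg_cst.
apply: cvg_near_cst; near=> T; rewrite MT_cst//.
Unshelve. all: by end_near. Qed.

Lemma mean_le f g c d : mean_to f c -> mean_to g d -> (forall x, f x <= g x) -> c <= d.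
Proof.
move=> [cf fc] [cg gd] fg; apply: (ler_cvg_to fc gd).
by near=> T; exact: MT_le.
Unshelve. all: by end_near. Qed.

Lemma mean_unique f c d : mean_to f c -> mean_to f d -> c = d.
Proof.
by move=> h1 h2; apply/eqP; rewrite eq_le; apply/andP; split;
  [apply: (mean_le h1 h2)|apply: (mean_le h2 h1)].
Qed.

Let dist_MT f g e T : 0 < T -> continuous f -> continuous g ->
  (forall x, `|f x - g x| <= e) -> `|MT f T - MT g T| <= e.
Proof.
move=> T0 cf cg H.
have cge (k : R) : continuous (fun x => g x + k).
  by move=> x; apply: cvgD; [exact: cg|exact: cvg_cst].
have E (k : R) : MT (fun x => g x + k) T = MT g T + k.
  by rewrite MTD ?MT_cst// => x; exact: cvg_cst.
have h1 : MT f T <= MT g T + e.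
  rewrite -E; apply: MT_le => // x; have := H x.
  by rewrite ler_norml => /andP[? ?]; lra.
have h2 : MT g T - e <= MT f T.
  rewrite -E; apply: MT_le => // x; have := H x.
  by rewrite ler_norml => /andP[? ?]; lra.
by rewrite ler_norml; apply/andP; split; lra.
Qed.

Lemma mean_approx f c : continuous f ->
  (forall e, 0 < e -> exists g, mean_to g c /\ forall x, `|f x - g x| <= e) -> mean_to f c.
Proof.
move=> cf H; split=> //; apply/cvgrPdist_le => e e0.
have e20 : 0 < e / 2 by rewrite divr_gt0.
have [g [[cg gc] fg]] := H _ e20.
near=> T; have T0 : 0 < T by near: T; apply: nbhs_pinfty_gt; exact: num_real.
have h1 : `|MT f T - MT g T| <= e / 2 by exact: dist_MT.
have h2 : `|c - MT g T| <= e / 2 by near: T; exact: (cvgrPdist_le _ _).1 gc _ e20.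
move: h1 h2; rewrite !ler_norml => /andP[? ?] /andP[? ?]; apply/andP; split; lra.
Unshelve. all: by end_near. Qed.

(** Averages of uniformly close functions are uniformly close, so those of [f] form a Cauchy
    family. *)
Lemma mean_ex f : continuous f ->
  (forall e, 0 < e -> exists g c, mean_to g c /\ forall x, `|f x - g x| <= e) ->
  exists c, mean_to f c.
Proof.
move=> cf H; suff /cauchy_cvgP : cauchy (MT f @ +oo).
  by move=> cv; exists (lim (MT f @ +oo)); split.
apply/cauchy_exP => e e0.
have e20 : 0 < e / 3 by rewrite divr_gt0.
have [g [c [[cg gc] fg]]] := H _ e20.
exists c; rewrite /fmapE/=.
near=> T; have T0 : 0 < T by near: T; apply: nbhs_pinfty_gt; exact: num_real.
have h1 : `|MT f T - MT g T| <= e / 3 by exact: dist_MT.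
have h2 : `|c - MT g T| <= e / 3 by near: T; exact: (cvgrPdist_le _ _).1 gc _ e20.
rewrite /ball/=; move: h1 h2; rewrite ler_norml ltr_norml => /andP[? ?].
rewrite ler_norml => /andP[? ?]; apply/andP; split; lra.
Unshelve. all: by end_near. Qed.

Lemma unif_approx_continuous f :
  (forall e, 0 < e -> exists g, continuous g /\ forall x, `|f x - g x| <= e) -> continuous f.
Proof.
move=> H x; apply/cvgrPdist_le => e e0.
have e30 : 0 < e / 3 by rewrite divr_gt0.
have [g [cg fg]] := H _ e30; have h1 := fg x.
near=> y; have h2 := fg y.
have h3 : `|g x - g y| <= e / 3 by near: y; exact: (cvgrPdist_le _ _).1 (cg x) _ e30.
move: h1 h2 h3; rewrite !ler_norml => /andP[? ?] /andP[? ?] /andP[? ?].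
by apply/andP; split; lra.
Unshelve. all: by end_near. Qed.

End Means.

(** * Means of plane waves *)

Section MeanCos.
Context {R : realType}.
Implicit Types (f g h : R * R -> R) (x l : R * R).
Notation mu := (@lebesgue_measure R).
Notation I_ T := `](- (T / 2)), (T / 2)[%classic.

Let open_squareE T (x y : R) : ((x, y) \in open_square T) = (x \in I_ T) && (y \in I_ T).
Proof.
by apply/idP/andP => [/set_mem[h1 h2]|[/set_mem h1 /set_mem h2]];
  [split; apply: mem_set|apply: mem_set; split].
Qed.

Lemma integral_open_square1 f (K T : R) : 0 < T -> 0 <= K -> continuous f ->
  (forall y, (`|\int[mu]_(x in I_ T) (f (x, y))%:E| <= K%:E)%E) ->
  `|\int[leb2]_(x in open_square T) f x| <= K * T.
Proof.
move=> T0 K0 cf HK.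
have mQ := measurable_open_square T.
have I0 : leb2.-integrable (open_square T) (EFin \o f) by exact: integrable_open_square.
have fin : (\int[leb2]_(x in open_square T) (f x)%:E)%E \is a fin_num.
  by apply: integrable_fin_num.
rewrite -lee_fin /Rintegral; set J := (X in fine X).
have -> : `|fine J|%:E = (`|J|)%E by rewrite -fine_abse// fineK// abse_fin_num.
rewrite /J integral_mkcond.
have Ip : leb2.-integrable setT ((EFin \o f) \_ (open_square T)).
  by apply: (iffLR (integrable_mkcond _ _)); [exact: mQ|exact: I0].
rewrite /leb2 -(integral21_prod_meas1 Ip).
apply: (le_trans (le_abse_integral _ measurableT _)).
  exact: measurable_fubini_G Ip.
have mI : measurable (I_ T : set R) by exact: measurable_itv.
have sec (y : R) : (`|fubini_G mu ((EFin \o f) \_ (open_square T)) y| <= (K * \1_(I_ T) y)%:E)%E.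
  rewrite /fubini_G indicE; have [yI|yI] := boolP (y \in I_ T).
    rewrite mulr1; have -> : (\int[mu]_x ((EFin \o f) \_ (open_square T)) (x, y) =
        \int[mu]_(x in I_ T) (f (x, y))%:E)%E.
      rewrite [RHS]integral_mkcond; apply: eq_integral => x _.
      by rewrite !patchE open_squareE yI andbT.
    exact: HK.
  rewrite (@eq_integral _ _ _ _ _ (fun=> 0%E)) ?integral0 ?abse0 ?mulr0// => x _.
  by rewrite patchE open_squareE (negbTE yI) andbF.
apply: (@le_trans _ _ (\int[mu]_y (K * \1_(I_ T) y)%:E)%E).
  apply: ge0_le_integral => //.
  - by apply: measurableT_comp => //; exact: measurable_fubini_G Ip.
  - by apply/measurable_EFinP; apply: measurable_funM => //; exact: measurable_indic.
  - by move=> y _; exact: sec.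
under eq_integral do rewrite EFinM.
rewrite ge0_integralZl//; last first.
  by apply: measurableT_comp => //; exact: measurable_indic.
by rewrite integral_indic// setIT EFinM -(leb_open_itv T0) lexx.
Qed.

Lemma integral_open_square2 f (K T : R) : 0 < T -> 0 <= K -> continuous f ->
  (forall x : R, (`|\int[mu]_(y in I_ T) (f (x, y))%:E| <= K%:E)%E) ->
  `|\int[leb2]_(x in open_square T) f x| <= K * T.
Proof.
move=> T0 K0 cf HK.
have mQ := measurable_open_square T.
have I0 : leb2.-integrable (open_square T) (EFin \o f) by exact: integrable_open_square.
have fin : (\int[leb2]_(x in open_square T) (f x)%:E)%E \is a fin_num.
  by apply: integrable_fin_num.
rewrite -lee_fin /Rintegral; set J := (X in fine X).
have -> : `|fine J|%:E = (`|J|)%E by rewrite -fine_abse// fineK// abse_fin_num.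
rewrite /J integral_mkcond.
have Ip : leb2.-integrable setT ((EFin \o f) \_ (open_square T)).
  by apply: (iffLR (integrable_mkcond _ _)); [exact: mQ|exact: I0].
rewrite /leb2 -(integral12_prod_meas1 Ip).
apply: (le_trans (le_abse_integral _ measurableT _)).
  exact: measurable_fubini_F Ip.
have mI : measurable (I_ T : set R) by exact: measurable_itv.
have sec (x : R) : (`|fubini_F mu ((EFin \o f) \_ (open_square T)) x| <= (K * \1_(I_ T) x)%:E)%E.
  rewrite /fubini_F indicE; have [xI|xI] := boolP (x \in I_ T).
    rewrite mulr1; have -> : (\int[mu]_y ((EFin \o f) \_ (open_square T)) (x, y) =
        \int[mu]_(y in I_ T) (f (x, y))%:E)%E.
      rewrite [RHS]integral_mkcond; apply: eq_integral => y _.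
      by rewrite !patchE open_squareE xI.
    exact: HK.
  rewrite (@eq_integral _ _ _ _ _ (fun=> 0%E)) ?integral0 ?abse0 ?mulr0// => y _.
  by rewrite patchE open_squareE (negbTE xI).
apply: (@le_trans _ _ (\int[mu]_x (K * \1_(I_ T) x)%:E)%E).
  apply: ge0_le_integral => //.
  - by apply: measurableT_comp => //; exact: measurable_fubini_F Ip.
  - by apply/measurable_EFinP; apply: measurable_funM => //; exact: measurable_indic.
  - by move=> x _; exact: sec.
under eq_integral do rewrite EFinM.
rewrite ge0_integralZl//; last first.
  by apply: measurableT_comp => //; exact: measurable_indic.
by rewrite integral_indic// setIT EFinM -(leb_open_itv T0) lexx.
Qed.

Lemma is_derive_affine (k c t : R) : is_derive t 1 (fun t => k * t + c) k.
Proof.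
apply: (is_derive_eq (is_derive_add (is_derive_cmul k (is_derive_id t 1)) (is_derive_cst c t 1))).
by rewrite addr0 mulr1.
Qed.

Lemma integral_cos_le (k c T : R) : k != 0 -> 0 < T ->
  (`|\int[mu]_(t in I_ T) (cos (k * t + c))%:E| <= (2 / `|k|)%:E)%E.
Proof.
move=> k0 T0.
have D (t : R) : is_derive t 1 (fun t => k^-1 * sin (k * t + c)) (cos (k * t + c)).
  apply: (is_derive_eq (is_derive_cmul k^-1 (is_derive_chain (is_derive_affine k c t) (is_derive_sin _)))).
  by rewrite mulrCA mulVf// mulr1.
have cc : continuous (fun t : R => cos (k * t + c)).
  move=> t; apply: (@continuous_comp _ _ _ (fun t => k * t + c) cos); last exact: continuous_cos.
  exact: (is_derive_continuous (is_derive_affine k c)).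
have mc : measurable_fun setT (fun t : R => (cos (k * t + c))%:E).
  by apply/measurable_EFinP; exact: continuous_measurable_fun.
have -> : (\int[mu]_(t in I_ T) (cos (k * t + c))%:E =
    \int[mu]_(t in `[(- (T / 2))%R, (T / 2)%R]) (cos (k * t + c))%:E)%E.
  rewrite -[RHS]integral_itv_bndo_bndc; last exact: measurable_funTS.
  by rewrite -[RHS]integral_itv_obnd_cbnd; last exact: measurable_funTS.
rewrite (FTC2 _ D cc); last by lra.
rewrite lee_fin -mulrBr normrM normfV mulrC ler_wpM2r ?invr_ge0//.
by apply: (le_trans (ler_normB _ _)); apply: lerD; exact: sin_max.
Qed.

Lemma continuous_dot2 l (c : R) : continuous (fun x => dot2 l x + c).
Proof.
move=> x; apply: cvgD; last exact: cvg_cst.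
by apply: cvgD; apply: cvgM; try exact: cvg_cst; [exact: continuous_fst|exact: continuous_snd].
Qed.

Lemma continuous_cos_dot2 l (c : R) : continuous (fun x => cos (dot2 l x + c)).
Proof.
move=> x; apply: (@continuous_comp _ _ _ (fun x => dot2 l x + c) cos); last exact: continuous_cos.
exact: continuous_dot2.
Qed.

(** A nonzero frequency has a nonzero coordinate; integrals in that coordinate stay bounded, so the
    integral over the square is O(T) against the area T^2. *)
Lemma mean_cos l (c : R) : mean_to (fun x => cos (dot2 l x + c)) (if l == 0 then cos c else 0).
Proof.
case: eqP => [->|/eqP l0].
  by apply: eq_mean (mean_cst _) => x; rewrite /dot2 !mul0r !add0r.
split; first exact: continuous_cos_dot2.
have [K K0 HK] : exists2 K : R, 0 <= K & forall T, 0 < T ->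
    `|\int[leb2]_(x in open_square T) cos (dot2 l x + c)| <= K * T.
  have [l1|l1] := eqVneq l.1 0; last first.
    exists (2 / `|l.1|); first by rewrite divr_ge0.
    move=> T T0; apply: integral_open_square1 => //; first exact: continuous_cos_dot2.
    move=> y; have := integral_cos_le (l.2 * y + c) l1 T0.
    by under eq_integral do rewrite addrA.
  have l2 : l.2 != 0.
    by apply: contraNN l0 => /eqP l2; rewrite [l]surjective_pairing l1 l2.
  exists (2 / `|l.2|); first by rewrite divr_ge0.
  move=> T T0; apply: integral_open_square2 => //; first exact: continuous_cos_dot2.
  move=> x; have := integral_cos_le (l.1 * x + c) l2 T0.
  by under eq_integral do rewrite addrA [l.2 * _ + _]addrC.
apply/cvgrPdist_le => e e0; near=> T; rewrite sub0r normrN.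
have T0 : 0 < T by near: T; apply: nbhs_pinfty_gt; exact: num_real.
have Te : K / e <= T by near: T; apply: nbhs_pinfty_ge; exact: num_real.
rewrite /MT normrM ger0_norm ?invr_ge0 ?sqr_ge0// mulrC ler_pdivrMr ?exprn_gt0//.
apply: (le_trans (HK T T0)).
rewrite ler_pdivrMr// in Te.
by rewrite expr2 mulrA ler_wpM2r ?(ltW T0)// mulrC.
Unshelve. all: by end_near. Qed.

End MeanCos.

(** * Fejer kernels and uniqueness of Fourier coefficients *)

Section TrigPolynomials.
Context {R : realType}.
Implicit Types (f g K : R * R -> R) (x l m : R * R) (a c d e : R).

Inductive TP : (R * R -> R) -> Prop :=
| TP0 : TP (fun=> 0)
| TPS a l c f : TP f -> TP (fun x => a * cos (dot2 l x + c) + f x).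

Lemma TP_continuous f : TP f -> continuous f.
Proof.
elim=> [|a l c g _ cg] x; first exact: cvg_cst.
by apply: cvgD; [apply: cvgM; [exact: cvg_cst|exact: continuous_cos_dot2]|exact: cg].
Qed.

Lemma TP_add f g : TP f -> TP g -> TP (fun x => f x + g x).
Proof.
move=> Hf; elim: Hf g => [g Hg|a l c h _ ih g Hg].
  by have := Hg; congr TP; apply/funext => x; rewrite add0r.
by have := TPS a l c (ih g Hg); congr TP; apply/funext => x; rewrite addrA.
Qed.

Lemma TP_scale k f : TP f -> TP (fun x => k * f x).
Proof.
elim=> [|a l c h _ ih].
  by have := TP0; congr TP; apply/funext => x; rewrite mulr0.
by have := TPS (k * a) l c ih; congr TP; apply/funext => x; rewrite mulrDr mulrA.
Qed.

Lemma TP_cos a l c : TP (fun x => a * cos (dot2 l x + c)).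
Proof. by have := TPS a l c TP0; congr TP; apply/funext => x; rewrite addr0. Qed.

Lemma TP_mean f : TP f -> exists c, mean_to f c.
Proof.
elim=> [|a l c g _ [d Hd]]; first by exists 0; exact: mean_cst.
by eexists; apply: mean_add Hd; apply: mean_scale; exact: mean_cos.
Qed.

Lemma cos_mul_cos (s t : R) : cos s * cos t = 2^-1 * (cos (s + t) + cos (s - t)).
Proof. by rewrite cosD cosB; field. Qed.

Lemma dot2D l m x : dot2 (l + m) x = dot2 l x + dot2 m x.
Proof. by rewrite /dot2 /=; ring. Qed.

Lemma dot2B l m x : dot2 (l - m) x = dot2 l x - dot2 m x.
Proof. by rewrite /dot2 /=; ring. Qed.

Lemma TP_mulcos f l c : TP f -> TP (fun x => f x * cos (dot2 l x + c)).
Proof.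
elim=> [|a m d h _ ih].
  by have := TP0; congr TP; apply/funext => x; rewrite mul0r.
have := TP_add (TP_add (TP_cos (a / 2) (m + l) (d + c)) (TP_cos (a / 2) (m - l) (d - c))) ih.
congr TP; apply/funext => x; rewrite [RHS]mulrDl -[a * cos _ * cos _]mulrA cos_mul_cos dot2D dot2B.
have -> : dot2 m x + d + (dot2 l x + c) = dot2 m x + dot2 l x + (d + c) by ring.
have -> : dot2 m x + d - (dot2 l x + c) = dot2 m x - dot2 l x + (d - c) by ring.
ring.
Qed.

Variable x0 : R * R.

(** The wave is centred so that its maximum 1 is attained at [x0], the point where the kernels have
    to concentrate. *)
Definition ck l x : R := cos (dot2 l x - dot2 l x0).

Lemma mean_ck l : mean_to (ck l) (if l == 0 then 1 else 0).
Proof.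
have := mean_cos l (- dot2 l x0); case: eqP => // ->.
by rewrite (_ : cos (- dot2 0 x0) = 1)// /dot2 !mul0r addr0 oppr0 cos0.
Qed.

Lemma ck_mul l m x : ck l x * ck m x = 2^-1 * (ck (l + m) x + ck (l - m) x).
Proof. by rewrite /ck cos_mul_cos !dot2B !dot2D; congr (_ * (cos _ + cos _)); ring. Qed.

Lemma ck_le1 l x : -1 <= ck l x <= 1.
Proof. by rewrite -ler_norml; exact: cos_max. Qed.

Lemma ck_double (k : R) l x : ck (2 * (k * l.1), 2 * (k * l.2)) x = 2 * ck (k * l.1, k * l.2) x ^+ 2 - 1.
Proof.
rewrite /ck; set s := dot2 (k * l.1, k * l.2) x - dot2 (k * l.1, k * l.2) x0.
have -> : dot2 (2 * (k * l.1), 2 * (k * l.2)) x - dot2 (2 * (k * l.1), 2 * (k * l.2)) x0 = s *+ 2.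
  by rewrite /s /dot2 /= mulr2n; ring.
by rewrite cos_mulr2n mulr2n; ring.
Qed.

(* Nonnegativity of the coefficients is stable under products and bounds the
   mean of a kernel below by its constant term. *)
Inductive PK : (R * R -> R) -> Prop :=
| PK0 : PK (fun=> 0)
| PKS a l f : 0 <= a -> PK f -> PK (fun x => a * ck l x + f x).

Lemma PK_mean f : PK f -> exists2 c, 0 <= c & mean_to f c.
Proof.
elim=> [|a l g a0 _ [d d0 Hd]]; first by exists 0 => //; exact: mean_cst.
eexists; last by apply: mean_add Hd; apply: mean_scale; exact: mean_ck.
by rewrite addr_ge0// mulr_ge0//; case: ifP.
Qed.

Lemma PK_add f g : PK f -> PK g -> PK (fun x => f x + g x).
Proof.
move=> Hf; elim: Hf g => [g Hg|a l h a0 _ ih g Hg].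
  by have := Hg; congr PK; apply/funext => x; rewrite add0r.
by have := PKS l a0 (ih g Hg); congr PK; apply/funext => x; rewrite addrA.
Qed.

Lemma PK_ck f l : PK f -> PK (fun x => f x * ck l x).
Proof.
elim=> [|a m h a0 _ ih].
  by have := PK0; congr PK; apply/funext => x; rewrite mul0r.
have a20 : 0 <= a / 2 by rewrite divr_ge0.
have := PKS (m + l) a20 (PKS (m - l) a20 ih); congr PK; apply/funext => x.
by rewrite [RHS]mulrDl -[a * ck m x * ck l x]mulrA ck_mul; ring.
Qed.

(* [prod_{k < n} (1 + cos (2 ^ k s))] is the Fejer kernel of order [2 ^ n]. *)
Lemma fejer n l K c : PK K -> (forall x, 0 <= K x) -> mean_to K c ->
  exists K' c', [/\ PK K', forall x, 0 <= K' x, mean_to K' c', c <= c' &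
    forall x, K' x <= 2 ^+ n * K x /\
      K' x * (1 - ck l x) = K x * (1 - ck (2 ^+ n * l.1, 2 ^+ n * l.2) x) / 2 ^+ n].
Proof.
move=> PKK K0 Kc; elim: n => [|n [K' [c' [PK' K'0 Kc' cc' H]]]].
  exists K, c; split=> // x; rewrite !expr0 !mul1r divr1; split=> //.
set m := (2 ^+ n * l.1, 2 ^+ n * l.2).
have [d d0 Hd] := PK_mean (PK_ck m PK').
exists (fun x => K' x + K' x * ck m x), (c' + d); split.
- by apply: PK_add => //; exact: PK_ck.
- move=> x; have /andP[h1 h2] := ck_le1 m x.
  have : 0 <= K' x * (1 + ck m x) by apply: mulr_ge0 => //; lra.
  by rewrite mulrDr mulr1.
- exact: mean_add.
- by rewrite (le_trans cc')// lerDl.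
move=> x; have [H1 H2] := H x; have /andP[h1 h2] := ck_le1 m x; split.
  have : K' x * ck m x <= K' x by rewrite ler_piMr.
  by rewrite exprS -mulrA; lra.
have -> : (2 ^+ n.+1 * l.1, 2 ^+ n.+1 * l.2) = (2 * (2 ^+ n * l.1), 2 * (2 ^+ n * l.2)).
  by rewrite exprS !mulrA.
(* The new factor telescopes: (1 - cos s) (1 + cos s) = 1 - cos^2 s = (1 - cos (2 s)) / 2. *)
rewrite ck_double -/m.
have -> : (K' x + K' x * ck m x) * (1 - ck l x) = K' x * (1 - ck l x) * (1 + ck m x) by ring.
have p0 : 2 ^+ n != 0 :> R by rewrite expf_neq0.
rewrite H2 -/m (exprS 2 n); move: (ck m x) (2 ^+ n) p0 => y p p0.
by field.
Qed.

(** One Fejer product per frequency. The new factor is at most 2^n, so it worsens the earlier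
    estimates at most by 2^n; the induction hypothesis is therefore used with [e / 2 ^+ n]. *)
Lemma kernel_exists (s : seq (R * R)) e : 0 < e -> exists K c,
  [/\ PK K, forall x, 0 <= K x, mean_to K c, 0 < c &
   forall l d, l \in s -> mean_to (fun x => K x * (1 - ck l x)) d -> d <= e * c].
Proof.
elim: s e => [|l s ih] e e0.
  have P1 : PK (fun=> 1).
    have := PKS 0 ler01 PK0; congr PK; apply/funext => x.
    by rewrite /ck /dot2 !mul0r !(addr0, subrr, cos0, mulr1).
  by exists (fun=> 1), 1; split=> //; exact: mean_cst.
(* The 2 is the maximum of [1 - ck], which [fejer] divides by 2^n. *)
have [n nP] : exists n : nat, 2 / 2 ^+ n <= e.
  exists (Num.truncn (2 / e)); rewrite ler_pdivrMr ?exprn_gt0// mulrC -ler_pdivrMr//.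
  apply: le_trans (ltW (truncnS_gt _)) _.
  by rewrite -natrX ler_nat; exact: ltn_expl.
have e'0 : 0 < e / 2 ^+ n by rewrite divr_gt0// exprn_gt0.
have [K [c [PKK K0 Kc c0 HK]]] := ih _ e'0.
have [K' [c' [PK' K'0 Kc' cc' H]]] := fejer n l PKK K0 Kc.
have n0 : 0 < 2 ^+ n :> R by rewrite exprn_gt0.
exists K', c'; split=> //; first exact: lt_le_trans cc'.
move=> m d; rewrite inE => /orP[/eqP ->|ms] Hd.
  apply: (@le_trans _ _ (2 / 2 ^+ n * c)); last by rewrite ler_pM// ltW// divr_gt0.
  apply: (mean_le Hd (mean_scale (2 / 2 ^+ n) Kc)) => x.
  have [_ ->] := H x; have /andP[h1 h2] := ck_le1 (2 ^+ n * l.1, 2 ^+ n * l.2) x.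
  rewrite -mulrA mulrC ler_wpM2r// ler_wpM2r ?invr_ge0 ?(ltW n0)//; lra.
have [q _ Hq] := PK_mean (PK_ck m PKK).
have Hm : mean_to (fun x => K x * (1 - ck m x)) (c - q).
  by apply: eq_mean (mean_sub Kc Hq) => x; rewrite mulrBr mulr1.
have h := HK m _ ms Hm.
have h2 : d <= 2 ^+ n * (c - q).
  apply: (mean_le Hd (mean_scale (2 ^+ n) Hm)) => x; rewrite mulrA.
  have [h3 _] := H x; have /andP[_ h4] := ck_le1 m x.
  by rewrite ler_wpM2r// subr_ge0.
apply: (le_trans h2); apply: (@le_trans _ _ (e * c)); last by rewrite ler_wpM2l// ltW.
have -> : e * c = 2 ^+ n * (e / 2 ^+ n * c) by field; rewrite gt_eqF.
by rewrite ler_wpM2l// ltW.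
Qed.

(** With v = (s - t) / 2, the left side is at most 2 |sin v| and 1 - cos (s - t) is 2 sin^2 v; the
    rest is 2 |sin v| <= eta + sin^2 v / eta. The modulus of continuity is thus expressed by
    [1 - ck], the quantity that the kernels control. *)
Lemma cos_lipschitz (s t eta : R) : 0 < eta ->
  `|cos s - cos t| <= eta + (1 - cos (s - t)) / (2 * eta).
Proof.
move=> eta0; pose u := (s + t) / 2; pose v := (s - t) / 2.
have -> : cos s - cos t = - (2 * (sin u * sin v)).
  have -> : s = u + v by rewrite /u /v; field.
  have -> : t = u - v by rewrite /u /v; field.
  by rewrite cosD cosB; ring.
have -> : cos (s - t) = 1 - 2 * sin v ^+ 2.
  have -> : s - t = v + v by rewrite /v; field.
  by rewrite cosD -!expr2 cos2sin2; ring.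
have -> : eta + (1 - (1 - 2 * sin v ^+ 2)) / (2 * eta) = (eta ^+ 2 + sin v ^+ 2) / eta.
  by field; rewrite gt_eqF.
rewrite normrN ler_pdivlMr// !normrM.
have : `|sin u| <= 1 by exact: sin_max.
rewrite -[sin v ^+ 2]real_normK ?num_real// ger0_norm//.
move: (normr_ge0 (sin v)) (normr_ge0 (sin u)); move: `|sin u| `|sin v| => p q q0 p0 p1.
have := sqr_ge0 (eta - q).
have : p * (q * eta) <= q * eta by rewrite ler_piMl// mulr_ge0// ltW.
by nra.
Qed.

Lemma TP_modulus f : TP f -> exists A (s : seq (R * R)), 0 <= A /\
  forall eta x, 0 < eta -> `|f x - f x0| <= A * eta + A / (2 * eta) * \sum_(l <- s) (1 - ck l x).
Proof.
elim=> [|a l c g _ [A [s [A0 H]]]].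
  by exists 0, [::]; split=> // eta x eta0; rewrite subrr normr0 big_nil !mul0r addr0.
exists (A + `|a|), (l :: s); split; first by rewrite addr_ge0.
move=> eta x eta0; rewrite big_cons.
have S0 : 0 <= \sum_(l <- s) (1 - ck l x).
  by apply: sumr_ge0 => m _; rewrite subr_ge0; case/andP: (ck_le1 m x).
have c0 : 0 <= 1 - ck l x by rewrite subr_ge0; case/andP: (ck_le1 l x).
have h1 := H eta x eta0.
have h2 := cos_lipschitz (dot2 l x + c) (dot2 l x0 + c) eta0.
have E : dot2 l x + c - (dot2 l x0 + c) = dot2 l x - dot2 l x0 by ring.
rewrite {}E -/(ck l x) in h2.
have -> : a * cos (dot2 l x + c) + g x - (a * cos (dot2 l x0 + c) + g x0) =
  a * (cos (dot2 l x + c) - cos (dot2 l x0 + c)) + (g x - g x0) by ring.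
apply: (le_trans (ler_normD _ _)); rewrite normrM.
have h3 := ler_wpM2l (normr_ge0 a) h2.
have i0 : 0 <= (2 * eta)^-1 by rewrite invr_ge0 mulr_ge0// ltW.
have k1 : 0 <= `|a| * (2 * eta)^-1 * \sum_(l <- s) (1 - ck l x) by rewrite !mulr_ge0.
have k2 : 0 <= A * (2 * eta)^-1 * (1 - ck l x) by rewrite !mulr_ge0.
by lra.
Qed.

Lemma mean_sum (s : seq (R * R)) (F : R * R -> R * R -> R) (D : R) :
  (forall l, l \in s -> exists2 d, mean_to (F l) d & d <= D) ->
  exists2 d, mean_to (fun x => \sum_(l <- s) F l x) d & d <= (size s)%:R * D.
Proof.
elim: s => [_|l s ih H].
  by exists 0; [apply: eq_mean (mean_cst 0) => x; rewrite big_nil|rewrite mul0r].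
have [d1 m1 D1] := H l (mem_head _ _).
have [|d2 m2 D2] := ih; first by move=> m ms; apply: H; rewrite inE ms orbT.
exists (d1 + d2); first by apply: eq_mean (mean_add m1 m2) => x; rewrite big_cons.
by rewrite /= -natr1 mulrDl mul1r addrC lerD.
Qed.

(* Test [f] against a nonnegative kernel that concentrates at [x0] modulo the
   finitely many frequencies of a trigonometric polynomial close to [f]. *)
Lemma uniqueness f : continuous f ->
  (forall l, mean_to (fun x => f x * ck l x) 0) ->
  (forall e, 0 < e -> exists P, TP P /\ forall x, `|f x - P x| <= e) -> f x0 = 0.
Proof.
move=> cf f0 fP; apply/eqP; rewrite -normr_le0; apply/ler_addgt0Pl => e e0; rewrite addr0.
have e40 : 0 < e / 4 by rewrite divr_gt0.
have [P [TPP HP]] := fP _ e40.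
have [A [s [A0 HA]]] := TP_modulus TPP.
(* The total [e] has four quarters: the distance from [f] to [P] at [x0] and at [x], the term
   [A * eta], and the kernel term, which [e'] below makes small. *)
pose eta := e / (4 * (A + 1)); have A1 : 0 < A + 1 by rewrite ltr_wpDl.
have eta0 : 0 < eta by rewrite divr_gt0// mulr_gt0.
have Aeta : A * eta <= e / 4.
  have -> : e / 4 = (A + 1) * eta by rewrite /eta; field; rewrite gt_eqF.
  by rewrite ler_wpM2r ?(ltW eta0)// lerDl.
pose B := A / (2 * eta); have B0 : 0 <= B by rewrite divr_ge0// mulr_ge0// ltW.
pose n : R := (size s)%:R; have n0 : 0 <= n by [].
pose e' := e / (4 * (B * n + 1)).
have Bn1 : 0 < B * n + 1 by rewrite ltr_wpDl// mulr_ge0.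
have e'0 : 0 < e' by rewrite divr_gt0// mulr_gt0.
have [K [c [PKK K0 Kc c0 HK]]] := kernel_exists s e'0.
have Hs l : l \in s -> exists2 d, mean_to (fun x => K x * (1 - ck l x)) d & d <= e' * c.
  move=> ls; have [q _ Hq] := PK_mean (PK_ck l PKK).
  have Hm : mean_to (fun x => K x * (1 - ck l x)) (c - q).
    by apply: eq_mean (mean_sub Kc Hq) => x; rewrite mulrBr mulr1.
  by exists (c - q) => //; exact: HK ls Hm.
have [d Hd dle] := mean_sum Hs.
have fK0 : mean_to (fun x => f x * K x) 0.
  elim: PKK => [|a l h a0 _ ih]; first by apply: eq_mean (mean_cst 0) => x; rewrite mulr0.
  have H := mean_add (mean_scale a (f0 l)) ih; rewrite mulr0 addr0 in H.
  by apply: eq_mean H => x; ring.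
have U := mean_add (mean_scale (3 * (e / 4)) Kc) (mean_scale B Hd).
have V := mean_sub (mean_scale (f x0) Kc) fK0; rewrite subr0 in V.
have bd x : `|f x0 * K x - f x * K x| <= 3 * (e / 4) * K x + B * \sum_(l <- s) K x * (1 - ck l x).
  rewrite -mulrBl normrM (ger0_norm (K0 x)) -mulr_sumr.
  have -> : 3 * (e / 4) * K x + B * (K x * \sum_(l <- s) (1 - ck l x)) =
    (3 * (e / 4) + B * \sum_(l <- s) (1 - ck l x)) * K x by ring.
  rewrite ler_wpM2r//.
  have h1 := HP x0; have h2 := HP x; have h3 := HA eta x eta0; rewrite -/B in h3.
  have -> : f x0 - f x = (f x0 - P x0) - (f x - P x) - (P x - P x0) by ring.
  apply: (le_trans (ler_normB _ _)); have := ler_normB (f x0 - P x0) (f x - P x); lra.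
have up : f x0 * c <= 3 * (e / 4) * c + B * d.
  by apply: (mean_le V U) => x; apply: le_trans (bd x); exact: ler_norm.
have lo : - (f x0 * c) <= 3 * (e / 4) * c + B * d.
  rewrite -mulN1r; apply: (mean_le (mean_scale (-1) V) U) => x.
  by rewrite mulN1r; apply: le_trans (bd x); rewrite -normrN; exact: ler_norm.
have Bd : B * d <= e / 4 * c.
  apply: (@le_trans _ _ (B * (n * (e' * c)))); first by rewrite ler_wpM2l.
  rewrite mulrA mulrA ler_wpM2r ?(ltW c0)//.
  have -> : e / 4 = (B * n + 1) * e' by rewrite /e'; field; rewrite gt_eqF.
  by rewrite ler_wpM2r ?(ltW e'0)// lerDl.
have nc : `|f x0| * c <= e * c.
  by rewrite -{1}(gtr0_norm c0) -normrM ler_norml; apply/andP; split; lra.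
by rewrite ler_pM2r in nc.
Qed.

End TrigPolynomials.

(** * Series dominated by a summable majorant *)

Section SummableSeries.
Context {R : realType}.
Implicit Types (w F : nat -> R) (B : R).

Definition ssum F : R := limn (fun n => \sum_(k < n) F k).

Definition bounded_sums w B := (forall k, 0 <= w k) /\ forall n, \sum_(k < n) w k <= B.

Lemma sum_split F n m : (n <= m)%N -> \sum_(k < m) F k = \sum_(k < n) F k + \sum_(n <= k < m) F k.
Proof. by move=> nm; rewrite -!(big_mkord xpredT) -big_cat_nat. Qed.

Lemma bounded_sums_tail w B e : bounded_sums w B -> 0 < e ->
  exists N, forall n m, (N <= n <= m)%N -> \sum_(n <= k < m) w k <= e.
Proof.
move=> [w0 wB] e0; pose u n := \sum_(k < n) w k.
have u_split n m : (n <= m)%N -> u m = u n + \sum_(n <= k < m) w k by exact: sum_split.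
have und : nondecreasing_seq u.
  by move=> n m nm; rewrite (u_split _ _ nm) lerDl sumr_ge0.
have ucv : cvgn u.
  by apply: nondecreasing_is_cvgn => //; exists B => _ [n _ <-]; exact: wB.
have ule := nondecreasing_cvgn_le und ucv.
have [N _ HN] := (cvgrPdist_le _ _).1 ucv _ e0.
exists N => n m /andP[Nn nm].
have := HN n Nn; rewrite ler_norml => /andP[_ h].
by have := ule m; rewrite (u_split _ _ nm); lra.
Qed.

Lemma ssum_cvg w B F : bounded_sums w B -> (forall k, `|F k| <= w k) ->
  (\sum_(k < n) F k) @[n --> \oo] --> ssum F.
Proof.
move=> bw Fw; have [w0 wB] := bw.
have E (G : nat -> R) : series G = (fun n => \sum_(k < n) G k).
  by apply/funext => n; rewrite seriesEord.
suff : cvgn (series F) by rewrite E.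
apply: normed_cvg; apply: (@series_le_cvg _ (fun k => `|F k|) w) => //; rewrite E.
 apply: nondecreasing_is_cvgn.
  by move=> n m nm; rewrite (sum_split _ nm) lerDl sumr_ge0.
by exists B => _ [n _ <-]; exact: wB.
Qed.

Lemma bounded_sums_scale (c : R) w B : 0 <= c -> bounded_sums w B ->
  bounded_sums (fun k => c * w k) (c * B).
Proof.
move=> c0 [w0 wB]; split=> [k|n]; first by rewrite mulr_ge0.
by rewrite -mulr_sumr ler_wpM2l.
Qed.

(** [N] depends on the majorant alone, which gives convergence uniform in parameters; the factor [c]
    admits bounds that grow with the parameter, such as |x|^2. *)
Lemma ssum_approx w B e : bounded_sums w B -> 0 < e ->
  exists N, forall F c, 0 <= c -> (forall k, `|F k| <= c * w k) -> forall n, (N <= n)%N ->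
    `|ssum F - \sum_(k < n) F k| <= c * e.
Proof.
move=> bw e0; have [N HN] := bounded_sums_tail bw e0; exists N => F c c0 Fw n Nn.
have cF := ssum_cvg (bounded_sums_scale c0 bw) Fw.
apply/ler_addgt0Pl => d d0.
have [M _ HM] := (cvgrPdist_le _ _).1 cF _ d0.
pose m := maxn n M; have nm : (n <= m)%N by exact: leq_maxl.
have h1 := HM m (leq_maxr _ _); rewrite (sum_split _ nm) in h1.
have h2 : `|\sum_(n <= k < m) F k| <= c * e.
  apply: (le_trans (ler_norm_sum _ _ _)).
  apply: (@le_trans _ _ (c * \sum_(n <= k < m) w k)); last by rewrite ler_wpM2l// HN// Nn.
  by rewrite mulr_sumr; exact: ler_sum.
move: h1 h2; rewrite !ler_norml => /andP[? ?] /andP[? ?]; apply/andP; split; lra.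
Qed.

Lemma ssumE F (l : R) : (\sum_(k < n) F k) @[n --> \oo] --> l -> ssum F = l.
Proof. by move=> Fl; apply: cvg_lim Fl. Qed.

Lemma ssum_lin w B F G L (c d : R) : 0 <= L -> bounded_sums w B ->
  (forall k, `|F k| <= L * w k) -> (forall k, `|G k| <= L * w k) ->
  ssum (fun k => c * F k + d * G k) = c * ssum F + d * ssum G.
Proof.
move=> L0 bw Fw Gw; have bL := bounded_sums_scale L0 bw; apply: ssumE.
have -> : (fun n => \sum_(k < n) (c * F k + d * G k)) =
    (fun n => c * (\sum_(k < n) F k) + d * (\sum_(k < n) G k)).
  by apply/funext => n; rewrite big_split /= !mulr_sumr.
apply: cvgD; (apply: cvgM; first exact: cvg_cst).
  exact: ssum_cvg bL Fw.
exact: ssum_cvg bL Gw.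
Qed.

Lemma bounded_sums_le w w' B : bounded_sums w B -> (forall k, 0 <= w' k <= w k) -> bounded_sums w' B.
Proof.
move=> [w0 wB] H; split=> [k|n]; first by case/andP: (H k).
by apply: le_trans (wB n); apply: ler_sum => k _; case/andP: (H k).
Qed.

End SummableSeries.

(** * Fourier coefficients of a real almost periodic function *)

Section FourierCoefficients.
Context {R : realType}.
Variable b : R * R -> R.
Hypothesis Wb : WAP b.
Implicit Types (x l : R * R).
Notation Re := (@complex.Re R).
Notation Im := (@complex.Im R).
Notation fc := (fourier_coef (toC b)).

Let Cb : CAP (toC b). Proof. by case: Wb. Qed.

Lemma le_Re_cabs (z : R[i]) : `|Re z| <= cabs z.
Proof.
case: z => p q /=; rewrite -sqrtr_sqr ler_wsqrtr// lerDl sqr_ge0//.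
Qed.

Lemma le_Im_cabs (z : R[i]) : `|Im z| <= cabs z.
Proof.
case: z => p q /=; rewrite -sqrtr_sqr ler_wsqrtr// lerDr sqr_ge0//.
Qed.

Lemma WAP_continuous : continuous b.
Proof.
have [c _ _] := Cb => x; apply/cvgrPdist_le => e e0.
have e0C : (0 : R[i]) < (e%:C)%C by rewrite ltcE/= eqxx.
have H : \forall y \near x, `|(toC b x : R[i]^o) - toC b y| <= (e%:C)%C.
  exact: (cvgrPdist_le _ _).1 (c x) _ e0C.
have K y : `|(toC b x : R[i]^o) - toC b y| <= (e%:C)%C -> `|b x - b y| <= e.
  rewrite -[`|_|]/((cabs (toC b x - toC b y))%:C)%C lecE/= eqxx/=.
  by apply: le_trans; rewrite oppr0 addr0 expr0n addr0 sqrtr_sqr.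
by apply: filterS H => y /K.
Qed.

Lemma WAP_bounded : exists B : R, forall x, `|b x| <= B.
Proof.
have [_ [M HM] _] := Cb; exists M => x; exact: le_trans (le_Re_cabs _) (HM x).
Qed.

Lemma TP_trig (s : seq (R[i] * (R * R))) :
  TP (fun x => Re (\sum_(p <- s) p.1 * expi (dot2 p.2 x))).
Proof.
elim: s => [|p s ih].
  by have := @TP0 R; congr TP; apply/funext => x; rewrite big_nil.
have := TPS (Re p.1) p.2 0 (TPS (Im p.1) p.2 (pi / 2) ih); congr TP; apply/funext => x.
rewrite big_cons ReD ReM addrA; congr (_ + _).
by rewrite addr0 cosDpihalf mulrN.
Qed.

Lemma WAP_TP e : 0 < e -> exists P, TP P /\ forall x, `|b x - P x| <= e.
Proof.
move=> e0; have [_ _ /(_ e e0)[s Hs]] := Cb.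
exists (fun x => Re (\sum_(p <- s) p.1 * expi (dot2 p.2 x))); split; first exact: TP_trig.
move=> x; have -> : b x - Re (\sum_(p <- s) p.1 * expi (dot2 p.2 x)) =
    Re (toC b x - \sum_(p <- s) p.1 * expi (dot2 p.2 x)) by rewrite ReD ReN.
exact: le_trans (le_Re_cabs _) (Hs x).
Qed.

Lemma WAP_mean l c : exists d, mean_to (fun x => b x * cos (dot2 l x + c)) d.
Proof.
apply: mean_ex.
  by move=> x; apply: cvgM; [exact: WAP_continuous|exact: continuous_cos_dot2].
move=> e e0; have [P [TPP HP]] := WAP_TP e0.
have [d Hd] := TP_mean (TP_mulcos l c TPP).
exists (fun x => P x * cos (dot2 l x + c)), d; split=> // x.
rewrite -mulrBl normrM; apply: le_trans (HP x).
by rewrite ler_piMr// cos_max.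
Qed.

(** [fourier_coef] is a [lim], informative only once convergence is known. The phases 0 and - pi / 2
    in [WAP_mean] give the two real means; the sign comes from the conjugate wave. *)
Lemma WAP_fourier l : mean_to (fun x => b x * cos (dot2 l x)) (Re (fc l)) /\
  mean_to (fun x => b x * sin (dot2 l x)) (- Im (fc l)).
Proof.
have [d1 H1] := WAP_mean l 0; have [d2 H2] := WAP_mean l (- (pi / 2)).
have {}H1 : mean_to (fun x => b x * cos (dot2 l x)) d1.
  by apply: eq_mean H1 => x; rewrite addr0.
have {}H2 : mean_to (fun x => b x * sin (dot2 l x)) d2.
  by apply: eq_mean H2 => x; rewrite cosBpihalf.
suff E : fc l = (d1 +i* - d2)%C by rewrite E /= opprK.
rewrite /fourier_coef; apply: (@cvg_lim R[i]^o); first exact: norm_hausdorff.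
have [[_ C1] [_ C2]] := (H1, mean_scale (-1) H2); rewrite mulN1r in C2.
apply: (cvg_complex (z := (d1 +i* - d2)%C)).
  rewrite [X in X @ _](_ : _ = MT (fun x => b x * cos (dot2 l x)))//.
  apply/funext => T; rewrite ReM ReC ImC mul0r subr0; congr (_ * _).
  by apply: eq_Rintegral => x _; rewrite ReM ReC ImC mul0r subr0 /= cosN.
rewrite [X in X @ _](_ : _ = MT (fun x => -1 * (b x * sin (dot2 l x))))//.
apply/funext => T; rewrite ImM ReC ImC mul0r addr0; congr (_ * _).
by apply: eq_Rintegral => x _; rewrite ImM ReC ImC mul0r addr0 /= sinN mulN1r mulrN.
Qed.

Lemma fourier_opp l : Re (fc (- l)) = Re (fc l) /\ Im (fc (- l)) = - Im (fc l).
Proof.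
have N x : dot2 (- l) x = - dot2 l x by rewrite /dot2 /=; ring.
have [h1 h2] := WAP_fourier l; have [h3 h4] := WAP_fourier (- l).
split; first by apply: mean_unique h3 _; apply: eq_mean h1 => x; rewrite N cosN.
have h := mean_scale (-1) h2; rewrite mulN1r in h.
apply: oppr_inj; apply: mean_unique h4 _; apply: eq_mean h => x.
by rewrite N sinN; ring.
Qed.

Lemma Im_mean_value : Im (mean_value (toC b)) = 0.
Proof.
have [_ h] := WAP_fourier 0; apply: oppr_inj; rewrite oppr0; apply: mean_unique h _.
by apply: eq_mean (mean_cst 0) => x; rewrite /dot2 !mul0r addr0 sin0 mulr0.
Qed.

End FourierCoefficients.

(** * Enumerating the frequencies *)

Section Enumeration.
Context {R : realType} {T : choiceType}.
Implicit Types (D : set T) (a : T -> R) (e : nat -> option T).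

Definition finite_sums D a M := forall s : seq T, uniq s ->
  (forall l, l \in s -> D l) -> \sum_(l <- s) a l <= M.

Lemma esum_finite_sums D a : (forall l, 0 <= a l) ->
  (\esum_(l in D) (a l)%:E < +oo)%E -> exists M, finite_sums D a M.
Proof.
move=> a0 aoo; have aE : (\esum_(l in D) (a l)%:E)%E \is a fin_num.
  by rewrite ge0_fin_numE//; apply: esum_ge0 => l _; rewrite lee_fin.
exists (fine (\esum_(l in D) (a l)%:E)%E) => s us sD.
rewrite -lee_fin fineK// -sumEFin; apply: esum_ge; exists [set` s]; last by rewrite fsbig_seq.
by split; [exact: finite_seq|exact: sD].
Qed.

(** At most M (n + 1) elements have weight at least 1/(n + 1), and every element has such a weight
    for some n. *)
Lemma finite_sums_countable D a M : (forall l, D l -> 0 < a l) -> finite_sums D a M ->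
  countable D.
Proof.
move=> a0 aM.
have DE : D `<=` \bigcup_n [set l | D l /\ n.+1%:R^-1 <= a l].
  move=> l Dl; have := a0 _ Dl => al0.
  exists (Num.truncn (a l)^-1) => //; split=> //.
  rewrite -[leRHS]invrK lef_pV2 ?posrE ?invr_gt0//.
  by apply: ltW; apply: truncnS_gt.
apply: sub_countable (subset_card_le DE) _.
apply: bigcup_countable => // n _; apply: finite_set_countable.
apply: contrapT => /(infinite_set_fset (Num.truncn (M * n.+1%:R)).+1)[B BD cB].
have := aM (finmap.enum_fset B) (finmap.fset_uniq B) (fun l lB => (BD _ lB).1).
apply/negP; rewrite -ltNge.
have h : (size (finmap.enum_fset B))%:R * n.+1%:R^-1 <= \sum_(l <- finmap.enum_fset B) a l.
  rewrite -sum1_size natr_sum mulr_suml big_seq_cond [leRHS]big_seq_cond.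
  by apply: ler_sum => l /andP[lB _]; rewrite mul1r; exact: (BD _ lB).2.
apply: lt_le_trans h; rewrite ltr_pdivlMr//.
by apply: lt_le_trans (truncnS_gt _) _; rewrite ler_nat.
Qed.

(** An index may carry no element, so finite, empty and infinite [D] are treated alike; an element
    sits at its code under an injection into the naturals. *)
Lemma countable_enum D : countable D -> exists e,
  [/\ forall k l, e k = Some l -> D l, forall l, D l -> exists k, e k = Some l &
      forall k k' l, e k = Some l -> e k' = Some l -> k = k'].
Proof.
move=> /countable_injP[f finj].
have E k : exists o : option T, (forall l, o = Some l -> D l /\ f l = k) /\
    (o = None -> forall l, D l -> f l <> k).
  have [[l [Dl fl]]|H] := pselect (exists l, D l /\ f l = k).
    by exists (Some l); split=> // m [<-].
  by exists None; split=> // _ l Dl fl; apply: H; exists l.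
have [e He] := choice E; exists e; split.
- by move=> k l /(He k).1[].
- move=> l Dl; exists (f l); case El : (e (f l)) => [m|]; last by have := (He _).2 El _ Dl.
  by have [Dm fm] := (He _).1 _ El; congr Some; apply: finj; rewrite ?in_setE.
- by move=> k k' l /(He k).1[_ <-] /(He k').1[_ <-].
Qed.

Lemma enum_bounded_sums D a M e : (forall l, 0 <= a l) -> finite_sums D a M ->
  (forall k l, e k = Some l -> D l) ->
  (forall k k' l, e k = Some l -> e k' = Some l -> k = k') ->
  bounded_sums (fun k => oapp a 0 (e k)) M.
Proof.
move=> a0 aM eD einj; split=> [k|n]; first by case: (e k) => /=.
have -> : \sum_(k < n) oapp a 0 (e k) = \sum_(l <- pmap e (iota 0 n)) a l.
  rewrite -(big_mkord xpredT (fun k => oapp a 0 (e k))) /index_iota subn0.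
  elim: (iota 0 n) => [|k s ih]; first by rewrite !big_nil.
  by rewrite big_cons ih /=; case: (e k) => [l|] /=; rewrite ?big_cons// add0r.
apply: aM; last by move=> l; rewrite mem_pmap => /mapP[k _ /esym/eD].
elim: (iota 0 n) (iota_uniq 0 n) => //= k s ih /andP[ks us].
case El : (e k) => [l|] /=; last exact: ih.
rewrite ih// andbT mem_pmap; apply/mapP => -[k' k's Ek'].
by move: ks; rewrite (einj _ _ _ El (esym Ek')) k's.
Qed.

End Enumeration.

(** * Expansion of b into an absolutely convergent series of waves *)

Section Expansion.
Context {R : realType}.
Implicit Types (x l m : R * R).

(** The real part of (p + i q) e^(i l.x). *)
Definition trig (p q : R) l x := p * cos (dot2 l x) - q * sin (dot2 l x).

Lemma trig_le p q l x : `|trig p q l x| <= `|p| + `|q|.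
Proof.
rewrite /trig; apply: le_trans (ler_normB _ _) _; rewrite !normrM.
by apply: lerD; rewrite ler_piMr// ?cos_max ?sin_max.
Qed.

(** A cosine of frequency [l] contains the waves l and -l with weight one half each, so a wave of
    frequency [m] is seen with this weight. *)
Definition hit l m : R := ((m == l)%:R + (m == - l)%:R) / 2.

Lemma mean_cos_ck x0 m (c : R) l :
  mean_to (fun x => cos (dot2 m x + c) * ck x0 l x) (cos (dot2 m x0 + c) * hit l m).
Proof.
have H := mean_scale 2^-1 (mean_add (mean_cos (m + l) (c - dot2 l x0)) (mean_cos (m - l) (c + dot2 l x0))).
have E : 2^-1 * ((if m + l == 0 then cos (c - dot2 l x0) else 0) +
    (if m - l == 0 then cos (c + dot2 l x0) else 0)) = cos (dot2 m x0 + c) * hit l m.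
  rewrite /hit subr_eq0 addr_eq0; have [<-|_] := eqVneq m l; have [ml|_] := eqVneq m (- _);
    rewrite ?mulr1n ?mulr0n ?addr0 ?add0r ?mulr0 ?mul0r ?mulr0//.
  - rewrite {1}ml; have -> : c - dot2 (- m) x0 = dot2 m x0 + c by rewrite /dot2 /=; ring.
    by rewrite (addrC c); field.
  - by rewrite (addrC c); field.
  - have -> : c - dot2 l x0 = dot2 m x0 + c by rewrite ml /dot2 /=; ring.
    by field.
rewrite E in H; apply: eq_mean H => x; rewrite /ck cos_mul_cos; congr (_ * (cos _ + cos _)).
- by rewrite dot2D; ring.
- by rewrite dot2B; ring.
Qed.

Lemma mean_trig_ck x0 p q m l :
  mean_to (fun x => trig p q m x * ck x0 l x) (trig p q m x0 * hit l m).
Proof.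
have H := mean_sub (mean_scale p (mean_cos_ck x0 m 0 l)) (mean_scale q (mean_cos_ck x0 m (- (pi / 2)) l)).
have E x : cos (dot2 m x + - (pi / 2)) = sin (dot2 m x) by exact: cosBpihalf.
rewrite E addr0 in H.
have -> : trig p q m x0 * hit l m = p * (cos (dot2 m x0) * hit l m) - q * (sin (dot2 m x0) * hit l m).
  by rewrite /trig; ring.
by apply: eq_mean H => x; rewrite E addr0 /trig; ring.
Qed.

Lemma TP_trigE p q m : TP (trig p q m).
Proof.
have := TP_add (TP_cos p m 0) (TP_cos (- q) m (- (pi / 2))); congr TP; apply/funext => x.
by rewrite addr0 cosBpihalf /trig mulNr.
Qed.

Lemma TP_sum (F : nat -> R * R -> R) n : (forall k, TP (F k)) -> TP (fun x => \sum_(k < n) F k x).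
Proof.
move=> HF; elim: n => [|n ih].
  by have := @TP0 R; congr TP; apply/funext => x; rewrite big_ord0.
by have := TP_add ih (HF n); congr TP; apply/funext => x; rewrite big_ord_recr.
Qed.

Lemma mean_ord_sum (F : nat -> R * R -> R) (c : nat -> R) n : (forall k, mean_to (F k) (c k)) ->
  mean_to (fun x => \sum_(k < n) F k x) (\sum_(k < n) c k).
Proof.
move=> HF; elim: n => [|n ih].
  by rewrite big_ord0; apply: eq_mean (mean_cst 0) => x; rewrite big_ord0.
by rewrite big_ord_recr; apply: eq_mean (mean_add ih (HF n)) => x; rewrite big_ord_recr.
Qed.

Lemma ssum_continuous w B (F : nat -> R * R -> R) : bounded_sums w B ->
  (forall k, continuous (F k)) -> (forall x k, `|F k x| <= w k) ->
  continuous (fun x => ssum (F^~ x)).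
Proof.
move=> bw cF Fw; apply: unif_approx_continuous => d d0; have [N HN] := ssum_approx bw d0.
exists (fun x => \sum_(k < N) F k x); split.
  elim: N {HN} => [|N ih] x.
    by under eq_fun do rewrite big_ord0; exact: cvg_cst.
  by under eq_fun do rewrite big_ord_recr /=; apply: cvgD; [exact: ih|exact: cF].
by move=> x; rewrite -[d]mul1r; apply: HN => // k; rewrite mul1r.
Qed.

(** The difference between b and its series has zero mean against every [ck x0 l], so [uniqueness]
    makes it vanish at [x0], which is arbitrary. *)
Lemma WAP_expansion (b : R * R -> R) : WAP b -> exists p q (lam : nat -> R * R) B,
  [/\ forall k, lam k != 0, bounded_sums (fun k => `|p k| + `|q k|) B &
   forall x, b x = complex.Re (mean_value (toC b)) + ssum (fun k => trig (p k) (q k) (lam k) x)].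
Proof.
move=> Wb; set b0 := complex.Re _; pose fc := fourier_coef (toC b).
pose D := [set l | fc l != 0 /\ l != 0].
have cabs0 l : 0 <= cabs (fc l) by case: (fc l) => ? ?; exact: sqrtr_ge0.
have [M HM] := esum_finite_sums cabs0 Wb.2.
have {}HM : finite_sums D (fun l => cabs (fc l)) M.
  by move=> s us sD; apply: HM => // l /sD[].
have cD : countable D.
  apply: finite_sums_countable HM => l [l0 _]; rewrite lt_neqAle cabs0 andbT eq_sym.
  by apply: contra l0 => /eqP/ComplexField.Normc.eq0_normc ->.
have [e [eD De einj]] := countable_enum cD.
pose p k := oapp (fun l => complex.Re (fc l)) 0 (e k).
pose q k := oapp (fun l => complex.Im (fc l)) 0 (e k).
(* At an empty index [p k] and [q k] are 0; the default frequency (1, 0) only keeps [lam k] nonzero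
   there. *)
pose lam k := odflt (1, 0) (e k).
have lam0 k : lam k != 0.
  rewrite /lam; case E : (e k) => [l|] /=; first by have [] := eD _ _ E.
  by apply/eqP => -[/eqP]; rewrite oner_eq0.
have bs : bounded_sums (fun k => `|p k| + `|q k|) (2 * M).
  apply: bounded_sums_le (bounded_sums_scale _ (enum_bounded_sums cabs0 HM eD einj)) _ => // k.
  rewrite addr_ge0//= /p /q; case: (e k) => [l|] /=; last by rewrite normr0; lra.
  by have := le_Re_cabs (fc l); have := le_Im_cabs (fc l); lra.
exists p, q, lam, (2 * M); split=> // x0.
pose F k x := trig (p k) (q k) (lam k) x.
pose r l := trig (complex.Re (fc l)) (complex.Im (fc l)) l x0.
have FE x k : `|F k x| <= `|p k| + `|q k| by exact: trig_le.
pose g x := b x - (b0 + ssum (F^~ x)).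
suff : g x0 = 0 by move/eqP; rewrite subr_eq0 => /eqP.
have SN d : 0 < d -> exists N, forall n, (N <= n)%N -> forall x, `|ssum (F^~ x) - \sum_(k < n) F k x| <= d.
  move=> d0; have [N HN] := ssum_approx bs d0; exists N => n Nn x; rewrite -[d]mul1r.
  by apply: HN => // k; rewrite mul1r.
have cS : continuous (fun x => ssum (F^~ x)).
  by apply: ssum_continuous bs _ FE => k; apply: TP_continuous; exact: TP_trigE.
(* The enumeration meets [mu] at most once, so these sums are eventually constant. *)
have hits mu : exists N, forall n, (N <= n)%N ->
    \sum_(k < n) F k x0 * (lam k == mu)%:R = r mu * (mu != 0)%:R.
  have [Dmu|Dmu] := pselect (D mu).
    have [k0 Ek0] := De _ Dmu; exists k0.+1 => n k0n.
    rewrite (bigD1 (Ordinal k0n))//= big1 ?addr0 => [|k kk0].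
      by rewrite /F /lam /p /q Ek0 /= eqxx Dmu.2.
    have [lk|] := eqVneq (lam k) mu; last by rewrite mulr0.
    move: lk; rewrite /F /p /q; case Ek : (e k) => [l|] /=; last by rewrite /trig !mul0r subrr mul0r.
    rewrite /lam Ek /= => lmu; rewrite lmu in Ek.
    by case/eqP: kk0; apply: val_inj => /=; exact: einj Ek Ek0.
  exists 0%N => n _; rewrite big1 => [|k _].
    have [->|mu0] := eqVneq mu 0; first by rewrite mulr0.
    have -> : r mu = 0; last by rewrite mul0r.
    have fc0 : fc mu = 0 by apply/eqP; apply: contra_notT Dmu => fcmu; split.
    by rewrite /r fc0 /trig !mul0r subrr.
  have [lk|] := eqVneq (lam k) mu; last by rewrite mulr0.
  move: lk; rewrite /F /p /q /lam; case Ek : (e k) => [l|] /=; last by rewrite /trig !mul0r subrr mul0r.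
  by move=> lmu; case: Dmu; rewrite -lmu; exact: eD Ek.
have rN l : r (- l) = r l.
  have [rl il] := fourier_opp Wb l; rewrite /r rl il /trig.
  have -> : dot2 (- l) x0 = - dot2 l x0 by rewrite /dot2 /=; ring.
  by rewrite cosN sinN; ring.
have mS l : mean_to (fun x => ssum (F^~ x) * ck x0 l x) (r l * (l != 0)%:R).
  (* Both l and -l contribute one half; by [rN], which rests on b being real, the halves agree and
     add up to [r l]. *)
  have [N1 H1] := hits l; have [N2 H2] := hits (- l).
  apply: mean_approx.
    by move=> x; apply: cvgM; [exact: cS|exact: (mean_ck x0 l).1].
  move=> d /SN[N HN]; pose n := maxn N (maxn N1 N2).
  exists (fun x => \sum_(k < n) (F k x * ck x0 l x)); split.
    have := mean_ord_sum n (fun k => mean_trig_ck x0 (p k) (q k) (lam k) l).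
    congr mean_to; rewrite /hit -/(F _ _).
    under eq_bigr do rewrite mulrA mulrDr.
    rewrite -mulr_suml big_split /= (H1 n) ?(H2 n) /n ?leq_max ?leqnn ?orbT//.
    by rewrite rN oppr_eq0; field.
  move=> x; rewrite -mulr_suml -mulrBl normrM; apply: le_trans (HN n _ x); last exact: leq_maxl.
  by rewrite ler_piMr// cos_max.
apply: (@uniqueness R x0).
- move=> x; apply: cvgB; first exact: WAP_continuous.
  by apply: cvgD; [exact: cvg_cst|exact: cS].
- move=> l; have [h1 h2] := WAP_fourier Wb l.
  have hb := mean_add (mean_scale (cos (dot2 l x0)) h1) (mean_scale (sin (dot2 l x0)) h2).
  have H := mean_sub hb (mean_add (mean_scale b0 (mean_ck x0 l)) (mS l)).
  rewrite (_ : _ - _ = 0) in H.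
    by apply: eq_mean H => x; rewrite /g /ck cosB; ring.
  rewrite -/fc /r; have [->|l0] := eqVneq l 0.
    have -> : dot2 0 x0 = 0 by rewrite /dot2 /=; ring.
    rewrite cos0 sin0 /b0 /mean_value -/fc -[(~~ true)%:R]/(0 : R); ring.
  by rewrite -[(~~ false)%:R]/(1 : R) /trig; ring.
- move=> d d0; have d20 : 0 < d / 2 by rewrite divr_gt0.
  have [P [TPP HP]] := WAP_TP Wb d20; have [N HN] := SN _ d20.
  exists (fun x => P x + (- b0 * cos (dot2 0 x + 0) + -1 * \sum_(k < N) F k x)); split.
    apply: TP_add => //; apply: TP_add; first exact: TP_cos.
    by apply: TP_scale; apply: TP_sum => k; exact: TP_trigE.
  move=> x; have -> : dot2 0 x + 0 = 0 by rewrite /dot2 /=; ring.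
  rewrite cos0 /g; have := HP x; have := HN N (leqnn _) x.
  by rewrite !ler_norml => /andP[? ?] /andP[? ?]; apply/andP; split; lra.
Qed.

End Expansion.

(** * Termwise differentiation *)

Section TermwiseDerivative.
Context {R : realType}.
Variables (w : nat -> R) (B : R).
Hypothesis bw : bounded_sums w B.
Implicit Types (g dg : nat -> R -> R) (G : nat -> R * R -> R) (x : R * R).

Lemma is_derive_psum g (g' : nat -> R -> R) (t : R) n : (forall k, is_derive t 1 (g k) (g' k t)) ->
  is_derive t 1 (fun s => \sum_(k < n) g k s) (\sum_(k < n) g' k t).
Proof.
move=> H; elim: n => [|n ih].
  by rewrite big_ord0; under eq_fun do rewrite big_ord0; exact: is_derive_cst.
rewrite big_ord_recr /=; under eq_fun do rewrite big_ord_recr /=.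
exact: is_derive_add ih (H n).
Qed.

Lemma is_derive_ssum g (g' : nat -> R -> R) (t : R) : (forall k (s : R), is_derive s 1 (g k) (g' k s)) ->
  (forall s, exists2 L, 0 <= L & forall k, `|g k s| <= L * w k) ->
  (forall M, exists2 L, 0 <= L & forall k s, `|s| <= M -> `|g' k s| <= L * w k) ->
  is_derive t 1 (fun s => ssum (g^~ s)) (ssum (g'^~ t)).
Proof.
move=> dg bg bg'; have [L L0 HL] := bg' (`|t| + 1).
pose Q (h : R) k := h^-1 * (g k (h * 1 + t) - g k t).
have QE (h : R) : h^-1 * (ssum (g^~ (h * 1 + t)) - ssum (g^~ t)) = ssum (Q h).
  have [L1 L10 H1] := bg (h * 1 + t); have [L2 L20 H2] := bg t.
  have w0 := bw.1; rewrite /Q.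
  have := @ssum_lin _ _ _ (g^~ (h * 1 + t)) (g^~ t) (L1 + L2) h^-1 (- h^-1) (addr_ge0 L10 L20) bw.
  rewrite mulrBr -mulNr => <-.
  - by congr ssum; apply/funext => k; rewrite mulrBr mulNr.
  - by move=> k; apply: le_trans (H1 k) _; rewrite ler_wpM2r// lerDl.
  - by move=> k; apply: le_trans (H2 k) _; rewrite ler_wpM2r// lerDr.
have Qle (h : R) : `|h| <= 1 -> forall k, `|Q h k| <= L * w k.
  move=> h1 k; rewrite /Q normrM.
  have [->|h0] := eqVneq h 0; first by rewrite invr0 normr0 mul0r mulr_ge0// bw.1.
  have := @MVT_lipschitz R (g k) (g' k) (`|t| + 1) (L * w k) t (h * 1 + t) (dg k) (HL k).
  rewrite mulr1 addrK normfV ler_pdivrMl ?normr_gt0// mulrC.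
  rewrite lerDl ler01 => -> //; by rewrite (le_trans (ler_normD _ _))// addrC lerD2l.
have C : (fun h : R => h^-1 *: (((fun s => ssum (g^~ s)) \o shift t) (h *: 1) - ssum (g^~ t)))
    @ 0^' --> ssum (g'^~ t).
  apply/cvgrPdist_le => e e0; have e30 : 0 < e / 3 by rewrite divr_gt0.
  have [N HN] := ssum_approx (bounded_sums_scale L0 bw) e30.
  have D := is_derive_psum N (fun k => dg k t).
  have CN : (fun h : R => h^-1 *: (((fun s => \sum_(k < N) g k s) \o shift t) (h *: 1) - \sum_(k < N) g k t))
      @ 0^' --> \sum_(k < N) g' k t.
    by case: D => dv <-; exact: dv.
  have h1 : `|ssum (g'^~ t) - \sum_(k < N) g' k t| <= e / 3.
    rewrite -[e / 3]mul1r; apply: HN => // k; rewrite mul1r; apply: HL.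
    by rewrite lerDl ler01.
  near=> h.
  have h2 : `|\sum_(k < N) g' k t -
      h^-1 *: (((fun s => \sum_(k < N) g k s) \o shift t) (h *: 1) - \sum_(k < N) g k t)| <= e / 3.
    by near: h; exact: (cvgrPdist_le _ _).1 CN _ e30.
  have hle : `|h| <= 1.
    near: h; apply: nbhs_dnbhs; exists 1 => //= z; rewrite /ball_ /= sub0r normrN => /ltW.
    exact.
  have h3 : `|ssum (Q h) - \sum_(k < N) Q h k| <= e / 3.
    by rewrite -[e / 3]mul1r; apply: HN => // k; rewrite mul1r; exact: Qle.
  rewrite /= -[X in _ - X]/(h^-1 * (ssum (g^~ (h * 1 + t)) - ssum (g^~ t))) QE.
  have EN : h^-1 *: (((fun s => \sum_(k < N) g k s) \o shift t) (h *: 1) - \sum_(k < N) g k t) =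
      \sum_(k < N) Q h k.
    rewrite -[LHS]/(h^-1 * (\sum_(k < N) g k (h * 1 + t) - \sum_(k < N) g k t)).
    by rewrite -sumrB mulr_sumr.
  rewrite EN in h2.
  move: h1 h2 h3; rewrite !ler_norml => /andP[? ?] /andP[? ?] /andP[? ?]; apply/andP; split; lra.
apply: DeriveDef; first by apply/cvg_ex; exists (ssum (g'^~ t)).
exact: cvg_lim C.
Unshelve. all: by end_near. Qed.

Definition sbound G := forall M : R, exists2 L : R, 0 <= L &
  forall k x, `|x.1| <= M -> `|x.2| <= M -> `|G k x| <= L * w k.

Lemma is_derive_ssum_e1 G G1 x : (forall k x, is_derive x e1 (G k) (G1 k x)) ->
  sbound G -> sbound G1 -> is_derive x e1 (fun x => ssum (G^~ x)) (ssum (G1^~ x)).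
Proof.
case: x => x y dG bG bG1; apply/is_derive_e1P.
apply: (@is_derive_ssum (fun k s => G k (s, y)) (fun k s => G1 k (s, y)) x).
- by move=> k s; apply/is_derive_e1P.
- move=> s; have [L L0 HL] := bG (Num.max `|s| `|y|); exists L => // k.
  by apply: HL; rewrite le_max lexx ?orbT.
- move=> M; have [L L0 HL] := bG1 (Num.max M `|y|); exists L => // k s sM.
  by apply: HL; rewrite le_max ?sM ?lexx ?orbT.
Qed.

Lemma is_derive_ssum_e2 G G2 x : (forall k x, is_derive x e2 (G k) (G2 k x)) ->
  sbound G -> sbound G2 -> is_derive x e2 (fun x => ssum (G^~ x)) (ssum (G2^~ x)).
Proof.
case: x => x y dG bG bG2; apply/is_derive_e2P.
apply: (@is_derive_ssum (fun k s => G k (x, s)) (fun k s => G2 k (x, s)) y).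
- by move=> k s; apply/is_derive_e2P.
- move=> s; have [L L0 HL] := bG (Num.max `|s| `|x|); exists L => // k.
  by apply: HL; rewrite le_max lexx ?orbT.
- move=> M; have [L L0 HL] := bG2 (Num.max M `|x|); exists L => // k s sM.
  by apply: HL; rewrite le_max ?sM ?lexx ?orbT.
Qed.

End TermwiseDerivative.

(** * Solving the Poisson equation with subquadratic error *)

Section ScalarPotential.
Context {R : realType}.
Implicit Types (x l : R * R) (p q s t : R).

(** The second primitive of p cos s - q sin s that vanishes to second order at 0. Hence |psi| is at
    most (|p| + |q|) s^2, and at s = l.x the division by |l|^2 is harmless however small l is. *)
Definition psi p q s := p * (1 - cos s) - q * (s - sin s).
Definition dpsi p q s := p * sin s - q * (1 - cos s).

Lemma is_derive_psi p q s : is_derive s 1 (psi p q) (dpsi p q s).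
Proof.
have dc := is_derive_cos s; have ds := is_derive_sin s.
have D := is_derive_sub (is_derive_cmul p (is_derive_sub (is_derive_cst (1 : R) s 1) dc))
  (is_derive_cmul q (is_derive_sub (is_derive_id s 1) ds)).
by apply: is_derive_eq D _; rewrite /dpsi; ring.
Qed.

Lemma is_derive_dpsi p q s : is_derive s 1 (dpsi p q) (p * cos s - q * sin s).
Proof.
have dc := is_derive_cos s; have ds := is_derive_sin s.
have D := is_derive_sub (is_derive_cmul p ds)
  (is_derive_cmul q (is_derive_sub (is_derive_cst (1 : R) s 1) dc)).
by apply: is_derive_eq D _; ring.
Qed.

Lemma norm_sin_le s : `|sin s| <= `|s|.
Proof.
have := @MVT_lipschitz R sin cos `|s| 1 0 s (@is_derive_sin R) (fun t _ => cos_max t).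
by rewrite normr0 normr_ge0 lexx sin0 !subr0 mul1r => ->.
Qed.

Lemma norm_1subcos_le s : `|1 - cos s| <= `|s|.
Proof.
have H t : `|t| <= `|s| -> `|- sin t| <= 1 by rewrite normrN sin_max.
have := @MVT_lipschitz R cos (fun t => - sin t) `|s| 1 0 s (@is_derive_cos R) H.
by rewrite normr0 normr_ge0 lexx cos0 distrC subr0 mul1r => ->.
Qed.

Lemma dpsi_le p q s : `|dpsi p q s| <= (`|p| + `|q|) * `|s|.
Proof.
rewrite /dpsi; apply: le_trans (ler_normB _ _) _; rewrite !normrM mulrDl.
by apply: lerD; rewrite ler_wpM2l// ?norm_sin_le ?norm_1subcos_le.
Qed.

Lemma psi_le p q s : `|psi p q s| <= (`|p| + `|q|) * s ^+ 2.
Proof.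
have H t : `|t| <= `|s| -> `|dpsi p q t| <= (`|p| + `|q|) * `|s|.
  by move=> ts; apply: le_trans (dpsi_le _ _ _) _; rewrite ler_wpM2l ?addr_ge0.
have := @MVT_lipschitz R (psi p q) (dpsi p q) `|s| _ 0 s (is_derive_psi p q) H.
rewrite normr0 normr_ge0 lexx subr0 -mulrA -expr2 real_normK ?num_real//.
by rewrite {2}/psi cos0 sin0 !subrr !mulr0 !subr0 => ->.
Qed.

(** The linear bound for large [s]: it makes each single term negligible against |x|^2, which
    [psi_le] does not give. *)
Lemma psi_le1 p q s : `|psi p q s| <= (`|p| + `|q|) * (2 + `|s|).
Proof.
rewrite /psi; apply: le_trans (ler_normB _ _) _; rewrite !normrM mulrDl.
have := cos_max s; have := sin_max s; rewrite !ler_norml => /andP[? ?] /andP[? ?].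
have := ler_norm s; have := ler_norm (- s); rewrite normrN => ? ?.
by apply: lerD; rewrite ler_wpM2l// ler_norml; apply/andP; split; lra.
Qed.

Lemma is_derive_dot2_e1 l x : is_derive x e1 (dot2 l) l.1.
Proof.
have := is_derive_add (is_derive_cmul l.1 (is_derive_fst x e1)) (is_derive_cmul l.2 (is_derive_snd x e1)).
by rewrite /e1 /= mulr1 mulr0 addr0.
Qed.

Lemma is_derive_dot2_e2 l x : is_derive x e2 (dot2 l) l.2.
Proof.
have := is_derive_add (is_derive_cmul l.1 (is_derive_fst x e2)) (is_derive_cmul l.2 (is_derive_snd x e2)).
by rewrite /e2 /= mulr1 mulr0 add0r.
Qed.

Definition sqn x := x.1 ^+ 2 + x.2 ^+ 2.

Lemma sqn_ge0 x : 0 <= sqn x.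
Proof. by rewrite addr_ge0// sqr_ge0. Qed.

Lemma sqn_gt0 l : l != 0 -> 0 < sqn l.
Proof.
move=> l0; rewrite lt_neqAle sqn_ge0 andbT eq_sym; apply: contra l0.
rewrite /sqn paddr_eq0 ?sqr_ge0// !sqrf_eq0 => /andP[/eqP h1 /eqP h2].
by apply/eqP; case: l h1 h2 => ? ? /= -> ->.
Qed.

(** Lagrange's identity: the difference is the squared determinant of [l] and [x]. *)
Lemma dot2_sqr_le l x : dot2 l x ^+ 2 <= sqn l * sqn x.
Proof.
rewrite -subr_ge0 /dot2 /sqn.
rewrite (_ : _ - _ = (l.1 * x.2 - l.2 * x.1) ^+ 2) ?sqr_ge0//; ring.
Qed.

Lemma coord_mul_le (c d : R) l : (c = l.1 \/ c = l.2) -> (d = l.1 \/ d = l.2) ->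
  `|c * d| <= sqn l.
Proof.
have := sqr_ge0 (l.1 - l.2); have := sqr_ge0 (l.1 + l.2).
have := sqr_ge0 l.1; have := sqr_ge0 l.2; rewrite /sqn => ? ? ? ?.
by move=> [->|->] [->|->]; rewrite ler_norml; apply/andP; split; nra.
Qed.

Lemma coord_dot2_le (c : R) l x : (c = l.1 \/ c = l.2) ->
  `|c * dot2 l x| <= sqn l * (`|x.1| + `|x.2|).
Proof.
move=> cl; rewrite /dot2 mulrDr; apply: le_trans (ler_normD _ _) _.
rewrite !mulrA !(normrM (_ * _)) mulrDr.
by apply: lerD; rewrite ler_wpM2r// coord_mul_le//; [left|right].
Qed.

Lemma sqn_divr (c d : R) l : l != 0 -> 0 <= d -> `|c| <= d * sqn l -> `|c / sqn l| <= d.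
Proof.
move=> l0 d0 h; have n0 := sqn_gt0 l0.
by rewrite normrM normfV (gtr0_norm n0) ler_pdivrMr.
Qed.

Variables (p q : nat -> R) (lam : nat -> R * R) (B : R).
Let w k := `|p k| + `|q k|.
Hypothesis bw : bounded_sums w B.
Hypothesis lam0 : forall k, lam k != 0.

(** The k-th term of the potential; [D c] and [H c d] are its first and second derivatives, [c] and
    [d] selecting a coordinate of the frequency. *)
Let G k x := psi (p k) (q k) (dot2 (lam k) x) / sqn (lam k).
Let D (c : nat -> R) k x := c k * dpsi (p k) (q k) (dot2 (lam k) x) / sqn (lam k).
Let H (c d : nat -> R) k x := c k * d k * trig (p k) (q k) (lam k) x / sqn (lam k).
Let coord (c : nat -> R) := (forall k, c k = (lam k).1) \/ (forall k, c k = (lam k).2).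
Let c1 k := (lam k).1.
Let c2 k := (lam k).2.

Let coordP c k : coord c -> c k = (lam k).1 \/ c k = (lam k).2.
Proof. by case=> h; [left|right]. Qed.

Let w0 k : 0 <= w k. Proof. by rewrite addr_ge0. Qed.

Lemma G_le k x : `|G k x| <= w k * sqn x.
Proof.
apply: sqn_divr; rewrite ?mulr_ge0 ?sqn_ge0//; apply: le_trans (psi_le _ _ _) _.
by rewrite -mulrA ler_wpM2l// [leRHS]mulrC dot2_sqr_le.
Qed.

Lemma D_le c k x : coord c -> `|D c k x| <= w k * (`|x.1| + `|x.2|).
Proof.
move=> cc; apply: sqn_divr; rewrite ?mulr_ge0 ?addr_ge0//.
rewrite normrM; apply: le_trans (ler_wpM2l (normr_ge0 _) (dpsi_le _ _ _)) _.
rewrite mulrCA -normrM -mulrA ler_wpM2l// [leRHS]mulrC; apply: coord_dot2_le; exact: coordP.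
Qed.

Lemma H_le c d k x : coord c -> coord d -> `|H c d k x| <= w k.
Proof.
move=> cc cd; apply: sqn_divr => //.
rewrite normrM mulrC; apply: ler_pM => //; first exact: trig_le.
by apply: coord_mul_le; exact: coordP.
Qed.

Lemma sbound_G : sbound w G.
Proof.
move=> M; exists (M ^+ 2 + M ^+ 2); first by rewrite addr_ge0 ?sqr_ge0.
move=> k x h1 h2; apply: le_trans (G_le _ _) _; rewrite mulrC ler_wpM2r//.
have M0 : 0 <= M by exact: le_trans h1.
by rewrite /sqn -(real_normK (num_real x.1)) -(real_normK (num_real x.2)) lerD// lerXn2r.
Qed.

Lemma sbound_D c : coord c -> sbound w (D c).
Proof.
move=> cc M; exists (`|M| + `|M|); first by rewrite addr_ge0.
move=> k x h1 h2; apply: le_trans (D_le _ _ cc) _; rewrite mulrC ler_wpM2r//.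
by apply: lerD; apply: le_trans (ler_norm _).
Qed.

Lemma sbound_H c d : coord c -> coord d -> sbound w (H c d).
Proof.
by move=> cc cd M; exists 1 => // k x _ _; rewrite mul1r; exact: H_le.
Qed.

Let coord1 : coord c1. Proof. by left. Qed.
Let coord2 : coord c2. Proof. by right. Qed.

Lemma G_e1 k x : is_derive x e1 (G k) (D c1 k x).
Proof.
have d := is_derive_chain (is_derive_dot2_e1 (lam k) x) (is_derive_psi (p k) (q k) _).
have := is_derive_cmul (sqn (lam k))^-1 d.
under eq_fun do rewrite mulrC.
by move=> /is_derive_eq; apply; rewrite /D /c1; ring.
Qed.

Lemma G_e2 k x : is_derive x e2 (G k) (D c2 k x).
Proof.
have d := is_derive_chain (is_derive_dot2_e2 (lam k) x) (is_derive_psi (p k) (q k) _).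
have := is_derive_cmul (sqn (lam k))^-1 d.
under eq_fun do rewrite mulrC.
by move=> /is_derive_eq; apply; rewrite /D /c2; ring.
Qed.

Lemma D_e1 c k x : is_derive x e1 (D c k) (H c c1 k x).
Proof.
have d := is_derive_chain (is_derive_dot2_e1 (lam k) x) (is_derive_dpsi (p k) (q k) _).
have := is_derive_cmul (c k / sqn (lam k)) d.
under eq_fun do rewrite mulrAC.
by move=> /is_derive_eq; apply; rewrite /H /c1 /trig; ring.
Qed.

Lemma D_e2 c k x : is_derive x e2 (D c k) (H c c2 k x).
Proof.
have d := is_derive_chain (is_derive_dot2_e2 (lam k) x) (is_derive_dpsi (p k) (q k) _).
have := is_derive_cmul (c k / sqn (lam k)) d.
under eq_fun do rewrite mulrAC.
by move=> /is_derive_eq; apply; rewrite /H /c2 /trig; ring.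
Qed.

Lemma H_continuous c d : coord c -> coord d -> continuous (fun x => ssum ((H c d)^~ x)).
Proof.
move=> cc cd; apply: (ssum_continuous bw); last by move=> x k; exact: H_le.
move=> k x; have ct := TP_continuous (TP_scale (c k * d k / sqn (lam k)) (TP_trigE (p k) (q k) (lam k))).
rewrite (_ : H c d k = fun x => c k * d k / sqn (lam k) * trig (p k) (q k) (lam k) x); first exact: ct.
by apply/funext => y; rewrite /H mulrAC.
Qed.

(** The tail costs at most (e / 2) |x|^2, by [ssum_approx] with factor |x|^2. The finitely many
    remaining terms grow linearly and are absorbed one by one, each taking half of the remaining
    allowance. *)
Lemma ssum_G_small e : 0 < e -> exists C, forall x, `|ssum (G^~ x)| <= e * sqn x + C.
Proof.
move=> e0; have e20 : 0 < e / 2 by rewrite divr_gt0.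
have [N HN] := ssum_approx bw e20.
suff [C HC] : exists C, forall x, `|\sum_(k < N) G k x| <= e / 2 * sqn x + C.
  exists C => x; have Gw k : `|G k x| <= sqn x * w k by rewrite mulrC; exact: G_le.
  have := HN (G^~ x) _ (sqn_ge0 x) Gw N (leqnn _); have := HC x.
  by rewrite !ler_norml => /andP[? ?] /andP[? ?]; apply/andP; split; lra.
elim: N (e / 2) e20 {HN} => [|N ih] d d0.
  by exists 0 => x; rewrite big_ord0 normr0 addr0 mulr_ge0 ?sqn_ge0// ltW.
have d20 : 0 < d / 2 by rewrite divr_gt0.
have [C HC] := ih _ d20; set n := sqn (lam N); have n0 : 0 < n by exact: sqn_gt0.
(* The linear growth is split as |s| <= eta s^2 + 1/eta; this [eta] keeps the quadratic part below
   (d / 2) |x|^2, the summand 1 guarding against [w N = 0]. *)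
pose eta := d / 2 / (w N + 1); have W0 : 0 < w N + 1 by rewrite ltr_wpDl.
have eta0 : 0 < eta by rewrite divr_gt0.
exists (C + w N * (2 + eta^-1) / n) => x.
rewrite big_ord_recr /=; apply: le_trans (ler_normD _ _) _.
suff : `|G N x| <= d / 2 * sqn x + w N * (2 + eta^-1) / n by have := HC x; lra.
rewrite /G normrM normfV (gtr0_norm n0) ler_pdivrMr// mulrDl divfK ?gt_eqF//.
apply: le_trans (psi_le1 _ _ _) _; rewrite -/(w N); set s := dot2 _ _.
have s1 : `|s| <= eta * s ^+ 2 + eta^-1.
  have /(_ eta) h : forall t : R, 0 < t -> `|s| <= t * s ^+ 2 + t^-1.
    move=> t t0; rewrite -(ler_pM2l t0) mulrDr mulfV ?gt_eqF// -(real_normK (num_real s)).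
    by have := sqr_ge0 (t * `|s| - 2^-1); move: (`|s|) => a; lra.
  exact: h.
have s2 : s ^+ 2 <= n * sqn x by exact: dot2_sqr_le.
have s3 : w N * (eta * s ^+ 2) <= d / 2 * sqn x * n.
  have -> : d / 2 * sqn x * n = (w N + 1) * (eta * (n * sqn x)).
    by rewrite /eta; field; rewrite gt_eqF.
  apply: ler_pM => //; first by rewrite mulr_ge0 ?sqr_ge0// ltW.
    by rewrite lerDl.
  by rewrite ler_pM2l.
have := ler_wpM2l (w0 N) s1; rewrite (mulrDr _ (eta * _)) !(mulrDr _ 2); lra.
Qed.

Lemma ssum_potential (c : R) : exists phi f1 f2 : R * R -> R,
  [/\ forall x, is_derive x e1 phi (f1 x) /\ is_derive x e2 phi (f2 x), Ck 1 f1, Ck 1 f2,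
     forall x, 'D_e1 f1 x + 'D_e2 f2 x = c + ssum (fun k => trig (p k) (q k) (lam k) x) &
     forall e, 0 < e -> exists C, forall x, `|phi x - c / 4 * sqn x| <= e * sqn x + C].
Proof.
pose f (j : nat -> R) x := ssum ((D j)^~ x).
have fe1 j x : coord j -> is_derive x e1 (f j) (ssum ((H j c1)^~ x)).
  by move=> cj; exact (is_derive_ssum_e1 bw x (D_e1 j) (sbound_D cj) (sbound_H cj coord1)).
have fe2 j x : coord j -> is_derive x e2 (f j) (ssum ((H j c2)^~ x)).
  by move=> cj; exact (is_derive_ssum_e2 bw x (D_e2 j) (sbound_D cj) (sbound_H cj coord2)).
have Cf j : coord j -> Ck 1 (f j).
  move=> cj; have k1 := H_continuous cj coord1; have k2 := H_continuous cj coord2.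
  have cf := partials_continuous (fun x => fe1 j x cj) (fun x => fe2 j x cj) k1 k2.
  exact (@Ck_intro R 0 (f j) _ _ cf (fun x => fe1 j x cj) (fun x => fe2 j x cj) k1 k2).
exists (fun x => c / 4 * (x.1 * x.1 + x.2 * x.2) + ssum (G^~ x)),
  (fun x => c / 2 * x.1 + f c1 x), (fun x => c / 2 * x.2 + f c2 x); split.
- move=> x; have d1 v := is_derive_fst x v; have d2 v := is_derive_snd x v.
  have d v := is_derive_cmul (c / 4) (is_derive_add (is_derive_mul (d1 v) (d1 v)) (is_derive_mul (d2 v) (d2 v))).
  split.
    have := is_derive_add (d e1) (is_derive_ssum_e1 bw x G_e1 sbound_G (sbound_D coord1)).
    by move=> /is_derive_eq; apply; congr (_ + _); rewrite /e1 /=; field.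
  have := is_derive_add (d e2) (is_derive_ssum_e2 bw x G_e2 sbound_G (sbound_D coord2)).
  by move=> /is_derive_eq; apply; congr (_ + _); rewrite /e2 /=; field.
- by apply: Ck_add; [apply: Ck_cmul; exact: Ck_fst|exact: Cf].
- by apply: Ck_add; [apply: Ck_cmul; exact: Ck_snd|exact: Cf].
- move=> x.
  have d1 := is_derive_add (is_derive_cmul (c / 2) (is_derive_fst x e1)) (fe1 _ x coord1).
  have d2 := is_derive_add (is_derive_cmul (c / 2) (is_derive_snd x e2)) (fe2 _ x coord2).
  rewrite (@derive_val _ _ _ _ _ _ _ d1) (@derive_val _ _ _ _ _ _ _ d2) /e1 /e2 /=.
  have := @ssum_lin _ _ _ ((H c1 c1)^~ x) ((H c2 c2)^~ x) 1 1 1 ler01 bw.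
  rewrite !mul1r => h.
  (* The squares of the two coordinates of the frequency add up to [sqn (lam k)], cancelling the
     denominator of [H]. *)
  have -> : ssum (fun k => trig (p k) (q k) (lam k) x) =
      ssum (fun k => 1 * H c1 c1 k x + 1 * H c2 c2 k x).
    congr ssum; apply/funext => k; have := sqn_gt0 (lam0 k); rewrite /H /c1 /c2 /sqn => n0.
    by field; rewrite gt_eqF.
  rewrite h; first by field.
    by move=> k; rewrite mul1r; exact: H_le.
  by move=> k; rewrite mul1r; exact: H_le.
- move=> e /ssum_G_small[C HC]; exists C => x.
  by have := HC x; congr (`|_| <= _); rewrite /sqn; ring.
Qed.

End ScalarPotential.

Lemma scalar_potential {R : realType} (b : R * R -> R) : WAP b -> exists phi f1 f2 : R * R -> R,
  [/\ forall x, is_derive x e1 phi (f1 x) /\ is_derive x e2 phi (f2 x), Ck 1 f1, Ck 1 f2,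
     forall x, 'D_e1 f1 x + 'D_e2 f2 x = b x &
     forall e, 0 < e -> exists C, forall x,
       `|phi x - complex.Re (mean_value (toC b)) / 4 * sqn x| <= e * sqn x + C].
Proof.
move=> /WAP_expansion[p [q [lam [B [lam0 bw bE]]]]].
have [phi [f1 [f2 [H1 H2 H3 H4 H5]]]] := ssum_potential bw lam0 (complex.Re (mean_value (toC b))).
by exists phi, f1, f2; split=> // x; rewrite bE.
Qed.

(** * Gaussian integrability and the kernel of L *)

Section ZeroModes.
Context {R : realType}.
Implicit Types (x : R * R) (z : R[i]).
Notation Re := (@complex.Re R).
Notation Im := (@complex.Im R).
Local Notation mu := (@lebesgue_measure R).

Lemma intble_gauss (c : R) : 0 < c -> intble (fun x => expR (- (c * sqn x))).
Proof.
(* With variance 1/(2 c) the normal density is a multiple of exp (- c t^2), so the Gaussian of the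
   plane is a multiple of a product of two densities, integrable by Tonelli. *)
move=> c0; pose s := Num.sqrt (2 * c)^-1.
have c20 : 0 < (2 * c)^-1 by rewrite invr_gt0 mulr_gt0.
have s0 : s != 0 by rewrite gt_eqF// sqrtr_gt0.
have s2 : s ^+ 2 *+ 2 = c^-1 by rewrite sqr_sqrtr ?ltW// invfM -mulr_natr; field; rewrite gt_eqF.
pose N := normal_pdf 0 s; have N0 t : 0 <= N t by exact: normal_pdf_ge0.
have cN : continuous N by exact: continuous_normal_pdf.
have cg : continuous (fun x => N x.1 * N x.2).
  move=> x; apply: cvgM.
    by apply: (@continuous_comp _ _ _ (fun x => x.1) N); [exact: continuous_fst|exact: cN].
  by apply: (@continuous_comp _ _ _ (fun x => x.2) N); [exact: continuous_snd|exact: cN].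
have mg := continuous_measurable2 cg.
have Ig : intble (fun x => N x.1 * N x.2).
  pose g x : R := N x.1 * N x.2.
  apply/integrableP; split; first exact/measurable_EFinP.
  rewrite (_ : (\int[leb2]_x _)%E = (\int[leb2]_x (g x)%:E)%E); last first.
    by apply: eq_integral => x _ /=; rewrite ger0_norm// mulr_ge0.
  rewrite fubini_tonelli1; last 2 first.
  - exact/measurable_EFinP.
  - by move=> x; rewrite lee_fin mulr_ge0.
  rewrite /fubini_F /=.
  have H t : (\int[mu]_y (N t * N y)%:E = (N t)%:E)%E.
    under eq_integral do rewrite EFinM.
    rewrite ge0_integralZl//; last 3 first.
    - by apply/measurable_EFinP; exact: measurable_normal_pdf.
    - by move=> y _; rewrite lee_fin.
    - by rewrite lee_fin.
    by rewrite integral_normal_pdf mule1.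
  by under eq_integral do rewrite H; rewrite integral_normal_pdf ltry.
have p0 := normal_peak_gt0 s0.
rewrite (_ : (fun x => _) = (fun x => (normal_peak s ^+ 2)^-1 * (N x.1 * N x.2))); first exact: intbleZ.
apply/funext => x; rewrite /N !normal_pdfE// /normal_fun !subr0 s2 !invrK /sqn mulrDr opprD expRD.
have h (t : R) : - t ^+ 2 * c = - (c * t ^+ 2) by ring.
by rewrite !h; field; rewrite gt_eqF.
Qed.

Lemma roots_bounded (P : {poly R[i]}) : P != 0 -> exists M : R, forall z, root P z -> Re z < M.
Proof.
move=> P0; have [r E] := closed_field_poly_normal P.
exists (\sum_(z <- r) `|Re z| + 1) => z.
rewrite E rootZ ?lead_coef_eq0// root_prod_XsubC => zr.
rewrite (big_rem z zr) /=; have := ler_norm (Re z).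
have : 0 <= \sum_(y <- rem z r) `|Re y| by exact: sumr_ge0.
lra.
Qed.

Variables (A : R * R -> R * R) (sg : R).
Hypotheses (hA : C1_potential A) (sg2 : sg ^+ 2 = 1).

Definition L_null (u : R * R -> R[i]) := [/\ Ck 1 (fun x => Re (u x)), Ck 1 (fun x => Im (u x)),
  forall x, LR A sg u x = 0 & forall x, LI A sg u x = 0].

Lemma L_nullP (u : R * R -> R[i]) p q p1 p2 q1 q2 : Ck 1 p -> Ck 1 q ->
  (forall x, u x = (p x +i* q x)%C) ->
  (forall x, is_derive x e1 p (p1 x)) -> (forall x, is_derive x e2 p (p2 x)) ->
  (forall x, is_derive x e1 q (q1 x)) -> (forall x, is_derive x e2 q (q2 x)) ->
  (forall x, - q1 x + (A x).1 * p x - sg * (p2 x + (A x).2 * q x) = 0) ->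
  (forall x, p1 x + (A x).1 * q x + sg * (- q2 x + (A x).2 * p x) = 0) -> L_null u.
Proof.
move=> Cp Cq /funext -> dp1 dp2 dq1 dq2 H1 H2.
split=> // x; rewrite /LR /LI /gR1 /gI1 /gR2 /gI2 /=.
  by rewrite (@derive_val _ _ _ _ _ _ _ (dq1 x)) (@derive_val _ _ _ _ _ _ _ (dp2 x)) H1.
by rewrite (@derive_val _ _ _ _ _ _ _ (dp1 x)) (@derive_val _ _ _ _ _ _ _ (dq2 x)) H2.
Qed.

Definition zvar x : R[i] := (x.1 +i* (sg * x.2))%C.

Lemma L_null0 : L_null (fun=> 0).
Proof.
apply: (@L_nullP _ (fun=> 0) (fun=> 0) (fun=> 0) (fun=> 0) (fun=> 0) (fun=> 0)) => //.
all: try exact: Ck_cst.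
all: try (by move=> x; exact: is_derive_cst).
all: by move=> x; ring.
Qed.

(** The derivative part of L is a multiple of d_1 + i sg d_2, which sends z to 1 - sg^2 = 0;
    multiplication by z thus commutes with L. *)
Lemma L_null_zvar u : L_null u -> L_null (fun x => zvar x * u x).
Proof.
move=> [Cp Cq H1 H2].
pose p x := Re (u x); pose q x := Im (u x).
have dp1 := @Ck_is_derive1 R 0 _ Cp; have dp2 := @Ck_is_derive2 R 0 _ Cp.
have dq1 := @Ck_is_derive1 R 0 _ Cq; have dq2 := @Ck_is_derive2 R 0 _ Cq.
have d1 v x := is_derive_fst x v; have d2 v x := is_derive_cmul sg (is_derive_snd x v).
apply: (L_nullP (p := fun x => x.1 * p x - sg * x.2 * q x)
  (q := fun x => x.1 * q x + sg * x.2 * p x) _ _ _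
  (fun x => is_derive_sub (is_derive_mul (d1 e1 x) (dp1 x)) (is_derive_mul (d2 e1 x) (dq1 x)))
  (fun x => is_derive_sub (is_derive_mul (d1 e2 x) (dp2 x)) (is_derive_mul (d2 e2 x) (dq2 x)))
  (fun x => is_derive_add (is_derive_mul (d1 e1 x) (dq1 x)) (is_derive_mul (d2 e1 x) (dp1 x)))
  (fun x => is_derive_add (is_derive_mul (d1 e2 x) (dq2 x)) (is_derive_mul (d2 e2 x) (dp2 x)))).
- apply: Ck_sub; first by apply: Ck_mul => //; exact: Ck_fst.
  by apply: Ck_mul => //; apply: Ck_cmul; exact: Ck_snd.
- apply: Ck_add; first by apply: Ck_mul => //; exact: Ck_fst.
  by apply: Ck_mul => //; apply: Ck_cmul; exact: Ck_snd.
- by move=> x; apply: eq_ReIm; rewrite ?ReM ?ImM.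
- move=> x; have := H1 x; have := H2 x; rewrite /LR /LI /gR1 /gI1 /gR2 /gI2 /e1 /e2 -/(p x) -/(q x) /=.
  move: ('D__ _ _) ('D__ _ _) ('D__ _ _) ('D__ _ _) (p x) (q x) => p2 q1 q2 p1 px qx h2 h1.
  apply: (@etrans _ _ (x.1 * (- q1 + (A x).1 * px - sg * (p2 + (A x).2 * qx)) -
     sg * x.2 * (p1 + (A x).1 * qx + sg * (- q2 + (A x).2 * px)) + (sg ^+ 2 - 1) * qx)); first by ring.
  by rewrite h1 h2 sg2; ring.
- move=> x; have := H1 x; have := H2 x; rewrite /LR /LI /gR1 /gI1 /gR2 /gI2 /e1 /e2 -/(p x) -/(q x) /=.
  move: ('D__ _ _) ('D__ _ _) ('D__ _ _) ('D__ _ _) (p x) (q x) => p2 q1 q2 p1 px qx h2 h1.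
  apply: (@etrans _ _ (x.1 * (p1 + (A x).1 * qx + sg * (- q2 + (A x).2 * px)) +
     sg * x.2 * (- q1 + (A x).1 * px - sg * (p2 + (A x).2 * qx)) + (1 - sg ^+ 2) * px)); first by ring.
  by rewrite h1 h2 sg2; ring.
Qed.

End ZeroModes.

(** * The zero modes and the final assembly *)

Section Assembly.
Context {R : realType}.
Implicit Types (x : R * R) (z : R[i]) (n : nat).
Notation Re := (@complex.Re R).
Notation Im := (@complex.Im R).
Variables (A : R * R -> R * R) (sg : R).
Hypotheses (hA : C1_potential A) (sg2 : sg ^+ 2 = 1).

(** This is exp (- sg phi + i chi), a nowhere vanishing function. *)
Definition base_mode (phi chi : R * R -> R) x : R[i] :=
  ((expR (- (sg * phi x)) * cos (chi x)) +i* (expR (- (sg * phi x)) * sin (chi x)))%C.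

(* [chi] is a gauge transformation carrying [A] to the Coulomb potential
   (- f2, f1). *)
Lemma L_null_base_mode phi chi f1 f2 : Ck 1 phi -> Ck 1 chi ->
  (forall x, is_derive x e1 phi (f1 x) /\ is_derive x e2 phi (f2 x)) ->
  (forall x, is_derive x e1 chi ((A x).1 + f2 x) /\ is_derive x e2 chi ((A x).2 - f1 x)) ->
  L_null A sg (base_mode phi chi).
Proof.
move=> Cphi Cchi dphi dchi.
pose E x := expR (- (sg * phi x)).
have dE v x df : is_derive x v phi df -> is_derive x v E (E x * - (sg * df)).
  by move=> d; exact (is_derive_chain (is_derive_opp (is_derive_cmul sg d)) (is_derive_expR _)).
have dc v x df : is_derive x v chi df -> is_derive x v (fun x => cos (chi x)) (- sin (chi x) * df).
  by move=> d; exact (is_derive_chain d (is_derive_cos _)).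
have ds v x df : is_derive x v chi df -> is_derive x v (fun x => sin (chi x)) (cos (chi x) * df).
  by move=> d; exact (is_derive_chain d (is_derive_sin _)).
have CE : Ck 1 E.
  apply: (C1_comp (@is_derive_expR R) (@continuous_expR R)).
  by apply: Ck_opp; apply: Ck_cmul.
have Cc : Ck 1 (fun x => cos (chi x)).
  apply: (C1_comp (@is_derive_cos R) _ Cchi) => t.
  by apply: cvgN; exact: continuous_sin.
have Cs : Ck 1 (fun x => sin (chi x)).
  exact (C1_comp (@is_derive_sin R) (@continuous_cos R) Cchi).
apply: (L_nullP (p := fun x => E x * cos (chi x)) (q := fun x => E x * sin (chi x)) _ _ _
  (fun x => is_derive_mul (dE _ _ _ (dphi x).1) (dc _ _ _ (dchi x).1))
  (fun x => is_derive_mul (dE _ _ _ (dphi x).2) (dc _ _ _ (dchi x).2))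
  (fun x => is_derive_mul (dE _ _ _ (dphi x).1) (ds _ _ _ (dchi x).1))
  (fun x => is_derive_mul (dE _ _ _ (dphi x).2) (ds _ _ _ (dchi x).2))).
- exact: Ck_mul.
- exact: Ck_mul.
- by [].
- move=> x; apply: (@etrans _ _ ((sg ^+ 2 - 1) * (f2 x * E x * cos (chi x)))); first by ring.
  by rewrite sg2 subrr mul0r.
- move=> x; apply: (@etrans _ _ ((sg ^+ 2 - 1) * (f2 x * E x * sin (chi x)))); first by ring.
  by rewrite sg2 subrr mul0r.
Qed.

Definition mode (phi chi : R * R -> R) n x : R[i] := zvar sg x ^+ n * base_mode phi chi x.

Lemma L_null_mode phi chi n : L_null A sg (base_mode phi chi) -> L_null A sg (mode phi chi n).
Proof.
move=> L0; elim: n => [|n ih].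
  by have -> : mode phi chi 0 = base_mode phi chi by apply/funext => x; rewrite /mode expr0 mul1r.
have := L_null_zvar sg2 ih; congr L_null; apply/funext => x.
by rewrite /mode exprS mulrA.
Qed.

Definition nrm2 z : R := Re z ^+ 2 + Im z ^+ 2.

Lemma nrm2M z w : nrm2 (z * w) = nrm2 z * nrm2 w.
Proof. by rewrite /nrm2 ReM ImM; ring. Qed.

Lemma nrm2_mode phi chi n x :
  nrm2 (mode phi chi n x) = sqn x ^+ n * expR (- (sg * phi x)) ^+ 2.
Proof.
rewrite /mode nrm2M; congr (_ * _).
  elim: n => [|n ih]; first by rewrite !expr0 /nrm2 /=; ring.
  rewrite !exprS nrm2M ih; congr (_ * _).
  by rewrite /nrm2 /zvar /sqn /= exprMn sg2 mul1r.
by rewrite /nrm2 /base_mode /= !exprMn -mulrDr cos2Dsin2 mulr1.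
Qed.

Lemma base_mode_neq0 phi chi x : base_mode phi chi x != 0.
Proof.
apply/eqP => h; have := nrm2_mode phi chi 0 x.
rewrite /mode expr0 mul1r mul1r h /nrm2 /= expr0n /= addr0 => /esym/eqP.
by rewrite expf_eq0 /= gt_eqF// expR_gt0.
Qed.

Lemma in_L2_mode phi chi (beta : R) n : 0 < sg * beta -> L_null A sg (mode phi chi n) ->
  (forall e : R, 0 < e -> exists C : R, forall x,
     `|phi x - beta / 4 * sqn x| <= e * sqn x + C) ->
  in_L2 (mode phi chi n).
Proof.
move=> b0 [Cr Ci _ _] Hphi; set bt := sg * beta in b0.
have nsg : `|sg| = 1.
  by apply/eqP; rewrite -(@eqrXn2 _ 2)// ?normr_ge0// real_normK ?num_real// sg2 expr1n.
(* Here bt / 4 = 2 c, so an error c |x|^2 + C leaves sg phi >= c |x|^2 - C. Of the decay exp (- 2 c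
   |x|^2) of the squared modulus, one half absorbs |x|^(2 n) and the other stays an integrable
   Gaussian. *)
pose c := bt / 8; have c0 : 0 < c by rewrite divr_gt0.
have [C HC] := Hphi _ c0; have [K HK] := exp_poly_bound ('X^n : {poly R}).
have K0 : 0 <= K.
  by have := HK 0 (lexx _); rewrite expR0 mulr1; apply: le_trans.
have key x : nrm2 (mode phi chi n x) <=
    K * c^-1 ^+ n * expR (C *+ 2) * expR (- (c * sqn x)).
  rewrite nrm2_mode.
  have y0 : 0 <= c * sqn x by rewrite mulr_ge0 ?sqn_ge0// ltW.
  have h1 : sqn x ^+ n <= c^-1 ^+ n * (K * expR (c * sqn x)).
    have -> : sqn x ^+ n = c^-1 ^+ n * (c * sqn x) ^+ n.
      by rewrite -exprMn mulrA mulVf ?gt_eqF// mul1r.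
    rewrite ler_wpM2l ?exprn_ge0 ?invr_ge0 ?(ltW c0)//.
    by have := HK _ y0; rewrite hornerXn; apply: le_trans; exact: ler_norm.
  have h2 : expR (- (sg * phi x)) ^+ 2 <= expR (C *+ 2) * expR (- (c * sqn x) *+ 2).
    rewrite -expRM_natl -expRD ler_expR.
    have : `|sg * (phi x - beta / 4 * sqn x)| <= c * sqn x + C by rewrite normrM nsg mul1r.
    have -> : sg * (phi x - beta / 4 * sqn x) = sg * phi x - c * 2 * sqn x.
      by rewrite /c /bt; field.
    by rewrite ler_norml => /andP[h _]; lra.
  apply: (@le_trans _ _ (c^-1 ^+ n * (K * expR (c * sqn x)) *
      (expR (C *+ 2) * expR (- (c * sqn x) *+ 2)))).
    by apply: ler_pM h1 h2; [exact/exprn_ge0/sqn_ge0|exact: sqr_ge0].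
  have -> : expR (- (c * sqn x) *+ 2) = expR (- (c * sqn x)) * expR (- (c * sqn x)).
    by rewrite -expRD.
  have e0 : expR (c * sqn x) * expR (- (c * sqn x)) = 1 by rewrite -expRD subrr expR0.
  rewrite le_eqVlt; apply/orP; left; apply/eqP.
  move: e0; move: (expR (c * sqn x)) (expR (- (c * sqn x))) => s t st.
  apply: (@etrans _ _ (K * c^-1 ^+ n * expR (C *+ 2) * t * (s * t))); first by ring.
  by rewrite st mulr1.
have Ig := intbleZ (K * c^-1 ^+ n * expR (C *+ 2)) (intble_gauss c0).
apply/in_L2P; split.
  apply: (L2r_le _ Ig); first exact (continuous_measurable2 (Ck_continuous Cr)).
  by move=> x; apply: le_trans (key x); rewrite /nrm2 lerDl sqr_ge0.
apply: (L2r_le _ Ig); first exact (continuous_measurable2 (Ck_continuous Ci)).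
by move=> x; apply: le_trans (key x); rewrite /nrm2 lerDr sqr_ge0.
Qed.

(** A combination of modes is a polynomial in z times a nowhere vanishing function; a nonzero
    polynomial has no root in some right half-plane, which contains a square of positive measure. *)
Lemma mode_free phi chi n (c : 'I_n -> R[i]) :
  {ae leb2, forall x, \sum_(i < n) c i * mode phi chi i x = 0} -> forall i, c i = 0.
Proof.
move=> [N [mN N0 HN]] i.
(* [insub] carries the coefficients from ordinals to naturals; the default 0 is never reached below
   [n]. *)
pose P := \poly_(j < n) oapp c 0 (insub j).
suff P0 : P = 0.
  by have := coef_poly n (fun j => oapp c 0 (insub j)) i; rewrite -/P P0 coef0 ltn_ord valK.
apply/eqP; apply: contraT => /roots_bounded[M HM].
(* A unit square, of measure 1, on which Re z = x_1 exceeds the real part of every root; it would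
   have to lie in the null set [N]. *)
pose Q : set (R * R) := `]M, (M + 1)[%classic `*` `]0, 1[%classic.
have mQ : measurable Q by apply: measurableX; exact: measurable_itv.
suff QN : Q `<=` N.
  have : (leb2 Q <= leb2 N)%E by apply: le_measure; rewrite ?inE.
  rewrite N0 /Q leb2_box; try exact: measurable_itv.
  rewrite !lebesgue_measure_itv /= !lte_fin ltrDl ltr01 -!EFinB -EFinM lee_fin.
  have -> : (M + 1 - M) * (1 - 0) = 1 :> R by ring.
  by rewrite ler10.
move=> x [/= x1 _]; apply: HN => /= h.
have : root P (zvar sg x).
  rewrite rootE /P horner_poly; apply/eqP/(mulIf (base_mode_neq0 phi chi x)).
  rewrite mul0r -[RHS]h mulr_suml; apply: eq_bigr => j _.
  by rewrite valK /= mulrA.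
move=> /HM /=; move: x1; rewrite in_itv/= => /andP[h1 _] h2.
by have := lt_trans h1 h2; rewrite ltxx.
Qed.

End Assembly.

Lemma mag_op_L_null {R : realType} (A : R * R -> R * R) (b : R * R -> R) (sg : R)
    (u : R * R -> R[i]) :
  WAP b -> C1_potential A -> (forall x, curl A x = b x) -> sg ^+ 2 = 1 ->
  L_null A sg u -> in_L2 u -> mag_op A u (fun x => ((sg * b x)%:C)%C * u x).
Proof.
move=> Wb hA hcurl sg2 [Cr Ci Lr Li] Lu.
have [B bB] := WAP_bounded Wb.
have [un aun] := exists_approximants hA sg2 Cr Ci Lu Lr Li.
exact (zero_mode hA hcurl sg2 (WAP_continuous Wb) bB Lu aun).
Qed.

(** Supplies the other spin component of each zero mode, which is identically 0. *)
Lemma mag_op0 {R : realType} (A : R * R -> R * R) (b : R * R -> R) :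
  WAP b -> C1_potential A -> (forall x, curl A x = b x) -> mag_op A (fun=> 0) (fun=> 0).
Proof.
move=> Wb hA hcurl.
have L20 : in_L2 (fun _ : R * R => 0 : R[i]).
  by apply/in_L2P; split; apply: (@L2r_compact R _ 0) => // x; exact: cvg_cst.
have := mag_op_L_null Wb hA hcurl (expr1n _ 2) (L_null0 A 1) L20.
by congr mag_op; apply/funext => x; rewrite mulr0.
Qed.

Lemma pair_lincomb {R : realType} n (c : 'I_n -> R[i]) (U : 'I_n -> R[i] * R[i]) :
  \sum_(i < n) c i *: U i = (\sum_(i < n) c i * (U i).1, \sum_(i < n) c i * (U i).2).
Proof. by elim/big_rec3: _ => [|i x y z _ ->]. Qed.

Theorem proposition4p2 (R : realType) (b : R * R -> R)
    (hb : WAP b) (hb0 : mean_value (toC b) != 0)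
    (A : R * R -> R * R) (hA : C1_potential A)
    (hcurl : forall x : R * R, curl A x = b x) :
  pauli_ker_infinite_dim A b.
Proof.
have [phi [f1 [f2 [dphi Cf1 Cf2 lap grow]]]] := scalar_potential hb.
set beta := complex.Re (mean_value (toC b)) in grow.
have beta0 : beta != 0.
  (* The mean value of a real function is real, so it is nonzero exactly when [beta] is. *)
  apply: contra hb0 => /eqP b0; apply/eqP/eq_ReIm; [exact: b0|exact: Im_mean_value].
have [CA1 CA2] := hA.
have c1 := Ck_add CA1 Cf2; have c2 := Ck_sub CA2 Cf1.
(* Subtracting the Coulomb potential (- f2, f1) from [A] leaves curl b - Laplace phi = 0, so the
   difference is a gradient. *)
have closed x : 'D_e1 (fun x => (A x).2 - f1 x) x = 'D_e2 (fun x => (A x).1 + f2 x) x.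
  have d1 := is_derive_sub (@Ck_is_derive1 R 0 _ CA2 x) (@Ck_is_derive1 R 0 _ Cf1 x).
  have d2 := is_derive_add (@Ck_is_derive2 R 0 _ CA1 x) (@Ck_is_derive2 R 0 _ Cf2 x).
  rewrite (@derive_val _ _ _ _ _ _ _ d1) (@derive_val _ _ _ _ _ _ _ d2).
  have := hcurl x; rewrite -lap /curl.
  move: ('D__ _ _) ('D__ _ _) ('D__ _ _) ('D__ _ _) => p q r s h.
  by apply/eqP; rewrite -subr_eq0; apply/eqP; move/eqP: h; rewrite -subr_eq0 => /eqP <-; ring.
have [chi [Cchi dchi]] := potential_exists c1 c2 closed.
have Cphi : Ck 1 phi.
  have k1 := Ck_continuous Cf1; have k2 := Ck_continuous Cf2.
  have d1 x := (dphi x).1; have d2 x := (dphi x).2.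
  exact (@Ck_intro R 0 phi f1 f2 (partials_continuous d1 d2 k1 k2) d1 d2 k1 k2).
pose sg : R := if 0 < beta then 1 else -1.
have sg2 : sg ^+ 2 = 1 by rewrite /sg; case: ifP; rewrite ?sqrrN expr1n.
have sgb : 0 < sg * beta.
  rewrite /sg; case: (ltP 0 beta) => h; first by rewrite mul1r.
  by rewrite mulN1r oppr_gt0 lt_neqAle beta0.
pose u i := mode sg phi chi i.
have Lu i : L_null A sg (u i) by apply: (L_null_mode sg2); exact: (L_null_base_mode sg2 Cphi Cchi).
have u2 i : in_L2 (u i) by exact: (in_L2_mode sg2 sgb (Lu i) grow).
have op i := mag_op_L_null hb hA hcurl sg2 (Lu i) (u2 i).
have op0 := mag_op0 hb hA hcurl.
(* The modes satisfy h u = sg b u, so they belong to the component h - b when [beta] is positive and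
   to h + b when it is negative. *)
move=> n; exists (fun i x => if 0 < beta then (u i x, 0) else (0, u i x)); split.
  move=> i; move: (op i); rewrite /sg; case: ifP => _ opi.
    exists (fun x => ((1 * b x)%:C)%C * u i x), (fun=> 0); split; [exact: opi|exact: op0|].
    by apply: aeW => x /=; rewrite mul1r /toC subrr mulr0 addr0.
  exists (fun=> 0), (fun x => ((-1 * b x)%:C)%C * u i x); split; [exact: op0|exact: opi|].
  by apply: aeW => x /=; rewrite mulr0 subrr mulN1r /toC raddfN mulNr addNr.
move=> c H; apply: (mode_free sg2 (phi := phi) (chi := chi)).
have [N [mN N0 HN]] := H; exists N; split=> //; apply: subset_trans HN => x /= nx.
rewrite pair_lincomb => h; apply: nx.
have := congr1 fst h; have := congr1 snd h; rewrite /=; case: (0 < beta) => h2 h1.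
  exact: h1.
exact: h2.
Qed.
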